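(* Let $M$ be a communicating MDP with $|S|$ states, $|A|$ actions and diameter $D$, and suppose that $M$ has a state $s^*$ and an action $a$ such that $\Pr(s_{t+1}=s^*\mid s_t=s^*,a_t=a)=1$. Suppose the start distribution has probability at least $\alpha$ on every state. Then, given access to the optimization oracle $\mathcal{O}$, there is an efficient algorithm with $$\text{Regret}\le O\left(D^2\sqrt{\frac{L^*|S|\log(|S||A|)}{\alpha}}\right),$$ where $L^*$ is the total expected loss of the best stationary deterministic policy in hindsight.
   Context: An MDP has a finite state space $S$, a finite action space $A$ and transition probabilities $P(s,a,s')$, known to the learner. A stationary policy is a map $\pi:S\times A\to[0,1]$ with $\pi(s,a)$ the probability of taking action $a$ in state $s$; it is deterministic if it always takes one action $\pi(s)$ in each state $s$. $T(s'\mid M,\pi,s)$ is the random first time step at which $s'$ is reached when starting at $s$ and following $\pi$ in $M$. The diameter is $D=D(M)=\max_{s\ne s'}\min_\pi\mathbb{E}[T(s'\mid M,\pi,s)]$, and $M$ is communicating if $D(M)<\infty$. Protocol: an oblivious adversary fixes in advance loss functions $\ell_1,\dots,\ell_T:S\times A\to[0,1]$. The start state is $s_1\sim d_1$, with $\Pr[s_1=s]\ge\alpha$ for all $s\in S$. At each step $t=1,\dots,T$ the learner, in state $s_t$, chooses (possibly at random) an action $a_t$, incurs loss $\ell_t(s_t,a_t)$, the whole function $\ell_t$ is then revealed (full information), and $s_{t+1}\sim P(s_t,a_t,\cdot)$. The loss of a stationary policy $\pi$ is $L^\pi=\mathbb{E}\left[\sum_{t=1}^T\ell_t(s_t,a_t)\right]$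 with $s_1\sim d_1$, $a_t\sim\pi(s_t,\cdot)$, $s_{t+1}\sim P(s_t,a_t,\cdot)$; $L^*=\min_\pi L^\pi$ over stationary deterministic policies. The regret of an algorithm is its expected total loss minus $L^*$. The oracle $\mathcal{O}$ takes in a sequence of loss functions and returns, at no computational cost, the stationary deterministic policy with the lowest expected cumulative loss when started from $s_1\sim d_1$. Efficient means running in polynomial time when given access to $\mathcal{O}$.
   Formalization: The regret bound is claimed, with one absolute constant, only when L* >= |S| ln(|S||A|)/alpha, since for L* = 0 it would assert zero regret, which is false (T = 1, two actions with losses 0 and 1); efficiency is claimed without this condition, and |S| >= 2 is assumed so that D is defined. *)

(* Defs.v *)
From HB Require Import structures.
From mathcomp Require Import all_boot all_order all_algebra.
From mathcomp Require Import all_classical all_reals all_analysis.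

Set Implicit Arguments.
Unset Strict Implicit.
Unset Printing Implicit Defensive.

Import Order.TTheory GRing.Theory Num.Theory.

Local Open Scope ring_scope.

(** * Finitely supported distributions *)

(* Weighted outcome lists, combined as in the probability monad. An outcome may
   occur several times in a list; its probability is the sum of its weights. *)
Section FiniteDistributions.
Variable R : realType.

Definition is_dist (F : finType) (p : F -> R) : Prop :=
  (forall x, 0 <= p x) /\ \sum_x p x = 1.

Definition fdist (X : Type) := seq (R * X).

Definition ret (X : Type) (x : X) : fdist X := [:: (1, x)].

Definition bind (X Y : Type) (mu : fdist X) (f : X -> fdist Y) : fdist Y :=
  [seq (u.1 * v.1, v.2) | u <- mu, v <- f u.2].

Definition draw (F : finType) (p : F -> R) : fdist F :=
  [seq (p x, x) | x <- enum F].

Definition expect (X : Type) (mu : fdist X) (f : X -> R) : R :=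
  \sum_(u <- mu) u.1 * f u.2.

End FiniteDistributions.

(** * Markov decision processes *)

(* S = 'I_nS and A = 'I_nA, so that an algorithm can name states and actions by
   numbers. A loss function has type {ffun 'I_nS * 'I_nA -> R}, and the length
   of the sequence of loss functions is the horizon T. *)
Section MDP.
Variables (R : realType) (nS nA : nat) (P : 'I_nS -> 'I_nA -> 'I_nS -> R).

Definition loss := {ffun 'I_nS * 'I_nA -> R}.

Definition losses01 (ls : seq loss) : Prop :=
  forall l, l \in ls -> forall sa, 0 <= l sa <= 1.

Definition stationary (pi : 'I_nS -> 'I_nA -> R) : Prop :=
  forall s, is_dist (pi s).

Definition point (F : finType) (x y : F) : R := (y == x)%:R.

Definition det (f : {ffun 'I_nS -> 'I_nA}) : 'I_nS -> 'I_nA -> R :=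
  fun s => point (f s).

(* The law of the first n state-action pairs, with first state drawn from mu. *)
Fixpoint rollout (pi : 'I_nS -> 'I_nA -> R) (n : nat) (mu : 'I_nS -> R) :
    fdist R (seq ('I_nS * 'I_nA)) :=
  if n is n'.+1 then
    bind (draw mu) (fun s =>
    bind (draw (pi s)) (fun a =>
    bind (rollout pi n' (P s a)) (fun w =>
    ret R ((s, a) :: w))))
  else ret R [::].

Definition hit_pmf pi (s' s : 'I_nS) (k : nat) : R :=
  expect (rollout pi k.+1 (point s))
    (fun w => (find (fun sa : 'I_nS * 'I_nA => sa.1 == s') w == k)%:R).

(* E[T(s' | M, pi, s)] for T with values in {0, 1, ...} U {+oo}, time being
   counted from 0 at the start state; recall that +oo * 0 = 0 in \bar R. *)
Definition hitting_time pi (s' s : 'I_nS) : \bar R :=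
  (\sum_(0 <= k <oo) (k%:R * hit_pmf pi s' s k)%:E
   + +oo * (1 - \sum_(0 <= k <oo) (hit_pmf pi s' s k)%:E))%E.

Definition diameter : \bar R :=
  \big[Order.max/-oo%E]_(q : 'I_nS * 'I_nS | q.1 != q.2)
    ereal_inf [set hitting_time pi q.2 q.1 | pi in stationary].

Definition communicating : Prop := (diameter < +oo)%E.

Variable d1 : 'I_nS -> R.

Definition policy_loss (pi : 'I_nS -> 'I_nA -> R) (ls : seq loss) : R :=
  expect (rollout pi (size ls) d1)
    (fun w => \sum_(u <- zip ls w) (u.1 : loss) u.2).

Definition best_loss (ls : seq loss) : R :=
  inf (range (fun f : {ffun 'I_nS -> 'I_nA} => policy_loss (det f) ls)).

(* Nothing is required on queries that are not [0,1]-valued, nor on how ties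
   are broken. *)
Definition is_oracle (O : seq loss -> {ffun 'I_nS -> 'I_nA}) : Prop :=
  forall ls, losses01 ls ->
  forall f, policy_loss (det (O ls)) ls <= policy_loss (det f) ls.

End MDP.

(** * Algorithms: a randomized real RAM with an optimization oracle *)

(* Memory consists of arrays of naturals and arrays of reals, addressed by an
   array name and a list of indices; scalars are arrays read at [::].
   A program is a finite object that does not depend on the instance: its only
   literals are natural numbers. A real operation is a field operation or a
   comparison (there is no rounding), and naturals are only added, subtracted
   and compared, so that unit cost is a realistic measure for them. *)

Inductive nexp :=
| NConst of nat
| NGet of nat & seq nexp
| NAdd of nexp & nexp
| NSub of nexp & nexp.

Inductive rexp :=
| RNat of nexp
| RGet of nat & seq nexp
| RAdd of rexp & rexp
| ROpp of rexp
| RMul of rexp & rexp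
| RInv of rexp.

Inductive bexp :=
| BLeN of nexp & nexp
| BLeR of rexp & rexp
| BNot of bexp
| BAnd of bexp & bexp.

(* Flip x i p: store 1 in the natural cell x[i] with probability p (clipped to
   [0,1]), and 0 otherwise.
   Query q n y: call the oracle on the loss functions stored in the real array
   q, namely (s, a) |-> q[t; s; a] for t < n, and store the answer in the
   natural array y, as y[s] for each state s. *)
Inductive cmd :=
| Skip
| NSet of nat & seq nexp & nexp
| RSet of nat & seq nexp & rexp
| Seq of cmd & cmd
| If of bexp & cmd & cmd
| While of bexp & cmd
| Flip of nat & seq nexp & rexp
| Query of nat & nexp & nat.

Section Semantics.
Variable R : realType.

Record mem := Mem {
  nmem : nat -> seq nat -> nat;
  rmem : nat -> seq nat -> R }.

Definition nset (m : mem) x (i : seq nat) (v : nat) : mem :=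
  Mem (fun y j => if (y == x) && (j == i) then v else nmem m y j) (rmem m).

Definition rset (m : mem) x (i : seq nat) (v : R) : mem :=
  Mem (nmem m) (fun y j => if (y == x) && (j == i) then v else rmem m y j).

Fixpoint neval (m : mem) (e : nexp) : nat :=
  match e with
  | NConst n => n
  | NGet x i => nmem m x (map (neval m) i)
  | NAdd e1 e2 => (neval m e1 + neval m e2)%N
  | NSub e1 e2 => (neval m e1 - neval m e2)%N
  end.

Fixpoint reval (m : mem) (e : rexp) : R :=
  match e with
  | RNat n => (neval m n)%:R
  | RGet x i => rmem m x (map (neval m) i)
  | RAdd e1 e2 => reval m e1 + reval m e2
  | ROpp e1 => - reval m e1
  | RMul e1 e2 => reval m e1 * reval m e2
  | RInv e1 => (reval m e1)^-1
  end.

Fixpoint beval (m : mem) (b : bexp) : bool :=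
  match b with
  | BLeN e1 e2 => (neval m e1 <= neval m e2)%N
  | BLeR e1 e2 => reval m e1 <= reval m e2
  | BNot b1 => ~~ beval m b1
  | BAnd b1 b2 => beval m b1 && beval m b2
  end.

Definition clip (p : R) : R := Num.max 0 (Num.min 1 p).

Variables (nS nA : nat).
Variable O : seq (loss R nS nA) -> {ffun 'I_nS -> 'I_nA}.

Definition read_loss (m : mem) (q t : nat) : loss R nS nA :=
  [ffun sa => rmem m q [:: t; val sa.1; val sa.2]].

Definition write_policy (m : mem) (y : nat) (f : {ffun 'I_nS -> 'I_nA}) : mem :=
  foldl (fun m' s => nset m' y [:: val s] (val (f s))) m (enum 'I_nS).

(* Runs the commands of the stack K for at most n steps, a step being the
   execution of one command or loop test; None marks the runs that have not
   terminated by then. *)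
Fixpoint run (n : nat) (K : seq cmd) (m : mem) : fdist R (option mem) :=
  match K with
  | [::] => ret R (Some m)
  | c :: K' =>
    match n with
    | 0 => ret R None
    | n'.+1 =>
      match c with
      | Skip => run n' K' m
      | NSet x i e => run n' K' (nset m x (map (neval m) i) (neval m e))
      | RSet x i e => run n' K' (rset m x (map (neval m) i) (reval m e))
      | Seq c1 c2 => run n' [:: c1, c2 & K'] m
      | If b c1 c2 => run n' ((if beval m b then c1 else c2) :: K') m
      | While b c1 =>
          run n' (if beval m b then [:: c1, While b c1 & K'] else K') m
      | Flip x i e =>
          let p := clip (reval m e) in
          bind [:: (p, 1%N); (1 - p, 0%N)]
            (fun v => run n' K' (nset m x (map (neval m) i) v))
      | Query q e y =>
          let ls := [seq read_loss m q t | t <- iota 0 (neval m e)] in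
          run n' K' (write_policy m y (O ls))
      end
    end
  end.

End Semantics.

(** * The online protocol *)

(* Array names through which an algorithm communicates with its environment. *)
Definition n_states := 0%N.  (* natural, holds |S| *)
Definition n_actions := 1%N. (* natural, holds |A| *)
Definition horizon := 2%N.   (* natural, holds T *)
Definition round := 3%N.     (* natural, holds t, counted from 0 *)
Definition state := 4%N.     (* natural, holds s_t *)
Definition action := 5%N.    (* natural, where the algorithm leaves a_t *)
Definition trans := 0%N.     (* real, trans[s; a; s'] = P(s, a, s') *)
Definition start := 1%N.     (* real, start[s] = d_1(s) *)
Definition past := 2%N.      (* real, past[t; s; a] = l_t(s, a) once revealed *)

Section Protocol.
Variables (R : realType) (nS nA : nat) (P : 'I_nS -> 'I_nA -> 'I_nS -> R).
Variables (d1 : 'I_nS -> R) (O : seq (loss R nS nA) -> {ffun 'I_nS -> 'I_nA}).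

Definition load (n : nat) (v : 'I_n -> R) (i : nat) : R :=
  if insub i is Some j then v j else 0.

Definition init_mem (T : nat) (s : 'I_nS) : mem R :=
  Mem
    (fun x i =>
       if i is [::] then
         if x == n_states then nS
         else if x == n_actions then nA
         else if x == horizon then T
         else if x == state then val s
         else 0%N
       else 0%N)
    (fun x i =>
       match i with
       | [:: j] => if x == start then load d1 j else 0
       | [:: j; k; l] =>
         if x == trans then
           load (fun s => load (fun a => load (P s a) l) k) j
         else 0
       | _ => 0
       end).

Definition reveal (t : nat) (l : loss R nS nA) (s' : 'I_nS) (m : mem R) :
    mem R :=
  Mem (nmem (nset (nset m round [::] t.+1) state [::] s'))
    (fun x i =>
       match i with
       | [:: t'; j; k] =>
         if (x == past) && (t' == t) then
           load (fun s => load (fun a => l (s, a)) k) j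
         else rmem m x i
       | _ => rmem m x i
       end).

(* The algorithm is run once per round, for at most n steps, and its memory
   persists between rounds. The outcome is the total loss, or None if in some
   round it did not terminate or did not leave a valid action. *)
Fixpoint play (n : nat) (alg : cmd) (t : nat) (ls : seq (loss R nS nA))
    (s : 'I_nS) (m : mem R) : fdist R (option R) :=
  if ls is l :: ls' then
    bind (run O n [:: alg] m) (fun om =>
      if om is Some m' then
        if insub (nmem m' action [::]) is Some a then
          bind (draw (P s a)) (fun s' =>
          bind (play n alg t.+1 ls' s' (reveal t l s' m')) (fun r =>
          ret R (omap (fun x => l (s, a) + x) r)))
        else ret R None
      else ret R None)
  else ret R (Some 0).

Definition game (n : nat) (alg : cmd) (ls : seq (loss R nS nA)) :
    fdist R (option R) :=
  bind (draw d1) (fun s => play n alg 0 ls s (init_mem (size ls) s)).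

Definition completes (n : nat) (alg : cmd) (ls : seq (loss R nS nA)) : Prop :=
  all (fun u => (0 < u.1) ==> isSome u.2) (game n alg ls).

Definition regret (n : nat) (alg : cmd) (ls : seq (loss R nS nA)) : R :=
  expect (game n alg ls) (odflt 0) - best_loss P d1 ls.

End Protocol.

(* Main.v *)
(* The learner follows a perturbed leader. The perturbation consists of one
   truncated geometric count g(s, a) for each state-action pair, drawn once and
   for all. It reaches the oracle through the first loss function, divided by
   d1(s), so that a policy f gains a multiple of the sum of the g(s, f(s)). The
   multiple is a scale n that grows like the square root of the loss of the best
   policy so far over |S|^2 log(|S||A|). The perturbed leaders lose
   O(n |S|^2 log(|S||A|)) more than the best policy and, the noise being
   memoryless, switch that rarely in expectation. Finally |S|^2 <= |S| / alpha.

   After a switch, the state is not distributed as if the new policy f had been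
   followed from the start. The learner repairs this by drawing a state y from the
   law that f would give H rounds later and aiming at y with the policy that
   reaches y after exactly H rounds with the largest probability. It accepts an
   arrival with the probability that makes the overall chance of success equal to
   theta for all y and all departure states, and tries again after a failure: a
   switch costs H / theta rounds on average. As one can wait in s*, every state is
   reached from every other one after exactly 2K rounds, where K is about
   2 (D + 1), with probability at least 1 / (4 (K + 1)): go to s*, wait there, and
   leave at the best moment. The best choice of H thus gives H / theta = O(D^2). *)

Require Import Defs.
From HB Require Import structures.
From mathcomp Require Import all_boot all_order all_algebra.
From mathcomp Require Import all_classical all_reals all_analysis.
From mathcomp Require Import ring lra zify.

Set Implicit Arguments.
Unset Strict Implicit.
Unset Printing Implicit Defensive.

Import Order.TTheory GRing.Theory Num.Theory.

Local Open Scope ring_scope.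

(** * Finite distributions and policy losses *)

(** A bound in [Lstar] rather than in the horizon T needs a switch probability proportional to the
    loss of the round. A loss h moves the threshold at which a count makes an action optimal by at
    most h T / n; with coin bias p = 1 / (|S| T), the sum over the |S| states gives a switch
    probability of at most h / n plus O(1 / T). The expected number of switches is thus about the
    leader's own loss divided by n, and as n >= 2 it can be absorbed into that loss. Counts are
    geometric because the machine only has coins, and capped because it must stop.

    A success probability that depends neither on the target nor on the departure state keeps the
    chase analysis recursive: after a success the state has the law of the current policy, after a
    failure the same bound applies from an arbitrary state. A chase cut short by a new switch costs
    at most H rounds.

    All of this is proved for [value], a recursion for fixed noise and so for a fixed sequence of
    policies. The program is tied to it backwards: each command comes with a bound on the expected
    value of what remains. *)

Section FDist.
Variable R : realType.

Lemma bind_cons (X Y : Type) (u : R * X) mu (f : X -> fdist R Y) :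
  bind (u :: mu) f = [seq (u.1 * v.1, v.2) | v <- f u.2] ++ bind mu f.
Proof. by []. Qed.

Lemma bind_cat (X Y : Type) (mu nu : fdist R X) (f : X -> fdist R Y) :
  bind (mu ++ nu) f = bind mu f ++ bind nu f.
Proof. by elim: mu => //= u mu IH; rewrite !bind_cons IH catA. Qed.

Lemma bind_ret (X Y : Type) (x : X) (f : X -> fdist R Y) : bind (ret R x) f = f x.
Proof.
rewrite /ret bind_cons cats0 /=.
by rewrite -[RHS]map_id; apply: eq_map => -[w y] /=; rewrite mul1r.
Qed.

Lemma bindA (X Y Z : Type) (mu : fdist R X) (f : X -> fdist R Y)
    (g : Y -> fdist R Z) :
  bind (bind mu f) g = bind mu (fun x => bind (f x) g).
Proof.
elim: mu => //= u mu IH; rewrite !bind_cons bind_cat IH; congr (_ ++ _).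
elim: (f u.2) => //= v nu IHn; rewrite !bind_cons map_cat IHn; congr (_ ++ _).
by rewrite -map_comp; apply: eq_map => -[w z] /=; rewrite mulrA.
Qed.

Lemma expect_nil (X : Type) (f : X -> R) : expect [::] f = 0.
Proof. by rewrite /expect big_nil. Qed.

Lemma expect_cons (X : Type) u (mu : fdist R X) f :
  expect (u :: mu) f = u.1 * f u.2 + expect mu f.
Proof. by rewrite /expect big_cons. Qed.

Lemma expect_ret (X : Type) (x : X) f : expect (ret R x) f = f x.
Proof. by rewrite /ret expect_cons expect_nil addr0 mul1r. Qed.

Lemma expect_cat (X : Type) (mu nu : fdist R X) f :
  expect (mu ++ nu) f = expect mu f + expect nu f.
Proof. by rewrite /expect big_cat. Qed.

Lemma expect_bind (X Y : Type) (mu : fdist R X) (k : X -> fdist R Y) f :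
  expect (bind mu k) f = expect mu (fun x => expect (k x) f).
Proof.
elim: mu => [|u mu IH]; first by rewrite !expect_nil.
rewrite bind_cons expect_cat expect_cons IH; congr (_ + _).
rewrite /expect big_map mulr_sumr.
by apply: eq_bigr => v _; rewrite mulrA.
Qed.

Lemma expect_draw (F : finType) (p : F -> R) f :
  expect (draw p) f = \sum_x p x * f x.
Proof. by rewrite /expect /draw big_map big_enum. Qed.

Lemma eq_expect (X : Type) (mu : fdist R X) f g :
  f =1 g -> expect mu f = expect mu g.
Proof. by move=> fg; apply: eq_bigr => u _; rewrite fg. Qed.

Lemma expectD (X : Type) (mu : fdist R X) f g :
  expect mu (fun x => f x + g x) = expect mu f + expect mu g.
Proof. by rewrite /expect -big_split; apply: eq_bigr => u _; rewrite mulrDr. Qed.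

Lemma expectZ (X : Type) (mu : fdist R X) c f :
  expect mu (fun x => c * f x) = c * expect mu f.
Proof. by rewrite /expect mulr_sumr; apply: eq_bigr => u _; rewrite mulrCA. Qed.

End FDist.

Section PolicyLoss.
Variables (R : realType) (nS nA : nat) (P : 'I_nS -> 'I_nA -> 'I_nS -> R).
Hypothesis PD : forall s a, is_dist (P s a).

Implicit Types (pi : 'I_nS -> 'I_nA -> R) (f : {ffun 'I_nS -> 'I_nA}).

Lemma expect_rolloutS pi n mu (g : seq ('I_nS * 'I_nA) -> R) :
  expect (rollout P pi n.+1 mu) g =
  \sum_s mu s * \sum_a pi s a *
    expect (rollout P pi n (P s a)) (fun w => g ((s, a) :: w)).
Proof.
rewrite /= expect_bind expect_draw; apply: eq_bigr => s _; congr (_ * _).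
rewrite expect_bind expect_draw; apply: eq_bigr => a _; congr (_ * _).
by rewrite expect_bind; apply: eq_expect => w; rewrite expect_ret.
Qed.

Lemma rollout_mass pi n mu : stationary pi -> is_dist mu ->
  expect (rollout P pi n mu) (fun _ => 1) = 1.
Proof.
move=> pD; elim: n mu => [|n IH] mu [_ mu1]; first by rewrite expect_ret.
rewrite expect_rolloutS -[RHS]mu1; apply: eq_bigr => s _.
rewrite -[RHS]mulr1; congr (_ * _).
rewrite -[RHS](pD s).2; apply: eq_bigr => a _.
by rewrite IH ?mulr1.
Qed.

Lemma det_stationary f : stationary (det R f).
Proof.
move=> s; split=> [a|]; first by rewrite /det /Defs.point ler0n.
rewrite /det /Defs.point (bigD1 (f s)) //. rewrite eqxx big1 /=; first by rewrite addr0.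
by move=> a /negbTE ->.
Qed.

Lemma sum_point (F : finType) (x : F) (g : F -> R) :
  \sum_y Defs.point R x y * g y = g x.
Proof.
rewrite (bigD1 x) // /Defs.point eqxx mul1r big1 /=; first by rewrite addr0.
by move=> y /negbTE ->; rewrite mul0r.
Qed.

Definition push f (d : 'I_nS -> R) (s' : 'I_nS) : R :=
  \sum_s d s * P s (f s) s'.

(** The law of the state in round [t] when [f] is followed from an initial state of law [d]. *)
Definition occ (d : 'I_nS -> R) f t := iter t (push f) d.

Lemma push_dist f d : is_dist d -> is_dist (push f d).
Proof.
move=> [d0 d1]; split=> [s'|].
  by apply: sumr_ge0 => s _; apply: mulr_ge0 => //; case: (PD s (f s)).
rewrite exchange_big -[RHS]d1; apply: eq_bigr => s _.
by rewrite -mulr_sumr (PD s (f s)).2 mulr1.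
Qed.

Lemma occ_dist d f t : is_dist d -> is_dist (occ d f t).
Proof. by move=> dD; elim: t => // t; apply: push_dist. Qed.

Lemma sum_push f d (g : 'I_nS -> R) :
  \sum_s' push f d s' * g s' = \sum_s d s * \sum_s' P s (f s) s' * g s'.
Proof.
under eq_bigr do rewrite mulr_suml.
rewrite exchange_big; apply: eq_bigr => s _.
by rewrite mulr_sumr; apply: eq_bigr => s' _; rewrite mulrA.
Qed.

Lemma policy_loss_cons d f (l : loss R nS nA) ls : is_dist d ->
  policy_loss P d (det R f) (l :: ls) =
  \sum_s d s * l (s, f s) + policy_loss P (push f d) (det R f) ls.
Proof.
move=> dD.
have lin d' g n : expect (rollout P (det R f) n.+1 d') g =
    \sum_s d' s * expect (rollout P (det R f) n.+1 (Defs.point R s)) g.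
  rewrite expect_rolloutS; apply: eq_bigr => s _; congr (_ * _).
  by rewrite expect_rolloutS sum_point.
(* A rollout of length 0 ignores its initial law, so this case of linearity rests on the mass of
   [d'] being 1. *)
have lin0 d' ls' : is_dist d' -> policy_loss P d' (det R f) ls' =
    \sum_s d' s * policy_loss P (Defs.point R s) (det R f) ls'.
  move=> [_ d1]; rewrite /policy_loss; case: ls' => [|l' ls']; last exact: lin.
  rewrite /= expect_ret big_nil big1 // => s _.
  by rewrite ?expect_ret ?big_nil mulr0.
rewrite {1}/policy_loss [size _]/= expect_rolloutS.
under eq_bigr => s _.
  rewrite (eq_bigr (fun a => det R f s a * (l (s, a) +
      policy_loss P (P s a) (det R f) ls))); last first.
    move=> a _; congr (_ * _).
    under eq_expect => w do rewrite /= big_cons /=.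
    rewrite expectD; congr (_ + _).
    rewrite (eq_expect _ (g := fun _ => l (s, a) * 1)) => [|w]; last by rewrite mulr1.
    by rewrite expectZ rollout_mass ?mulr1 //; apply: det_stationary.
  rewrite sum_point mulrDr lin0 //; over.
rewrite big_split /=; congr (_ + _).
rewrite lin0; last exact: push_dist.
by rewrite sum_push.
Qed.

(** Only the state marginals matter for an expected loss. This is the form in which the program
    evaluates a policy and in which oracle queries are compared. *)
Lemma policy_loss_sum d f (ls : seq (loss R nS nA)) : is_dist d ->
  policy_loss P d (det R f) ls =
  \sum_(t < size ls) \sum_s occ d f t s * nth [ffun=> 0] ls t (s, f s).
Proof.
elim: ls d => [|l ls IH] d dD.
  by rewrite /policy_loss /= expect_ret !big_nil big_ord0.
rewrite policy_loss_cons // big_ord_recl /= IH; last exact: push_dist.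
congr (_ + _); apply: eq_bigr => t _; apply: eq_bigr => s _.
by rewrite /occ -iterSr.
Qed.

End PolicyLoss.

(** * Reaching a state after a given number of rounds *)

Section Load.
Variable R : realType.

Lemma load_ord n (v : 'I_n -> R) (i : 'I_n) : load v i = v i.
Proof. by rewrite /load valK. Qed.

Lemma load_nat n (v : 'I_n -> R) i (lt_i : (i < n)%N) : load v i = v (Ordinal lt_i).
Proof. by rewrite -(load_ord v (Ordinal lt_i)). Qed.

(** The scan performed by [best_cmd], with the same treatment of ties, so that program and
    specification select the same action. The initial value 0 is harmless for nonnegative [q]: index
    0 replaces it at once. *)
Definition best_step (q : nat -> R) (b : R * nat) a :=
  if b.1 <= q a then (q a, a) else b.

Definition best_arg (q : nat -> R) n := foldl (best_step q) (0, 0%N) (iota 0 n).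

Lemma best_argS q n : best_arg q n.+1 = best_step q (best_arg q n) n.
Proof. by rewrite /best_arg -addn1 iotaD foldl_cat. Qed.

Lemma best_argP q n : (0 < n)%N -> (forall a, (a < n)%N -> 0 <= q a) ->
  [/\ ((best_arg q n).2 < n)%N, (best_arg q n).1 = q (best_arg q n).2 &
      forall a, (a < n)%N -> q a <= (best_arg q n).1].
Proof.
case: n => // n _; elim: n => [|n IH] q0.
  rewrite best_argS /best_step /= q0 //=; split=> // a.
  by rewrite ltnS leqn0 => /eqP ->.
have [|lt_b qb leb] := IH; first by move=> a /ltnW; apply: q0.
rewrite best_argS /best_step; case: ifP => [le_b|/negbT lt_q].
  split=> //= a; rewrite ltnS leq_eqVlt => /predU1P[-> //|/leb].
  by move/le_trans; apply.
split=> // [|a]; first exact: ltnW.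
by rewrite ltnS leq_eqVlt => /predU1P[->|/leb //]; apply: ltW; rewrite ltNge.
Qed.

End Load.

Section Steering.
Variables (R : realType) (nS nA : nat) (P : 'I_nS -> 'I_nA -> 'I_nS -> R).
Hypothesis PD : forall s a, is_dist (P s a).
Variable a0 : 'I_nA.

Let nA_gt0 : (0 < nA)%N. Proof. exact: leq_ltn_trans (ltn_ord a0). Qed.

(* The largest probability of being in y after exactly h steps from x. *)
Fixpoint reach (y : 'I_nS) (h : nat) (x : 'I_nS) : R :=
  if h is h'.+1 then
    (best_arg (load (fun a => \sum_x' P x a x' * reach y h' x')) nA).1
  else (x == y)%:R.

Definition reach_arg y h x : nat :=
  (best_arg (load (fun a => \sum_x' P x a x' * reach y h.-1 x')) nA).2.

Lemma reach_ge0 y h x : 0 <= reach y h x.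
Proof.
elim: h x => [|h IH] x; first exact: ler0n.
have q0 a : (a < nA)%N -> 0 <= load (fun a => \sum_x' P x a x' * reach y h x') a.
  move=> lt_a; rewrite load_nat; apply: sumr_ge0 => x' _.
  by apply: mulr_ge0 => //; case: (PD x (Ordinal lt_a)).
by have [lt_b /= -> _] := best_argP nA_gt0 q0; apply: q0.
Qed.

Let q0 y h x a : (a < nA)%N ->
  0 <= load (fun a => \sum_x' P x a x' * reach y h x') a.
Proof.
move=> lt_a; rewrite load_nat; apply: sumr_ge0 => x' _.
by apply: mulr_ge0 (reach_ge0 _ _ _); case: (PD x (Ordinal lt_a)).
Qed.

Lemma reach_arg_lt y h x : (reach_arg y h x < nA)%N.
Proof. by case: (best_argP nA_gt0 (q0 y h.-1 x)). Qed.

Definition reach_act y h x : 'I_nA := Ordinal (reach_arg_lt y h x).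

Lemma reach_actE y h x :
  reach y h.+1 x = \sum_x' P x (reach_act y h.+1 x) x' * reach y h x'.
Proof.
by have [lt_b /= -> _] := best_argP nA_gt0 (q0 y h x); rewrite load_nat (bool_irrelevance lt_b (reach_arg_lt y h.+1 x)).
Qed.

Lemma reach_max y h x a : \sum_x' P x a x' * reach y h x' <= reach y h.+1 x.
Proof.
have [_ _ /(_ a (ltn_ord a))] := best_argP nA_gt0 (q0 y h x).
by rewrite load_ord.
Qed.

Lemma reach_le1 y h x : reach y h x <= 1.
Proof.
elim: h x => [|h IH] x; first by rewrite /= lern1 leq_b1.
rewrite reach_actE -(PD x (reach_act y h.+1 x)).2; apply: ler_sum => x' _.
by rewrite ler_piMr //; case: (PD x (reach_act y h.+1 x)).
Qed.

Lemma reach_avg (pi : 'I_nS -> 'I_nA -> R) y h x : stationary pi ->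
  \sum_a pi x a * \sum_x' P x a x' * reach y h x' <= reach y h.+1 x.
Proof.
move=> pD; rewrite -[leRHS]mul1r -(pD x).2 mulr_suml; apply: ler_sum => a _.
by apply: ler_wpM2l (reach_max _ _ _ _); case: (pD x).
Qed.

(** An optimal plan towards [z] followed by an optimal plan from [z] is one of the plans from [x] to
    [y]. *)
Lemma reach_comp y z h k x : reach z h x * reach y k z <= reach y (h + k) x.
Proof.
elim: h x => [|h IH] x.
  by rewrite /=; case: eqP => [->|_]; rewrite ?mul1r ?mul0r ?reach_ge0.
rewrite addSn reach_actE mulr_suml.
apply: le_trans (reach_max y (h + k) x (reach_act z h.+1 x)).
apply: ler_sum => x' _; rewrite -mulrA; apply: ler_wpM2l (IH x').
by case: (PD x (reach_act z h.+1 x)).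
Qed.

(** * Hitting times and reachability at a fixed time *)

Section Hitting.
Variable pi : 'I_nS -> 'I_nA -> R.
Hypothesis pD : stationary pi.

Lemma hit_pmf0 y x : hit_pmf P pi y x 0 = (x == y)%:R.
Proof.
rewrite /hit_pmf expect_rolloutS sum_point.
rewrite (eq_bigr (fun a => pi x a * (x == y)%:R)) => [|a _].
  by rewrite -mulr_suml (pD x).2 mul1r.
by rewrite /= expect_ret /=; case: (x == y).
Qed.

Lemma hit_pmfS y x k : hit_pmf P pi y x k.+1 =
  (x != y)%:R * \sum_a pi x a * \sum_x' P x a x' * hit_pmf P pi y x' k.
Proof.
rewrite {1}/hit_pmf expect_rolloutS sum_point mulr_sumr.
apply: eq_bigr => a _; rewrite mulrCA; congr (_ * _).
case: (eqVneq x y) => [->|/negbTE xy] /=.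
  rewrite mul0r -[RHS](mul0r (expect (rollout P pi k.+1 (P y a)) (fun _ => 1))) -expectZ.
  by apply: eq_expect => w; rewrite /= eqxx mul0r.
rewrite mul1r.
transitivity (expect (rollout P pi k.+1 (P x a))
   (fun w => (find (fun sa : 'I_nS * 'I_nA => sa.1 == y) w == k)%:R : R)).
  by apply: eq_expect => w; rewrite /= xy.
rewrite expect_rolloutS; apply: eq_bigr => x' _; congr (_ * _).
by rewrite /hit_pmf expect_rolloutS sum_point.
Qed.

Lemma hit_pmf_ge0 y x k : 0 <= hit_pmf P pi y x k.
Proof.
elim: k x => [|k IH] x; first by rewrite hit_pmf0 ler0n.
rewrite hit_pmfS mulr_ge0 //; apply: sumr_ge0 => a _.
apply: mulr_ge0; first by case: (pD x).
by apply: sumr_ge0 => x' _; apply: mulr_ge0 => //; case: (PD x a).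
Qed.

(** A first visit at time [k] is one way of being in [y] at time [k], and [reach] is optimal among
    all plans, in particular the stationary ones. *)
Lemma hit_pmf_reach y x k : hit_pmf P pi y x k <= reach y k x.
Proof.
elim: k x => [|k IH] x; first by rewrite hit_pmf0.
rewrite hit_pmfS; case: eqP => _; first by rewrite mul0r; apply: (reach_ge0 y k.+1).
rewrite mul1r; apply: le_trans (reach_avg y k x pD).
apply: ler_sum => a _; apply: ler_wpM2l; first by case: (pD x).
by apply: ler_sum => x' _; apply: ler_wpM2l => //; case: (PD x a).
Qed.

Definition hit_cdf y x k := \sum_(j < k.+1) hit_pmf P pi y x j.

Lemma hit_cdfS y x k : hit_cdf y x k.+1 = (x == y)%:R +
  (x != y)%:R * \sum_a pi x a * \sum_x' P x a x' * hit_cdf y x' k.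
Proof.
rewrite {1}/hit_cdf big_ord_recl hit_pmf0; congr (_ + _).
under eq_bigr do rewrite hit_pmfS.
rewrite -mulr_sumr; congr (_ * _); rewrite exchange_big; apply: eq_bigr => a _.
rewrite -mulr_sumr; congr (_ * _); rewrite exchange_big; apply: eq_bigr => x' _.
by rewrite -mulr_sumr.
Qed.

Lemma hit_cdf_le1 y x k : hit_cdf y x k <= 1.
Proof.
elim: k x => [|k IH] x.
  by rewrite /hit_cdf big_ord_recl big_ord0 addr0 hit_pmf0 lern1 leq_b1.
rewrite hit_cdfS; case: eqP => _; first by rewrite mul0r addr0.
rewrite add0r mul1r -(pD x).2; apply: ler_sum => a _.
rewrite ler_piMr //; first by case: (pD x).
rewrite -(PD x a).2; apply: ler_sum => x' _.
by rewrite ler_piMr //; case: (PD x a).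
Qed.

(* Go to the absorbing state with pi, then stay there. *)
Lemma hit_cdf_reach z b x k : P z b z = 1 -> hit_cdf z x k <= reach z k x.
Proof.
move=> zz; have stay h : reach z h z = 1.
  elim: h => [|h IH]; first by rewrite /= eqxx.
  apply/le_anti; rewrite reach_le1 /=; apply: le_trans (reach_max z h z b).
  rewrite (bigD1 z) //= zz IH mulr1 lerDl; apply: sumr_ge0 => x' _.
  by apply: mulr_ge0 (reach_ge0 _ _ _); case: (PD z b).
elim: k x => [|k IH] x.
  by rewrite /hit_cdf big_ord_recl big_ord0 addr0 hit_pmf0.
rewrite hit_cdfS; case: eqP => [->|_].
  by rewrite mul0r addr0 (stay k.+1).
rewrite add0r mul1r; apply: le_trans (reach_avg z k x pD).
apply: ler_sum => a _; apply: ler_wpM2l; first by case: (pD x).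
by apply: ler_sum => x' _; apply: ler_wpM2l => //; case: (PD x a).
Qed.

(* Wait in the absorbing state and leave it at the best moment. *)
Lemma hit_cdf_wait z b y k : P z b z = 1 ->
  hit_cdf y z k <= k.+1%:R * reach y k z.
Proof.
move=> zz; have mono h : reach y h z <= reach y h.+1 z.
  apply: le_trans (reach_max y h z b); rewrite (bigD1 z) //= zz mul1r lerDl.
  apply: sumr_ge0 => x' _; apply: mulr_ge0 (reach_ge0 _ _ _).
  by case: (PD z b).
have monoD h d : reach y h z <= reach y (h + d) z.
  elim: d => [|d IH]; first by rewrite addn0.
  by rewrite addnS; apply: le_trans IH (mono _).
rewrite /hit_cdf mulr_natl -[X in _ *+ X](card_ord k.+1) -sumr_const.
apply: ler_sum => j _; apply: le_trans (hit_pmf_reach _ _ _) _.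
case: j => j' lt_j /=; have /subnKC <- : (j' <= k)%N by [].
exact: monoD.
Qed.

Lemma hit_series_le1 y x :
  (\sum_(0 <= k <oo) (hit_pmf P pi y x k)%:E <= 1)%E.
Proof.
apply: lime_le; first by apply: is_cvg_nneseries => n _ _; rewrite lee_fin hit_pmf_ge0.
apply: nearW => -[|n]; first by rewrite big_geq.
rewrite sumEFin lee_fin big_mkord; exact: hit_cdf_le1.
Qed.

(** Time 0 has no mass, so the mean dominates the total mass; if that mass is below 1, the infinite
    term takes over. The resulting [1 <= D] lets [D ^+ 2] absorb additive constants. *)
Lemma hitting_time_ge1 y x : x != y -> (1 <= hitting_time P pi y x)%E.
Proof.
move=> xy; rewrite /hitting_time.
set S := (\sum_(0 <= k <oo) (hit_pmf P pi y x k)%:E)%E.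
set M := (\sum_(0 <= k <oo) (k%:R * hit_pmf P pi y x k)%:E)%E.
have SM : (S <= M)%E.
  apply: lee_nneseries => [k _ _|k _]; first by rewrite lee_fin hit_pmf_ge0.
  rewrite lee_fin; case: k => [|k]; first by rewrite hit_pmf0 (negbTE xy) mulr0.
  by rewrite ler_peMl ?hit_pmf_ge0 // ler1n.
have S0 : (0 <= S)%E by apply: nneseries_ge0 => k _ _; rewrite lee_fin hit_pmf_ge0.
have := hit_series_le1 y x; rewrite -/S le_eqVlt => /predU1P[S1|lt_S].
  by rewrite -S1 subee ?mule0 ?adde0 // S1.
have -> : (+oo * (1 - S) = +oo)%E by rewrite gt0_mulye // sube_gt0.
rewrite addey ?leey // gt_eqF //.
by apply: lt_le_trans (le_trans S0 SM); rewrite ltNy0.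
Qed.

(* Markov's inequality, with the hitting time known to be almost surely finite. *)
Lemma hit_cdf_half y x (B : R) K : (hitting_time P pi y x < B%:E)%E ->
  2 * B <= K.+1%:R -> 1 / 2 <= hit_cdf y x K.
Proof.
rewrite /hitting_time => ltB BK.
set S := (\sum_(0 <= k <oo) (hit_pmf P pi y x k)%:E)%E in ltB.
set M := (\sum_(0 <= k <oo) (k%:R * hit_pmf P pi y x k)%:E)%E in ltB.
have M0 : (0 <= M)%E.
  by apply: nneseries_ge0 => k _ _; rewrite lee_fin mulr_ge0 ?hit_pmf_ge0.
have S1 : S = 1%E.
  have := hit_series_le1 y x; rewrite -/S le_eqVlt => /predU1P[//|lt_S].
  move: ltB; have -> : (+oo * (1 - S) = +oo)%E by rewrite gt0_mulye // sube_gt0.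
  rewrite addey ?ltNge ?leey // gt_eqF //.
  by apply: lt_le_trans M0; rewrite ltNy0.
have MB : (M < B%:E)%E by move: ltB; rewrite S1 subee // mule0 adde0.
have part n : \sum_(0 <= k < n) k%:R * hit_pmf P pi y x k <= B.
  rewrite -lee_fin -sumEFin; apply: le_trans (ltW MB).
  apply: nneseries_lim_ge => k _ _.
  by rewrite lee_fin mulr_ge0 ?hit_pmf_ge0.
have B0 : 0 <= B by have := part 0; rewrite big_geq.
have K0 : 0 < K.+1%:R :> R by [].
(* Beyond [K] every index is at least [K.+1], so [K.+1] times the tail is part of the mean. *)
have cdf_bound n : \sum_(0 <= k < n) hit_pmf P pi y x k <= hit_cdf y x K + B / K.+1%:R.
  have [le_nK|lt_Kn] := leqP n K.+1.
    apply: (@le_trans _ _ (hit_cdf y x K)); last by rewrite lerDl divr_ge0.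
    rewrite /hit_cdf -(big_mkord xpredT (hit_pmf P pi y x)) (@big_cat_nat _ _ _ n 0 K.+1) //=.
    by rewrite lerDl; apply: sumr_ge0 => k _; apply: hit_pmf_ge0.
  rewrite (@big_cat_nat _ _ _ K.+1) ?(ltnW lt_Kn) //= big_mkord lerD2l.
  rewrite ler_pdivlMr // mulrC; apply: le_trans (part n).
  rewrite (@big_cat_nat _ _ _ K.+1 0 n) ?(ltnW lt_Kn) //= -[leLHS]add0r lerD //.
    by apply: sumr_ge0 => k _; rewrite mulr_ge0 ?hit_pmf_ge0.
  rewrite mulr_sumr ler_sum_nat // => k /andP[le_k _].
  by rewrite ler_wpM2r ?hit_pmf_ge0 // ler_nat.
have : (S <= (hit_cdf y x K + B / K.+1%:R)%:E)%E.
  apply: lime_le; first by apply: is_cvg_nneseries => n _ _; rewrite lee_fin hit_pmf_ge0.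
  by apply: nearW => n; rewrite sumEFin lee_fin; apply: cdf_bound.
rewrite S1 lee_fin => le1.
have : B / K.+1%:R <= 1 / 2 by rewrite ler_pdivrMr //; lra.
move: le1; set b := B / _ => le1 leb; lra.
Qed.

End Hitting.

Lemma diameter_ge_inf x y : x != y ->
  (ereal_inf [set hitting_time P pi y x | pi in @stationary R nS nA] <= diameter P)%E.
Proof.
move=> xy; rewrite /diameter.
exact: (le_bigmax_cond _ (j := (x, y))
  (fun q => ereal_inf [set hitting_time P pi q.2 q.1 | pi in @stationary R nS nA])).
Qed.

Lemma diameter_ge1 : (1 < nS)%N -> communicating P ->
  (diameter P \is a fin_num) /\ 1 <= fine (diameter P).
Proof.
move=> nS1 comm.
pose x := Ordinal (ltnW nS1); pose y := Ordinal nS1.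
have xy : x != y by [].
have D1 : (1%:E <= diameter P)%E.
  apply: le_trans (diameter_ge_inf xy); apply: le_ereal_inf_tmp => _ [pi piS <-].
  exact: hitting_time_ge1.
have fD : diameter P \is a fin_num.
  rewrite fin_numElt comm andbT; apply: lt_le_trans D1; exact: ltNyr.
by split=> //; rewrite -lee_fin fineK.
Qed.

(* A state y is reached from x in exactly 2 K steps by going to the absorbing
   state, waiting there, and leaving it at the best moment. *)
Lemma reach_lower (z : 'I_nS) b x y K : (1 < nS)%N -> communicating P ->
  P z b z = 1 -> 2 * (fine (diameter P) + 1) <= K.+1%:R ->
  1 / (4 * K.+1%:R) <= reach y (K + K) x.
Proof.
move=> nS1 comm zz DK; have [fD D1] := diameter_ge1 nS1 comm.
have half x' y' : exists2 pi, @stationary R nS nA pi & 1 / 2 <= hit_cdf pi y' x' K.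
  (* The diameter only speaks of distinct states; equal ones are hit at time 0 by any policy. *)
  have [<-|xy] := eqVneq x' y'.
    exists (det R [ffun=> a0]); first exact: det_stationary.
    rewrite /hit_cdf big_ord_recl hit_pmf0; last exact: det_stationary.
    rewrite -[leLHS]addr0 eqxx lerD //; first by rewrite ler_pdivrMr // mul1r ler1n.
    by apply: sumr_ge0 => j _; apply: hit_pmf_ge0; apply: det_stationary.
  (* The infimum need not be attained; the additional 1 leaves room to pick a policy. *)
  have : (ereal_inf [set hitting_time P pi y' x' | pi in @stationary R nS nA]
            < (fine (diameter P) + 1)%:E)%E.
    apply: le_lt_trans (diameter_ge_inf xy) _.
    by rewrite -[ltLHS](fineK fD) lte_fin ltrDl.
  move=> /ereal_inf_lt[_ [pi piS <-] lt_pi]; exists pi => //.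
  exact: hit_cdf_half lt_pi DK.
have [pi piS xz] := half x z; have [rho rhoS zy] := half z y.
have h1 : 1 / 2 <= reach z K x by apply: le_trans xz (hit_cdf_reach piS x K zz).
have h2 := le_trans zy (hit_cdf_wait rhoS y K zz).
have K0 : 0 < K.+1%:R :> R by [].
apply: le_trans (reach_comp y z K K x).
have h3 : 1 / (2 * K.+1%:R) <= reach y K z.
  by rewrite ler_pdivrMr ?mulr_gt0 //; move: h2; rewrite mulrC; lra.
have -> : 1 / (4 * K.+1%:R) = 1 / 2 * (1 / (2 * K.+1%:R)) :> R.
  by field; rewrite gt_eqF.
by apply: ler_pM => //; rewrite ?divr_ge0 ?mulr_ge0.
Qed.

End Steering.

(** * The cost of following a switching policy *)

Lemma dist_avg_le (R : realType) (F : finType) (p : F -> R) f (B : R) :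
  is_dist p -> (forall x, f x <= B) -> \sum_x p x * f x <= B.
Proof.
move=> [p0 p1] fB; rewrite -[leRHS]mul1r -p1 mulr_suml.
by apply: ler_sum => x _; apply: ler_wpM2l.
Qed.

Section Tracking.
Variables (R : realType) (nS nA : nat) (P : 'I_nS -> 'I_nA -> 'I_nS -> R).
Hypothesis PD : forall s a, is_dist (P s a).
Variables (a0 : 'I_nA) (d1 : 'I_nS -> R).
Hypothesis d1D : is_dist d1.
Variable ell : nat -> 'I_nS -> 'I_nA -> R.
Hypothesis ell01 : forall t s a, 0 <= ell t s a <= 1.
Variables (H : nat) (theta : R).
Variable pol : nat -> {ffun 'I_nS -> 'I_nA}.

(* None: the state is distributed as if the current policy had been followed
   since round 0. Some (h, y, q): the learner is chasing the state y, where it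
   wants to be in h rounds; it then declares success with probability q. *)
Definition config := option (nat * 'I_nS * R).

(** The default in round 0 is what a zeroed policy array reads as when [a0] is action 0. *)
Definition prev_pol t := if t is t'.+1 then pol t' else [ffun=> a0].

Section Round.
Variable v : nat -> 'I_nS -> config -> R.

Definition move t x a (c : config) :=
  ell t x a + \sum_x' P x a x' * v t.+1 x' c.

Definition follow t x := move t x (pol t x) None.

Definition chase t x h y (q : R) :=
  move t x (reach_act PD a0 y h x) (Some (h.-1, y, q)).

(* The target is drawn where the current policy would be after H rounds. The
   acceptance probability makes every chase succeed with probability theta. *)
Definition launch t x :=
  \sum_y occ P d1 (pol t) (t + H) y * chase t x H y (theta / reach P y H x).

Definition round_value t x (c : config) :=
  if pol t != prev_pol t then launch t x else
  match c with
  | None => follow t x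
  | Some (0, y, q) =>
      let p := if x == y then clip q else 0 in
      p * follow t x + (1 - p) * launch t x
  | Some (h.+1, y, q) => chase t x h.+1 y q
  end.

End Round.

(** The learner's expected loss over the [r] rounds from [t] on, from state [x] and configuration
    [c], for a fixed sequence of policies. *)
Fixpoint value (r t : nat) (x : 'I_nS) (c : config) : R :=
  if r is r'.+1 then round_value (value r') t x c else 0.

Definition mean_loss (f : {ffun 'I_nS -> 'I_nA}) t :=
  \sum_s occ P d1 f t s * ell t s (f s).

Definition tracked r t := \sum_(t <= j < t + r) mean_loss (pol j) j.

Definition switches r t : nat := (\sum_(t <= j < t + r) (pol j != prev_pol j))%N.

Hypotheses (H_gt0 : (0 < H)%N) (theta_gt0 : 0 < theta).
Hypothesis theta_le : forall x y, theta <= reach P y H x.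

(** The price of a switch: an attempt takes [H] rounds of loss at most 1 and succeeds with
    probability [theta], so that [theta^-1] attempts are expected. *)
Let W := H%:R / theta.
Let theta_le1 (x : 'I_nS) : theta <= 1.
Proof. exact: le_trans (theta_le x x) (reach_le1 PD a0 _ _ _). Qed.

Let P_ge0 x a x' : 0 <= P x a x'. Proof. by case: (PD x a). Qed.

Let le_HW (x : 'I_nS) : H%:R <= W.
Proof. by rewrite /W ler_pdivlMr // ler_piMr // (theta_le1 x). Qed.

Let W_ge0 : 0 <= W. Proof. by rewrite divr_ge0 // ltW. Qed.

Lemma clip01 (q : R) : 0 <= clip q <= 1.
Proof.
rewrite /clip; apply/andP; split; first by rewrite le_max lexx.
by rewrite ge_max ler01 ge_min lexx.
Qed.

Lemma clip_id (q : R) : 0 <= q <= 1 -> clip q = q.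
Proof. by move=> /andP[q0 q1]; rewrite /clip min_r // max_r. Qed.

Lemma mean_loss01 f t : 0 <= mean_loss f t <= 1.
Proof.
have [w0 w1] := occ_dist PD f t d1D; apply/andP; split.
  by apply: sumr_ge0 => s _; apply: mulr_ge0 => //; case/andP: (ell01 t s (f s)).
rewrite -w1; apply: ler_sum => s _.
by apply: ler_piMr => //; case/andP: (ell01 t s (f s)).
Qed.

Lemma trackedS r t : tracked r.+1 t = mean_loss (pol t) t + tracked r t.+1.
Proof. by rewrite /tracked addnS big_ltn ?ltnS ?leq_addr // addSn. Qed.

Lemma switchesS r t :
  switches r.+1 t = ((pol t != prev_pol t) + switches r t.+1)%N.
Proof. by rewrite /switches addnS big_ltn ?ltnS ?leq_addr // addSn. Qed.

Lemma tracked_add h r t : tracked r (t + h) <= tracked (h + r) t.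
Proof.
elim: h t => [|h IH] t; first by rewrite addn0.
rewrite addSn trackedS addnS -addSn; apply: le_trans (IH t.+1) _.
by rewrite lerDr; case/andP: (mean_loss01 (pol t) t).
Qed.

Lemma switches_add h r t : (switches r (t + h) <= switches (h + r) t)%N.
Proof.
elim: h t => [|h IH] t; first by rewrite addn0.
by rewrite addSn switchesS addnS -addSn; apply: leq_trans (IH t.+1) (leq_addl _ _).
Qed.

Lemma move_le v t x a c (B : R) : (forall x', v t.+1 x' c <= B) ->
  move v t x a c <= 1 + B.
Proof.
move=> vB; rewrite /move lerD //; first by case/andP: (ell01 t x a).
exact: dist_avg_le.
Qed.

(** Each round loses at most 1. This settles the horizons that are too short for the chase
    analysis. *)
Lemma value_le r t x c : value r t x c <= r%:R.
Proof.
elim: r t x c => [|r IH] t x c //=.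
have mv t' x' a c' : move (value r) t' x' a c' <= r.+1%:R.
  by rewrite -[r.+1]add1n natrD; apply: move_le => x''; apply: IH.
have ln : launch (value r) t x <= r.+1%:R.
  by apply: dist_avg_le => [|y]; [apply: occ_dist | apply: mv].
rewrite /round_value; case: ifP => // _.
case: c => [[[[|h] y] q]|]; [|exact: mv|exact: mv].
set p := if _ then _ else _.
have /andP[p0 p1] : 0 <= p <= 1 by rewrite /p; case: ifP => _; rewrite ?clip01 // lexx ler01.
apply: (@le_trans _ _ (p * r.+1%:R + (1 - p) * r.+1%:R)).
  by apply: lerD; apply: ler_wpM2l => //; [apply: mv | rewrite subr_ge0].
by rewrite -mulrDl addrC subrK mul1r.
Qed.

(** A launch in round [t] covers [r.+1] rounds. A switch in round [t] itself is paid by the last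
    [W], hence the count from [t.+1]. The bound holds from every state, as needed after failed or
    interrupted chases. *)
Definition launch_bound r := forall t x,
  launch (value r) t x <= tracked r.+1 t + (switches r t.+1)%:R * W + W.

(** At most [h] rounds of loss at most 1 precede the interruption, and the switch that causes it
    pays for the launch that follows. If the horizon ends first, the term [h] covers everything. *)
Lemma chase_interrupted r (IH : forall r', (r' < r)%N -> launch_bound r') h t x y q :
  ((exists j, [/\ (j <= h)%N, (j < r)%N & pol (t + j) != prev_pol (t + j)]) \/
   (r <= h)%N) ->
  value r t x (Some (h, y, q)) <= h%:R + tracked r t + (switches r t)%:R * W.
Proof.
elim: h r IH t x => [|h IHh] [|r] IH t x int.
- by rewrite /tracked /switches !addn0 !big_geq //= !add0r mul0r.
- case: int => [[j []]|//]; rewrite leqn0 => /eqP -> _; rewrite addn0 => sw.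
  rewrite /= /round_value sw; apply: le_trans (IH r _ t x) _ => //.
  by rewrite switchesS sw natrD mulrDl mul1r; lra.
- rewrite /= /tracked /switches !addn0 !big_geq // mul0r !addr0; exact: ler0n.
rewrite [value _ _ _ _]/= /round_value; case: ifP => [sw|/negbT sw].
  apply: le_trans (IH r _ t x) _ => //.
  rewrite switchesS sw natrD mulrDl mul1r.
  by have : 0 <= h.+1%:R :> R by []; lra.
rewrite /chase [h.+1.-1]/=.
apply: le_trans (move_le x _ (B := h%:R + tracked r t.+1 + (switches r t.+1)%:R * W) _) _.
  move=> x'; apply: IHh => [r' lt_r|]; first by apply: IH; apply: ltnW.
  case: int => [[[|j] [le_j lt_j swj]]|]; last by right.
    by move: swj; rewrite addn0 (negbTE sw).
  by left; exists j; split=> //; rewrite addSnnS.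
rewrite trackedS switchesS (negbTE sw) add0n.
by have /andP[] := mean_loss01 (pol t) t; rewrite -[h.+1]addn1 natrD; lra.
Qed.

(* Without interruption, y is reached after h rounds with probability
   reach y h x, whatever happens otherwise. *)
Lemma chase_uninterrupted r h t x y q (Bd : R) :
  (forall j, (j <= h)%N -> pol (t + j) = prev_pol (t + j)) ->
  (forall x', launch (value r) (t + h) x' <= Bd) ->
  value (h + r.+1) t x (Some (h, y, q)) <=
  h%:R + (reach P y h x * clip q * follow (value r) (t + h) y +
          (1 - reach P y h x * clip q) * Bd).
Proof.
move=> nosw leB; elim: h t x nosw leB => [|h IH] t x nosw leB.
  have nosw0 : (pol t != prev_pol t) = false.
    by apply/negbTE; rewrite negbK -{1}[t]addn0 nosw ?addn0.
  rewrite add0n [value _ _ _ _]/= /round_value nosw0 add0r addn0.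
  move: leB; rewrite addn0 => leB.
  have := clip01 q; rewrite [reach _ _ _ _]/=; case: (x =P y) => [->|_] /andP[c0 c1].
    by rewrite mul1r lerD2l ler_wpM2l // subr_ge0.
  by rewrite !mul0r subr0 !mul1r !add0r.
have nosw0 : (pol t != prev_pol t) = false.
  by apply/negbTE; rewrite negbK -{1}[t]addn0 nosw ?addn0.
rewrite addSn [value _ _ _ _]/= /round_value nosw0 /chase /move [h.+1.-1]/=.
set a := reach_act _ _ _ _ _.
(* Written as an affine function of [reach P y h x'], so that averaging over [x'] turns it into the
   same function of [reach P y h.+1 x]. Equality in the recursion of [reach] matters, as the
   coefficient may have either sign. *)
have {}IH x' : value (h + r.+1) t.+1 x' (Some (h, y, q)) <=
   h%:R + Bd + reach P y h x' * (clip q * (follow (value r) (t + h.+1) y - Bd)).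
  apply: le_trans (IH t.+1 x' _ _) _.
  - by move=> j le_j; rewrite addSnnS; apply: nosw.
  - by move=> x''; rewrite addSnnS; apply: leB.
  by rewrite addSnnS le_eqVlt; apply/orP; left; apply/eqP; ring.
apply: le_trans (lerD (proj2 (andP (ell01 t x a))) (ler_sum _ (fun x' _ => ler_wpM2l (P_ge0 x a x') (IH x')))) _.
rewrite (reach_actE PD a0) -/a.
under eq_bigr do rewrite mulrDr (mulrA (P _ _ _) (reach _ _ _ _)).
rewrite big_split /= -!mulr_suml (PD x a).2 -[h.+1]addn1 natrD.
by rewrite le_eqVlt; apply/orP; left; apply/eqP; ring.
Qed.

(** Only an average over the law of the state: a coupled learner is distributed as if its policy had
    been played throughout, and nothing is claimed state by state. *)
Definition follow_bound r := forall t,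
  \sum_x occ P d1 (prev_pol t) t x * value r t x None <=
  tracked r t + (switches r t)%:R * W.

Lemma sum_follow r t : follow_bound r ->
  \sum_x occ P d1 (pol t) t x * follow (value r) t x <=
  tracked r.+1 t + (switches r t.+1)%:R * W.
Proof.
move=> IH; rewrite trackedS -addrA /follow /move.
under eq_bigr do rewrite mulrDr.
rewrite big_split /= lerD2l -sum_push; exact: IH t.+1.
Qed.

Lemma follow_bound_step r : launch_bound r -> follow_bound r ->
  follow_bound r.+1.
Proof.
move=> IHl IHf t; rewrite switchesS.
have oD := occ_dist PD (prev_pol t) t d1D.
rewrite [value _]/= /round_value; case: eqP => [tp|_] /=.
  by rewrite -tp; apply: sum_follow.
rewrite natrD mulrDl mul1r addrA.
apply: dist_avg_le => // x; by apply: le_trans (IHl t x) _; lra.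
Qed.

(** A full attempt costs [H], then with probability [theta] the learner follows the policy from its
    own law, and otherwise it launches anew. With [Bd] the bound for launching at [t + H], the total
    is at most [H + (1 - theta) * Bd + theta * (Bd - W)], which is [Bd] because [theta * W = H]. *)
Lemma launch_bound_step r :
  (forall r', (r' < r)%N -> launch_bound r' /\ follow_bound r') -> launch_bound r.
Proof.
move=> IH t x.
have IHl r' : (r' < r)%N -> launch_bound r' by move=> /IH[].
have oD := occ_dist PD (pol t) (t + H) d1D; have [w0 w1] := oD.
have [k kH] : exists k, H = k.+1 by exists H.-1; rewrite prednK.
(* Either the next [H] rounds exist and keep the policy, or the attempt is cut short and [H <= W]
   pays for it. *)
have [/forallP nosw|/forallPn[j]] :=
  boolP [forall j : 'I_H, (j < r)%N && (pol (t.+1 + j) == prev_pol (t.+1 + j))]; last first.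
  rewrite negb_and -leqNgt => int; rewrite /launch.
  have chaseB y q : chase (value r) t x H y q <=
      tracked r.+1 t + (switches r t.+1)%:R * W + W.
    rewrite /chase kH [k.+1.-1]/=.
    apply: le_trans (move_le x _ (B := k%:R + tracked r t.+1 + (switches r t.+1)%:R * W) _) _.
      move=> x'; apply: chase_interrupted => //.
      have lt_j : (j <= k)%N by have := ltn_ord j; rewrite [X in (_ < X)%N]kH ltnS.
      have [le_r|lt_r] := leqP r k; first by right.
      left; exists j; split=> //; first exact: leq_ltn_trans lt_r.
      by case/orP: int => // le_rj; move: (leq_trans lt_r (leq_trans le_rj lt_j)); rewrite ltnn.
    have := le_HW x; rewrite kH -addn1 natrD trackedS.
    by have /andP[] := mean_loss01 (pol t) t; lra.
  exact: dist_avg_le.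
have {}nosw j : (j <= k)%N -> (j < r)%N /\ pol (t.+1 + j) = prev_pol (t.+1 + j).
  rewrite -ltnS -kH => lt_j.
  by have /andP[? /eqP] := nosw (Ordinal lt_j).
have [r' rE] : exists r', r = (k + r'.+1)%N.
  by have [lt_k _] := nosw k (leqnn k); exists (r - k.+1)%N; lia.
have tkH : (t.+1 + k = t + H)%N by rewrite kH addSnnS.
have polH : pol (t + H) = pol t.
  rewrite -tkH; have : (k <= k)%N by []. elim: {-2}k => [|i IHi] le_i.
    by have [_ ->] := nosw 0%N isT; rewrite addn0.
  by have [_ ->] := nosw _ le_i; rewrite addnS; apply: IHi; apply: ltnW.
pose Bd := tracked r'.+1 (t + H) + (switches r' (t + H).+1)%:R * W + W.
have lt_r' : (r' < r)%N by rewrite rE; lia.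
have leB x' : launch (value r') (t + H) x' <= Bd by apply: (IHl r' lt_r').
have chaseB y : chase (value r) t x H y (theta / reach P y H x) <=
    H%:R + Bd + theta * (follow (value r') (t + H) y - Bd).
  rewrite /chase /move; set a := reach_act _ _ _ _ _; set q := theta / _.
  (* As [theta] lies below every [reach P y H x], clipping is void, and the success probability is
     the same for all targets. *)
  have qE : reach P y H x * clip q = theta.
    have r0 : 0 < reach P y H x by apply: lt_le_trans theta_gt0 _.
    rewrite clip_id /q; first by rewrite mulrCA divff ?mulr1 // gt_eqF.
    by rewrite divr_ge0 ?(ltW r0) ?(ltW theta_gt0) //= ler_pdivrMr // mul1r.
  have cB x' : value r t.+1 x' (Some (H.-1, y, q)) <=
    k%:R + Bd + reach P y k x' * (clip q * (follow (value r') (t + H) y - Bd)).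
    have -> : H.-1 = k by rewrite kH.
    rewrite rE.
    apply: le_trans (chase_uninterrupted (r := r') (Bd := Bd) x' y q _ _) _.
    - by move=> j /nosw[].
    - by rewrite tkH.
    by rewrite tkH le_eqVlt; apply/orP; left; apply/eqP; ring.
  apply: le_trans (lerD (proj2 (andP (ell01 t x a))) (ler_sum _ (fun x' _ => ler_wpM2l (P_ge0 x a x') (cB x')))) _.
  under eq_bigr do rewrite mulrDr (mulrA (P _ _ _) (reach _ _ _ _)).
  rewrite big_split /= -!mulr_suml (PD x a).2 -qE.
  have -> : reach P y H x = \sum_x' P x a x' * reach P y k x'.
    by rewrite /a kH (reach_actE PD a0).
  rewrite kH -[k.+1]addn1 natrD.
  by rewrite le_eqVlt; apply/orP; left; apply/eqP; ring.
apply: (@le_trans _ _ (H%:R + Bd - theta * Bd +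
    theta * \sum_y occ P d1 (pol t) (t + H) y * follow (value r') (t + H) y)).
  rewrite /launch; apply: le_trans (ler_sum _ (fun y _ => ler_wpM2l (w0 y) (chaseB y))) _.
  rewrite (eq_bigr (fun y => occ P d1 (pol t) (t + H) y * (H%:R + Bd - theta * Bd) +
     theta * (occ P d1 (pol t) (t + H) y * follow (value r') (t + H) y))).
    by rewrite big_split /= -mulr_suml w1 mul1r mulr_sumr.
  by move=> y _; ring.
(* The targets were drawn for the policy of round [t]; as it is still current in round [t + H],
   their law is the one in [sum_follow]. *)
rewrite -polH.
have fb := sum_follow (t + H) (proj2 (IH r' lt_r')).
set F := \sum_y _ in fb *.
have thW : theta * W = H%:R by rewrite /W mulrCA divff ?mulr1 // gt_eqF.
have trk : tracked r'.+1 (t + H) <= tracked r.+1 t.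
  by apply: le_trans (tracked_add H r'.+1 t) _; rewrite rE kH addSn.
have sws : (switches r' (t + H).+1)%:R * W <= (switches r t.+1)%:R * W.
  apply: ler_wpM2r => //; rewrite ler_nat -addSn.
  have -> : r = (H + r')%N by rewrite rE kH addSnnS.
  exact: switches_add.
have : theta * F <= theta * (Bd - W).
  apply: (ler_wpM2l (ltW theta_gt0)).
  move: fb; rewrite /Bd. lra.
rewrite mulrBr thW /Bd; lra.
Qed.

(** Strong induction, because a completed attempt resumes with [H] fewer rounds to go. *)
Lemma tracking_bounds r : launch_bound r /\ follow_bound r.
Proof.
have [n] := ubnP r; elim: n r => // n IH r lt_r.
have IHr r' : (r' < r)%N -> launch_bound r' /\ follow_bound r'.
  by move=> lt_r'; apply: IH; apply: leq_trans lt_r' _.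
split; first exact: launch_bound_step.
case: r lt_r IHr => [|r] _ IHr.
  move=> t; rewrite /tracked /switches !addn0 !big_geq // mul0r addr0 big1 // => x _.
  by rewrite /= mulr0.
by have [] := IHr r (leqnn _); apply: follow_bound_step.
Qed.

(** The 1 pays for a first policy that differs from the default one. The sum also counts a change
    into round [r], which only weakens the bound. *)
Lemma tracking_value r :
  \sum_x d1 x * value r 0 x None <=
  \sum_(j < r) mean_loss (pol j) j +
  (1 + \sum_(j < r) (pol j.+1 != pol j)%:R) * W.
Proof.
have [_ /(_ 0%N)] := tracking_bounds r; rewrite /occ /= => /le_trans; apply.
rewrite /tracked add0n big_mkord lerD2l ler_wpM2r // /switches add0n.
rewrite natr_sum; case: r => [|r]; first by rewrite big_geq // big_ord0 addr0.
rewrite big_mkord big_ord_recl big_ord_recr /= addrA -[leLHS]addr0 lerD //.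
by rewrite lerD // lern1 leq_b1.
Qed.

End Tracking.

(** * Truncated geometric noise *)

Lemma count_window a b n : (\sum_(v < n) (a <= v < b))%N = (minn n b - a)%N.
Proof.
elim: n => [|n IH]; first by rewrite big_ord0 min0n.
by rewrite big_ord_recr /= IH; lia.
Qed.

Section Geometric.
Variables (R : realType) (p : R) (N : nat).
Hypothesis p01 : 0 < p <= 1.
Let q := 1 - p.

Let p_ge0 : 0 <= p. Proof. by case/andP: p01 => /ltW. Qed.
Let q_ge0 : 0 <= q. Proof. by rewrite subr_ge0; case/andP: p01. Qed.
Let q_le1 : q <= 1. Proof. by rewrite gerBl. Qed.

(* Count up from v while a p-coin shows tails, for at most r tosses. *)
Fixpoint geo (r v : nat) (phi : nat -> R) : R :=
  if r is r'.+1 then q * geo r' v.+1 phi + p * phi v else phi v.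

Definition geo_weight (v : nat) : R := if (v < N)%N then p * q ^+ v else q ^+ N.

Definition geoE (phi : nat -> R) := \sum_(v < N.+1) geo_weight v * phi v.

Lemma geo_geoE phi : geo N 0 phi = geoE phi.
Proof.
have gen r v : geo r v phi = \sum_(i < r) p * q ^+ i * phi (v + i)%N + q ^+ r * phi (v + r)%N.
  elim: r v => [|r IH] v /=; first by rewrite big_ord0 add0r mul1r addn0.
  rewrite IH big_ord_recl expr0 mulr1 addn0 mulrDr mulr_sumr addrC addrA addSnnS exprS mulrA.
  congr (_ + _ + _); apply: eq_bigr => i _.
  by rewrite addSnnS exprS; ring.
rewrite gen /geoE big_ord_recr /= /geo_weight ltnn; congr (_ + _).
by apply: eq_bigr => i _; rewrite ltn_ord.
Qed.

Lemma geo_weight_ge0 v : 0 <= geo_weight v.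
Proof. by rewrite /geo_weight; case: ifP => _; rewrite ?mulr_ge0 ?exprn_ge0. Qed.

Lemma geoE_le phi psi : (forall v, (v <= N)%N -> phi v <= psi v) ->
  geoE phi <= geoE psi.
Proof.
move=> le; apply: ler_sum => v _.
by apply: ler_wpM2l; [exact: geo_weight_ge0 | apply: le; rewrite -ltnS].
Qed.

Lemma eq_geoE phi psi : phi =1 psi -> geoE phi = geoE psi.
Proof. by move=> e; apply: eq_bigr => v _; rewrite e. Qed.

(** The mass put on the cap makes the tail exactly geometric up to [N]. *)
Lemma geo_tail thr : (thr <= N)%N ->
  \sum_(v < N.+1 | (thr <= v)%N) geo_weight v = q ^+ thr.
Proof.
move=> le_thr; rewrite big_mkcond big_ord_recr /= le_thr /geo_weight ltnn.
have -> : \sum_(i < N) (if (thr <= i)%N then if (i < N)%N then p * q ^+ i else q ^+ N else 0)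
   = q ^+ thr - q ^+ N.
  rewrite (eq_bigr (fun i : 'I_N => if (thr <= i)%N then p * q ^+ i else 0)); last first.
    by move=> i _; rewrite ltn_ord.
  elim: N le_thr => [|n IH]; first by rewrite leqn0 => /eqP ->; rewrite big_ord0 subrr.
  rewrite leq_eqVlt big_ord_recr /= => /predU1P[->|]; last first.
    by rewrite ltnS => le; rewrite IH // le exprS /q; ring.
  rewrite ltnn subrr addr0 big1 // => i _.
  by rewrite leqNgt (ltn_trans (ltn_ord i)).
by rewrite subrK.
Qed.

Lemma geoE_cst c : geoE (fun _ => c) = c.
Proof.
rewrite /geoE -mulr_suml -[RHS]mul1r; congr (_ * _).
by have := geo_tail (leq0n N); rewrite expr0 => <-; apply: eq_bigl.
Qed.

Lemma geoED phi psi : geoE (fun v => phi v + psi v) = geoE phi + geoE psi.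
Proof. by rewrite /geoE -big_split; apply: eq_bigr => v _; rewrite mulrDr. Qed.

Lemma geoEZ c phi : geoE (fun v => c * phi v) = c * geoE phi.
Proof. by rewrite /geoE mulr_sumr; apply: eq_bigr => v _; rewrite mulrCA. Qed.

(** A count that has reached [v0] starts afresh, with mean at most [p^-1]. Summed over all cells,
    this controls the largest count. *)
Lemma geoE_excess v0 : geoE (fun v => (v - v0)%:R) <= q ^+ v0 / p.
Proof.
have p0 : 0 < p by case/andP: p01.
(* The bound is the mean excess of an uncapped count started at [v]: [q / p] is its mean, and
   [q ^+ (v0 - v)] the chance of reaching [v0]. *)
have gen r v : geo r v (fun v => (v - v0)%:R) <= (v - v0)%:R + q ^+ (v0 - v) * (q / p).
  elim: r v => [|r IH] v /=.
    by rewrite lerDl mulr_ge0 ?exprn_ge0 // divr_ge0.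
  apply: le_trans (lerD (ler_wpM2l q_ge0 (IH v.+1)) (lexx _)) _.
  have qp : q * (1 + q / p) = q / p by rewrite /q; field; rewrite gt_eqF.
  have [le_v|lt_v] := leqP v0 v.
    have /eqP -> : (v0 - v)%N == 0%N by lia.
    have /eqP -> : (v0 - v.+1)%N == 0%N by lia.
    rewrite subSn // expr0 mul1r -[(v - v0).+1]addn1 natrD -addrA mulrDr qp.
    by rewrite /q le_eqVlt; apply/orP; left; apply/eqP; ring.
  have -> : (v.+1 - v0 = 0)%N by lia.
  have -> : (v - v0 = 0)%N by lia.
  have -> : (v0 - v = (v0 - v.+1).+1)%N by lia.
  by rewrite mulr0n exprS mulr0 addr0 !add0r -(mulrA q).
rewrite -geo_geoE; apply: le_trans (gen N 0%N) _.
rewrite sub0n add0r subn0 mulrA ler_pM2r ?invr_gt0 //.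
by apply: ler_piMr => //; apply: exprn_ge0.
Qed.

(* A marks the noise values for which an action is chosen, B those for which it
   is then abandoned. Memorylessness bounds the probability of A and B by that of
   A times the length of the window of noise values in which B can happen. *)
Lemma geoE_switch (A B : pred nat) (h : nat -> R) (c : R) :
  0 <= c -> (forall v, 0 <= h v) ->
  (forall u v, A u -> (u <= v)%N -> A v) ->
  (forall thr vs v, A thr -> A vs -> (thr <= v)%N -> (v <= N)%N ->
     (vs <= N)%N -> (thr <= N)%N -> B v -> (v - thr)%:R <= h vs * c) ->
  geoE (fun v => (A v && B v)%:R) <=
  p * geoE (fun v => (A v)%:R * (h v * c + 1)) + q ^+ N.
Proof.
move=> c0 h0 up win.
have rhs0 : 0 <= p * geoE (fun v => (A v)%:R * (h v * c + 1)).
  apply: mulr_ge0 => //; rewrite -(geoE_cst 0); apply: geoE_le => v _.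
  by apply: mulr_ge0 => //; rewrite addr_ge0 ?mulr_ge0.
have [/existsP[v1 Av1]|/existsPn noA] := boolP [exists v : 'I_N.+1, A v]; last first.
  apply: le_trans (_ : 0 <= _); last by rewrite addr_ge0 ?exprn_ge0.
  rewrite -[leRHS](geoE_cst 0); apply: geoE_le => v; rewrite -ltnS => lt_v.
  by rewrite (negbTE (noA (Ordinal lt_v))).
have exA : exists v, A v by exists v1.
pose thr := ex_minn exA.
have [Athr minthr] : A thr /\ forall v, A v -> (thr <= v)%N.
  by rewrite /thr; case: ex_minnP.
have thrN : (thr <= N)%N by apply: leq_trans (minthr _ Av1) _; rewrite -ltnS.
(* The window is measured with the smallest [h] on [A], which lies below the average of [h] there.
   This keeps the final bound proportional to the expected loss. *)
case: (@Order.TotalTheory.arg_minP _ _ _ v1 (fun v : 'I_N.+1 => A v) (fun v => h v) Av1) => vs Avs minh.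
have lower : p * ((h vs * c + 1) * q ^+ thr) <= p * geoE (fun v => (A v)%:R * (h v * c + 1)).
  apply: ler_wpM2l => //; rewrite -geo_tail // mulr_sumr /geoE big_mkcond.
  apply: ler_sum => v _; case: ifP => [le_v|_]; last first.
    rewrite mulr_ge0 ?geo_weight_ge0 // mulr_ge0 //.
    by rewrite addr_ge0 ?mulr_ge0.
  rewrite (up _ _ Athr le_v) mul1r mulrC; apply: ler_wpM2l; first exact: geo_weight_ge0.
  by rewrite lerD2r ler_wpM2r // minh // (up _ _ Athr le_v).
apply: le_trans (_ : p * ((h vs * c + 1) * q ^+ thr) + q ^+ N <= _); last by rewrite lerD2r.
(* The capped value [N] is split off; its weight is the additive term [q ^+ N]. *)
rewrite /geoE big_ord_recr /= lerD //; last first.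
  by rewrite {1}/geo_weight ltnn; case: (_ && _); rewrite ?mulr1 // mulr0 exprn_ge0.
have [/existsP[m0 bad0]|/existsPn nobad] := boolP [exists v : 'I_N, A v && B v]; last first.
  have hc0 : 0 <= h vs * c + 1 by rewrite addr_ge0 // mulr_ge0.
  have qt0 : 0 <= q ^+ thr by apply: exprn_ge0.
  rewrite big1 => [|v _]; first by rewrite !mulr_ge0.
  by rewrite (negbTE (nobad v)) mulr0.
(* All bad values below the cap lie between [thr] and the largest one [m]: at most [m - thr + 1] of
   them, each of weight at most [p * q ^+ thr]. This is the origin of the [+ 1] in the statement. *)
case: (@arg_maxnP _ m0 (fun v : 'I_N => A v && B v) (fun v => v) bad0) => m /andP[Am Bm] maxm.
have le_thm : (thr <= m)%N := minthr m Am.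
have mbound : (m - thr)%:R <= h vs * c.
  by apply: win => //; [exact: ltnW | rewrite -ltnS].
apply: (@le_trans _ _ (p * q ^+ thr * \sum_(v < N) ((thr <= v < m.+1)%N)%:R)).
  rewrite mulr_sumr; apply: ler_sum => v _.
  rewrite /geo_weight ltn_ord; have [bad|bad] := boolP (A v && B v); last first.
    by rewrite mulr0 !mulr_ge0 ?exprn_ge0.
  case/andP: (bad) => Av Bv; have /= le_vm := maxm v bad; rewrite ltnS (minthr _ Av) le_vm !mulr1.
  by apply: ler_wpM2l => //; apply: ler_wiXn2l => //; apply: minthr.
rewrite -mulrA; apply: ler_wpM2l => //; rewrite mulrC; apply: ler_wpM2r; first exact: exprn_ge0.
rewrite -natr_sum count_window.
apply: le_trans (_ : (m - thr).+1%:R <= _); last first.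
  by rewrite -addn1 natrD lerD2r.
by rewrite ler_nat -subSn // leq_sub2r // geq_minr.
Qed.

(** * Independent counts, one for each cell *)

Section Product.
Variable I : eqType.
Implicit Types (g : I -> nat) (l : seq I).

Definition upd g i v : I -> nat := fun j => if j == i then v else g j.

Fixpoint prodE l g (f : (I -> nat) -> R) : R :=
  if l is i :: l' then geo N 0 (fun v => prodE l' (upd g i v) f) else f g.

Lemma prodE_cons i l g f :
  prodE (i :: l) g f = geoE (fun v => prodE l (upd g i v) f).
Proof. by rewrite -geo_geoE. Qed.

Lemma upd_upd g i u v : upd (upd g i u) i v = upd g i v.
Proof. by apply/funext => j; rewrite /upd; case: eqP. Qed.

Lemma upd_comm g i j u v : i != j ->
  upd (upd g i u) j v = upd (upd g j v) i u.
Proof.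
move=> ij; apply/funext => k; rewrite /upd; case: (eqVneq k j) => [->|//].
by rewrite eq_sym (negbTE ij).
Qed.

Lemma prodE_le l g f f' : (forall i, (g i <= N)%N) ->
  (forall g', (forall i, (g' i <= N)%N) -> f g' <= f' g') ->
  prodE l g f <= prodE l g f'.
Proof.
elim: l g => [|i l IH] g gN le; first exact: le.
rewrite !prodE_cons; apply: geoE_le => v vN; apply: IH => // j.
by rewrite /upd; case: eqP.
Qed.

Lemma eq_prodE l g f f' : f =1 f' -> prodE l g f = prodE l g f'.
Proof. by move=> /funext ->. Qed.

Lemma prodED l g f f' :
  prodE l g (fun g => f g + f' g) = prodE l g f + prodE l g f'.
Proof.
elim: l g => // i l IH g; rewrite !prodE_cons -geoED.
by apply: eq_geoE => v; rewrite IH.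
Qed.

Lemma prodEZ l g c f : prodE l g (fun g => c * f g) = c * prodE l g f.
Proof.
elim: l g => // i l IH g; rewrite !prodE_cons -geoEZ.
by apply: eq_geoE => v; rewrite IH.
Qed.

Lemma prodE_cst l g c : prodE l g (fun _ => c) = c.
Proof.
elim: l g => // i l IH g; rewrite prodE_cons -[RHS]geoE_cst.
by apply: eq_geoE => v; rewrite IH.
Qed.

Lemma prodE_sum (J : Type) (r : seq J) l g (f : J -> (I -> nat) -> R) :
  prodE l g (fun g => \sum_(j <- r) f j g) = \sum_(j <- r) prodE l g (f j).
Proof.
elim: r => [|j r IH].
  by rewrite big_nil -[RHS](prodE_cst l g); apply: eq_prodE => g'; rewrite big_nil.
by rewrite big_cons -IH -prodED; apply: eq_prodE => g'; rewrite big_cons.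
Qed.

Lemma prodE_geoE l g (f : (I -> nat) -> nat -> R) :
  prodE l g (fun g' => geoE (f g')) = geoE (fun v => prodE l g (f^~ v)).
Proof.
rewrite /geoE prodE_sum; apply: eq_bigr => v _; exact: prodEZ.
Qed.

Lemma prodE_updC l g i u f : i \notin l ->
  prodE l (upd g i u) f = prodE l g (fun g' => f (upd g' i u)).
Proof.
elim: l g => // j l IH g; rewrite inE negb_or => /andP[ij il].
rewrite !prodE_cons; apply: eq_geoE => v.
by rewrite upd_comm // IH.
Qed.

(** Redrawing one of several independent counts preserves expectations. Inside the outer expectation
    a single count then varies while all others are fixed. *)
Lemma prodE_resample l g i f : uniq l -> i \in l ->
  prodE l g f = prodE l g (fun g' => geoE (fun v => f (upd g' i v))).
Proof.
elim: l g => // j l IH g /andP[jl ul]; rewrite inE => /orP[/eqP ->|il]; last first.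
  by rewrite !prodE_cons; apply: eq_geoE => v; apply: IH.
rewrite [LHS]prodE_cons [RHS]prodE_cons -[LHS]geoE_cst.
apply: eq_geoE => u; rewrite prodE_updC // prodE_geoE; apply: eq_geoE => v.
rewrite prodE_updC //; apply: eq_prodE => g'.
by rewrite upd_upd.
Qed.

Lemma prodE_marginal l g i phi : uniq l -> i \in l ->
  prodE l g (fun g' => phi (g' i)) = geoE phi.
Proof.
move=> ul il; rewrite (prodE_resample _ _ ul il) -[RHS](prodE_cst l g).
by apply: eq_prodE => g'; apply: eq_geoE => v; rewrite /upd eqxx.
Qed.

End Product.
End Geometric.

(** * The perturbed leader *)

Lemma exp_half (R : realType) (Q : nat) : (0 < Q)%N ->
  (1 - Q%:R^-1) ^+ Q <= 1 / 2 :> R.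
Proof.
move=> Q0; have Q0' : 0 < Q%:R :> R by rewrite ltr0n.
have le1 : Q%:R^-1 <= 1 :> R by rewrite invf_le1 // ler1n.
apply: (@le_trans _ _ (expR (- Q%:R^-1) ^+ Q)).
  by apply: lerXn2r; rewrite ?nnegrE ?subr_ge0 ?expR_ge0 //; apply: expR_ge1Dx.
rewrite -expRM_natl mulrN mulfV ?gt_eqF // expRN div1r lef_pV2 ?posrE ?expR_gt0 //.
by have := expR_ge1Dx (1 : R); lra.
Qed.

Lemma sum_ord_cst (R : realType) n (c : R) : \sum_(i < n) c = n%:R * c.
Proof. by rewrite sumr_const card_ord mulr_natl. Qed.

Section PerturbedLeader.
Variables (R : realType) (nS nA T lg N : nat).
Local Notation policy := {ffun 'I_nS -> 'I_nA}.
Hypotheses (nS_gt1 : (1 < nS)%N) (nA_gt0 : (0 < nA)%N) (T_gt0 : (0 < T)%N).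
Hypothesis lgP : (nS * nA <= 2 ^ lg)%N.
Hypothesis NE : N = (nS * T * (T * nS * nA))%N.

Let S := nS%:R : R.
Let Q := (nS * T)%:R : R.
Let p := Q^-1.
Let q := 1 - p.
Let B := S ^+ 2 * lg%:R.

(** Cells are named by index lists, as in the memory array that holds the counts. *)
Definition cell_of (s : 'I_nS) (a : 'I_nA) : seq nat := [:: val s; val a].

Variable coords : seq (seq nat).
Hypothesis coords_uniq : uniq coords.
Hypothesis mem_coords : forall s a, cell_of s a \in coords.

Let E := prodE p N coords (fun _ => 0%N).

Variables (h : nat -> policy -> R) (n : nat -> nat).
Variable pi : nat -> (seq nat -> nat) -> policy.
Variable best : nat -> policy.
Hypothesis h01 : forall t f, 0 <= h t f <= 1.

Let L t f := \sum_(j < t) h j f.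
Let noise (g : seq nat -> nat) (f : policy) : R := \sum_s (g (cell_of s (f s)))%:R.

Hypothesis n0 : n 0 = 2.
Hypothesis nS' : forall t, n t.+1 = n t \/ n t.+1 = (n t).+1.
Hypothesis pi_opt : forall t g f, (t <= T)%N -> (forall i, (g i <= N)%N) ->
  L t (pi t g) - (n t)%:R / T%:R * noise g (pi t g) <=
  L t f - (n t)%:R / T%:R * noise g f.
Hypothesis best_le : forall t, (t <= T)%N -> L t (best t) <= (n t)%:R ^+ 2 * B.

Let T0 : 0 < T%:R :> R. Proof. by rewrite ltr0n. Qed.
Let S0 : 0 < S. Proof. by rewrite ltr0n ltnW. Qed.
Let Q0 : 0 < Q. Proof. by rewrite ltr0n muln_gt0 T_gt0 ltnW. Qed.
Let p01 : 0 < p <= 1.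
Proof. by rewrite invr_gt0 Q0 invf_le1 // ler1n muln_gt0 T_gt0 ltnW. Qed.
Let n_ge2 t : (2 <= n t)%N.
Proof. by elim: t => [|t IH]; [rewrite n0 | case: (nS' t) => -> //; apply: leqW]. Qed.
Let nt0 t : 0 < (n t)%:R :> R. Proof. by rewrite ltr0n; apply: ltn_trans (n_ge2 t). Qed.
Let h_ge0 t f : 0 <= h t f. Proof. by case/andP: (h01 t f). Qed.
Let h_le1 t f : h t f <= 1. Proof. by case/andP: (h01 t f). Qed.
Let q_ge0 : 0 <= q. Proof. by rewrite subr_ge0; case/andP: p01. Qed.

Let LS t f : L t.+1 f = L t f + h t f.
Proof. by rewrite /L big_ord_recr. Qed.

Let lg_gt0 : (0 < lg)%N.
Proof.
case: lg lgP => // ; rewrite expn0 => le1.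
have := leq_trans (leq_mul nS_gt1 nA_gt0) le1; by [].
Qed.

Let B_ge4 : 4 <= B.
Proof.
have S2 : 2 <= S by rewrite ler_nat.
have : 1 <= lg%:R :> R by rewrite ler1n.
rewrite /B => l1; apply: le_trans (_ : S ^+ 2 <= _); first by rewrite expr2; nra.
by rewrite ler_peMr // exprn_ge0 // ltW.
Qed.

Let qQm m : q ^+ (nS * T * m) <= (1 / 2) ^+ m.
Proof.
rewrite exprM; apply: lerXn2r; rewrite ?nnegrE ?exprn_ge0 ?divr_ge0 //.
by apply: exp_half; rewrite muln_gt0 T_gt0 ltnW.
Qed.

(** By [qQm], [nS * T] tosses halve the tail. The cap allows [T * nS * nA] halvings, enough for the
    truncation error over all cells to stay below [1 / T] in a round. *)
Let qN : (S * nA%:R) * q ^+ N <= T%:R^-1.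
Proof.
rewrite -[leRHS]div1r ler_pdivlMr // mulrAC.
apply: (@le_trans _ _ ((T * nS * nA)%:R * (1 / 2) ^+ (T * nS * nA))).
  rewrite !natrM [S * _ * _]mulrC mulrA; apply: ler_wpM2l; first by rewrite !mulr_ge0.
  by rewrite NE qQm.
by rewrite div1r exprVn ler_pdivrMr ?exprn_gt0 // mul1r -natrX ler_nat ltnW // ltn_expl.
Qed.

Let sw t g : R := (pi t.+1 g != pi t g)%:R.

Let cell_of_inj s a s' a' : cell_of s a = cell_of s' a' -> s = s' /\ a = a'.
Proof. by case=> /val_inj -> /val_inj ->. Qed.

Let noise_upd g s a v f : noise (upd g (cell_of s a) v) f =
  (if f s == a then v else g (cell_of s (f s)))%:R +
  \sum_(s' | s' != s) (g (cell_of s' (f s')))%:R.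
Proof.
rewrite /noise (bigD1 s) //=; congr (_ + _).
  rewrite /upd; case: (eqVneq (f s) a) => [->|ne]; first by rewrite eqxx.
  by case: eqP => // /cell_of_inj[_ e]; rewrite e eqxx in ne.
apply: eq_bigr => s' ss'; rewrite /upd; case: eqP => // /cell_of_inj[e].
by rewrite e eqxx in ss'.
Qed.

(** With the other counts fixed, raising the count of [(s, a)] favours exactly the policies that
    play [a] in [s], and all of them equally. The choice of [a] is thus a threshold event, and a
    round moves the threshold by at most [T / n] times a loss. *)
Lemma switch_coord t g s a : (t < T)%N -> n t.+1 = n t ->
  (forall i, (g i <= N)%N) ->
  geoE p N (fun v => ((pi t (upd g (cell_of s a) v) s == a) &&
                      (pi t.+1 (upd g (cell_of s a) v) s != a))%:R) <=
  p * geoE p N (fun v => (pi t (upd g (cell_of s a) v) s == a)%:R *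
      (h t (pi t (upd g (cell_of s a) v)) * (T%:R / (n t)%:R) + 1)) + q ^+ N.
Proof.
move=> lt_t nn gN; set i := cell_of s a; set c := T%:R / (n t)%:R.
have c0 : 0 < c by rewrite divr_gt0.
have updN v : (v <= N)%N -> forall j, (upd g i v j <= N)%N.
  by move=> vN j; rewrite /upd; case: eqP.
have opt v f := pi_opt (t := t) (g := upd g i v) f (ltnW lt_t).
have opt' v f := pi_opt (t := t.+1) (g := upd g i v) f lt_t.
have cV : (n t)%:R / T%:R = c^-1 :> R by rewrite invf_div.
(* Optimality is known for counts up to [N] only; adding [N < v] to the event makes it upward closed
   on all naturals, and [drop] removes it again. *)
have E1 : geoE p N (fun v => (((pi t (upd g i v) s == a) || (N < v)%N) && (pi t.+1 (upd g i v) s != a))%:R) <=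
  p * geoE p N (fun v => (((pi t (upd g i v) s == a) || (N < v)%N))%:R * (h t (pi t (upd g i v)) * c + 1)) + q ^+ N.
  apply: (@geoE_switch _ p N p01 (fun v => (pi t (upd g i v) s == a) || (N < v)%N)
     (fun v => pi t.+1 (upd g i v) s != a) (fun v => h t (pi t (upd g i v))) c).
  - exact: ltW.
  - by move=> v; apply: h_ge0.
  - move=> u v /= Au uv; have [vN|] := leqP v N; last by rewrite orbT.
    have uN := leq_trans uv vN; move: Au; rewrite ltnNge uN /= orbF => /eqP Au.
    apply/negPn/negP; rewrite ?orbF => nAv.
    (* If [a] were given up at a larger count, the optimality of the two leaders would contradict
       the strict gain of the policies that play [a]. Strictness makes tie-breaking irrelevant. *)
    move: uv; rewrite leq_eqVlt => /predU1P[uv|uv]; first by rewrite -uv Au eqxx in nAv.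
    have := opt v (pi t (upd g i u)) (updN _ vN).
    have := opt u (pi t (upd g i v)) (updN _ uN).
    rewrite !noise_upd Au eqxx (negbTE nAv) cV.
    have : 0 < c^-1 * (v%:R - u%:R) by rewrite mulr_gt0 ?invr_gt0 // subr_gt0 ltr_nat.
    by rewrite !mulrDr; lra.
  (* Three optimality inequalities are chained: at [thr] against the later choice, at [vs] between
     two policies that both play [a], and at [v] in round [t.+1]. What remains is that [v - thr] is
     at most [T / n] times the loss of the leader at [vs]. *)
  move=> thr vs v /=; rewrite !ltnNge => Athr Avs thv vN vsN thN Bv.
  move: Athr Avs; rewrite vsN thN /= !orbF => /eqP Athr /eqP Avs.
  have := opt thr (pi t.+1 (upd g i v)) (updN _ thN).
  have := opt vs (pi t (upd g i thr)) (updN _ vsN).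
  have := opt' v (pi t (upd g i vs)) (updN _ vN).
  rewrite !noise_upd Athr Avs eqxx (negbTE Bv) nn cV !LS => h1 h2 h3.
  rewrite natrB // -ler_pdivrMr // mulrC.
  have := h_ge0 t (pi t.+1 (upd g i v)); move: h1 h2 h3; rewrite !mulrDr mulrN; lra.
have drop v : (v <= N)%N -> (pi t (upd g i v) s == a) || (N < v)%N = (pi t (upd g i v) s == a).
  by rewrite ltnNge => ->; rewrite orbF.
apply: le_trans (le_trans E1 _).
  by apply: geoE_le => // v vN; rewrite drop.
rewrite lerD2r; apply: ler_wpM2l; first by case/andP: p01 => /ltW.
by apply: geoE_le => // v vN; rewrite drop.
Qed.

(** A change of policy shows in some state. Each of the [nS] states contributes a factor [p], and
    [S * p] is [1 / T]; the truncation error gives the other [1 / T]. *)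
Lemma switch_prob t : (t < T)%N -> n t.+1 = n t ->
  E (sw t) <= E (fun g => h t (pi t g)) / (n t)%:R + 2 / T%:R.
Proof.
move=> lt_t nn; pose c : R := T%:R / (n t)%:R.
pose bad s a g := (pi t g s == a) && (pi t.+1 g s != a).
have step1 : E (sw t) <= E (fun g => \sum_s \sum_a (bad s a g)%:R).
  apply: prodE_le => // g _; rewrite /sw; case: eqP => [_|/eqP ne].
    by apply: sumr_ge0 => s _; apply: sumr_ge0.
  have [s ns] : exists s, pi t.+1 g s != pi t g s.
    apply/existsP; apply: contraNT ne => /existsPn e; apply/eqP/ffunP => s.
    by apply/eqP; rewrite -[_ == _]negbK; apply: e.
  rewrite (bigD1 s) //= (bigD1 (pi t g s)) //= /bad eqxx ns /= -addrA lerDl.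
  by rewrite addr_ge0 // !sumr_ge0 // => s' _; rewrite sumr_ge0.
apply: le_trans step1 _.
rewrite /E prodE_sum.
pose W s a g := (pi t g s == a)%:R * (h t (pi t g) * c + 1).
apply: (@le_trans _ _ (\sum_s \sum_a (p * E (W s a) + q ^+ N))).
  apply: ler_sum => s _; rewrite prodE_sum; apply: ler_sum => a _.
  rewrite (prodE_resample p N _ _ coords_uniq (mem_coords s a)).
  rewrite [E (W s a)](prodE_resample p N _ _ coords_uniq (mem_coords s a)).
  rewrite -prodEZ -[q ^+ N](prodE_cst p N coords (fun=> 0%N)) -prodED.
  by apply: prodE_le => // g gN; apply: switch_coord.
have -> : \sum_s \sum_a (p * E (W s a) + q ^+ N) =
   \sum_(s < nS) (p * E (fun g => h t (pi t g) * c + 1)) + S * nA%:R * q ^+ N.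
  under eq_bigr do rewrite big_split /=.
  rewrite big_split /=; congr (_ + _); last first.
    by rewrite !sum_ord_cst mulrA.
  apply: eq_bigr => s _; rewrite -mulr_sumr /E -prodE_sum; congr (_ * _).
  (* A policy plays one action in each state, so the sum over [a] has a single nonzero term and no
     factor [nA] arises. *)
  apply: eq_prodE => g; rewrite (bigD1 (pi t g s)) //= /W eqxx mul1r big1 ?addr0 // => a.
  by rewrite eq_sym => /negbTE ->; rewrite mul0r.
rewrite sum_ord_cst mulrA.
have -> : S * p = T%:R^-1 by rewrite /p /Q natrM invfM mulrA divff ?mul1r // gt_eqF.
have -> : E (fun g => h t (pi t g) * c + 1) = E (fun g => h t (pi t g)) * c + 1.
  rewrite /E prodED prodE_cst; congr (_ + _).
  by rewrite mulrC -prodEZ; apply: eq_prodE => g; rewrite mulrC.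
apply: le_trans (lerD (lexx _) qN) _.
have fld X : T%:R^-1 * (X * c + 1) + T%:R^-1 = X / (n t)%:R + 2 / T%:R.
  by rewrite /c; field; rewrite !gt_eqF.
by rewrite fld.
Qed.

Let sw_le1 t : E (sw t) <= 1.
Proof.
rewrite -[leRHS](prodE_cst p N coords (fun=> 0%N)); apply: prodE_le => // g _.
by rewrite /sw lern1 leq_b1.
Qed.

Let Hh t := E (fun g => h t (pi t g)).
Let Z k := \sum_(t < k) Hh t / (n t)%:R.

(** [n k] pays for the [n k - 2] rounds in which the scale grows, where a switch is simply granted,
    and for the terms [2 / T], which add up to at most 2. *)
Lemma expected_switches k : (k <= T)%N ->
  \sum_(t < k) E (sw t) <= Z k + (n k)%:R.
Proof.
move=> kT; have : \sum_(t < k) E (sw t) <= Z k + ((n k)%:R - 2) + k%:R * (2 / T%:R).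
  elim: k kT => [|k IH] kT; first by rewrite /Z !big_ord0 n0 mul0r; lra.
  have {}IH := IH (ltnW kT).
  rewrite /Z !big_ord_recr /= -/(Z k) -[k.+1]addn1 natrD mulrDl mul1r addn1.
  have tT : 0 <= 2 / T%:R :> R by rewrite divr_ge0.
  have Hn : 0 <= Hh k / (n k)%:R.
    apply: divr_ge0 => //; rewrite -(prodE_cst p N coords (fun=> 0%N) 0).
    by apply: prodE_le => // g _.
  case: (nS' k) => e.
    by have := switch_prob kT e; rewrite e -/(Hh k); lra.
  by have := sw_le1 k; rewrite e -addn1 natrD; lra.
move/le_trans; apply; rewrite -addrA lerD2l.
have : k%:R * (2 / T%:R) <= 2 :> R.
  by rewrite mulrA ler_pdivrMr // mulrC ler_wpM2l // ler_nat.
lra.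
Qed.

Let v0 := (nS * T * lg)%N.
(** Bounds every count. A count survives the level [v0] with probability at most [2 ^ - lg], hence
    at most [1 / (nS * nA)], so all excesses together add at most [Q] to the mean. *)
Let Mx (g : seq nat -> nat) : R := v0%:R + \sum_s \sum_a (g (cell_of s a) - v0)%:R.

Let Mx_ge g s a : (g (cell_of s a))%:R <= Mx g.
Proof.
rewrite /Mx (bigD1 s) //= (bigD1 a) //= -addrA.
apply: le_trans (_ : v0%:R + (g (cell_of s a) - v0)%:R <= _).
  by rewrite -natrD ler_nat -leq_subLR.
rewrite lerD2l lerDl addr_ge0 ?sumr_ge0 // => s' _; exact: sumr_ge0.
Qed.

Let E_Mx : E Mx <= 2 * Q * lg%:R.
Proof.
rewrite /E /Mx prodED prodE_cst prodE_sum //.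
apply: (@le_trans _ _ (v0%:R + \sum_(s < nS) \sum_(a < nA) q ^+ v0 / p)).
  rewrite lerD2l; apply: ler_sum => s _; rewrite prodE_sum //; apply: ler_sum => a _.
  rewrite (prodE_marginal p N (fun=> 0%N) (fun v => (v - v0)%:R) coords_uniq (mem_coords s a)).
  exact: geoE_excess.
rewrite !sum_ord_cst mulrA /p invrK.
have : nS%:R * nA%:R * (q ^+ v0 * Q) <= Q.
  rewrite mulrA ler_piMl ?(ltW Q0) //.
  apply: le_trans (ler_wpM2l _ (qQm lg)) _; first by rewrite mulr_ge0.
  by rewrite div1r exprVn ler_pdivrMr ?exprn_gt0 // mul1r -natrX -natrM ler_nat.
have : v0%:R = Q * lg%:R by rewrite /v0 natrM.
have : Q <= Q * lg%:R by rewrite ler_peMr ?(ltW Q0) // ler1n.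
lra.
Qed.

Let noise_le g f : noise g f <= S * Mx g.
Proof.
rewrite /noise /S mulr_natl -[X in _ *+ X](card_ord nS) -sumr_const.
by apply: ler_sum => s _; apply: Mx_ge.
Qed.

Let noise_ge0 g f : 0 <= noise g f. Proof. by apply: sumr_ge0. Qed.

(* Be-the-leader, with a perturbation whose scale n grows with time. *)
Lemma be_the_leader k g f : (k <= T)%N -> (forall i, (g i <= N)%N) ->
  \sum_(t < k) h t (pi t.+1 g) <= L k f + (n k)%:R * (S / T%:R * Mx g).
Proof.
move=> kT gN.
have Mx0 : 0 <= Mx g by rewrite addr_ge0 // sumr_ge0 // => s _; rewrite sumr_ge0.
have Rg f' : T%:R^-1 * noise g f' <= S / T%:R * Mx g.
  rewrite mulrAC [leRHS]mulrC; apply: ler_wpM2l; last exact: noise_le.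
  by rewrite invr_ge0 ltW.
(* The right side contains the perturbed objective of the leader, which telescopes; a unit increase
   of the scale is charged to the last term. *)
have : \sum_(t < k) h t (pi t.+1 g) <=
   L k (pi k g) - (n k)%:R / T%:R * noise g (pi k g) + (n k)%:R * (S / T%:R * Mx g).
  elim: k kT => [|k IH] kT.
    rewrite big_ord0 /L big_ord0 sub0r addrC -(mulrA (n 0)%:R) -mulrBr mulr_ge0 //.
    by rewrite subr_ge0.
  have {}IH := IH (ltnW kT).
  have := pi_opt (t := k) (pi k.+1 g) (ltnW kT) gN.
  rewrite big_ord_recr /= LS.
  have := Rg (pi k.+1 g); case: (nS' k) => ->; first by move: IH; lra.
  rewrite -[(n k).+1]addn1 natrD !mulrDl !mul1r; move: IH; lra.
move/le_trans; apply; rewrite lerD2r.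
apply: le_trans (pi_opt f kT gN) _.
by rewrite gerBl mulr_ge0 // divr_ge0.
Qed.

(** The leader of round [t] differs from the one that already knows round [t] only at a switch, at a
    cost of at most 1. Of [3 * B * n], two parts come from the noise and one covers the [n] of
    [expected_switches]. *)
Lemma perturbed_prefix k : (k <= T)%N ->
  \sum_(t < k) Hh t <= L k (best k) + 3 * B * (n k)%:R + Z k.
Proof.
move=> kT.
have step : \sum_(t < k) Hh t <=
    E (fun g => L k (best k) + (n k)%:R * (S / T%:R) * Mx g + \sum_(t < k) sw t g).
  rewrite /Hh -prodE_sum //; apply: prodE_le => // g gN.
  apply: (@le_trans _ _ (\sum_(t < k) (h t (pi t.+1 g) + sw t g))).
    apply: ler_sum => t _; rewrite /sw; case: eqP => [->|_]; first by rewrite addr0.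
    by apply: le_trans (h_le1 _ _) _; rewrite lerDr.
  by rewrite big_split /= lerD2r -mulrA; apply: be_the_leader.
apply: le_trans step _; rewrite /E !prodED prodE_cst prodEZ prodE_sum // -/E.
have := expected_switches kT.
have : (n k)%:R * (S / T%:R) * E Mx <= (n k)%:R * (2 * B).
  rewrite -mulrA; apply: ler_wpM2l; first exact: ltW.
  apply: le_trans (ler_wpM2l _ E_Mx) _; first by rewrite divr_ge0 // ltW.
  rewrite le_eqVlt /Q /B natrM; apply/orP; left; apply/eqP; rewrite -/S; field.
  by rewrite gt_eqF.
have : (n k)%:R <= B * (n k)%:R by rewrite ler_peMl ?(ltW (nt0 k)) // (le_trans _ B_ge4) // ler1n.
rewrite -/(Z k); lra.
Qed.

Let Hh_ge0 t : 0 <= Hh t.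
Proof.
rewrite -(prodE_cst p N coords (fun=> 0%N) 0).
by apply: prodE_le => // g _.
Qed.

(** As [n >= 2], [Z] is at most half of the loss on the left and can be absorbed. This is why the
    scale starts at 2. *)
Let prefix_bound k : (k <= T)%N ->
  \sum_(t < k) Hh t <= 5 * B * (n k)%:R ^+ 2.
Proof.
move=> kT; have := perturbed_prefix kT; have := best_le kT.
have : Z k <= (\sum_(t < k) Hh t) / 2.
  rewrite /Z mulr_suml; apply: ler_sum => t _; apply: ler_wpM2l => //.
  by rewrite lef_pV2 ?posrE // ler_nat.
have n2 : 2 <= (n k)%:R :> R by rewrite ler_nat.
have : 2 * B * (n k)%:R <= B * (n k)%:R ^+ 2.
  have B0 : 0 <= B by apply: le_trans B_ge4.
  have -> : B * (n k)%:R ^+ 2 = 2 * B * (n k)%:R + B * (n k)%:R * ((n k)%:R - 2) by ring.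
  by rewrite lerDl !mulr_ge0 // subr_ge0.
lra.
Qed.

(** Summation by parts: while [n] is constant, [Z] grows like the cumulated loss divided by [n], and
    each increase of [n] costs at most [10 * B]. *)
Let Z_bound k : (k <= T)%N -> Z k <= 15 * B * (n k)%:R.
Proof.
move=> kT.
have B0 : 0 <= B by apply: le_trans B_ge4.
have Zk : Z k <= (\sum_(t < k) Hh t) / (n k)%:R + 10 * B * (n k)%:R.
  elim: k kT => [|k IH] kT.
    by rewrite /Z !big_ord0 mul0r add0r !mulr_ge0.
  have {}IH := IH (ltnW kT).
  have cur : Z k.+1 <= (\sum_(t < k.+1) Hh t) / (n k)%:R + 10 * B * (n k)%:R.
    by rewrite /Z !big_ord_recr /= -/(Z k) mulrDl; lra.
  case: (nS' k) => e; first by rewrite e.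
  apply: le_trans cur _; have := prefix_bound kT; rewrite e.
  set X := \sum_(t < k.+1) Hh t; set m : R := (n k)%:R => XB.
  rewrite -[(n k).+1]addn1 natrD -/m in XB *.
  have m2 : 2 <= m by rewrite ler_nat.
  have m0 : 0 < m by exact: nt0.
  (* The difference is [X / (m * (m + 1))], and [X <= 5 * B * (m + 1) ^+ 2] by [prefix_bound]; a
     factor 2 bounds [(m + 1) / m]. *)
  have : X / m - X / (m + 1) <= 10 * B.
    have -> : X / m - X / (m + 1) = X / (m * (m + 1)) by field; rewrite !gt_eqF ?addr_gt0.
    rewrite ler_pdivrMr ?mulr_gt0 ?addr_gt0 //; apply: le_trans XB _.
    rewrite -subr_ge0; have -> : 10 * B * (m * (m + 1)) - 5 * B * (m + 1) ^+ 2 = 5 * B * ((m + 1) * (m - 1)) by ring.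
    apply: mulr_ge0; [by rewrite mulr_ge0 | by apply: mulr_ge0; lra].
  lra.
apply: le_trans Zk _.
have : (\sum_(t < k) Hh t) / (n k)%:R <= 5 * B * (n k)%:R.
  rewrite ler_pdivrMr //.
  have -> : 5 * B * (n k)%:R * (n k)%:R = 5 * B * (n k)%:R ^+ 2 by ring.
  exact: prefix_bound.
lra.
Qed.

(** The constants are 18 = 3 + 15 and 16 = 15 + 1, with 15 from [Z_bound]. *)
Theorem perturbed_leader :
  \sum_(t < T) Hh t <= L T (best T) + 18 * B * (n T)%:R /\
  \sum_(t < T) E (sw t) <= 16 * B * (n T)%:R.
Proof.
have Zb := Z_bound (leqnn T); split.
  by have := perturbed_prefix (leqnn T); lra.
have := expected_switches (leqnn T).
have : (n T)%:R <= B * (n T)%:R by rewrite ler_peMl ?(ltW (nt0 T)) // (le_trans _ B_ge4) // ler1n.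
lra.
Qed.

End PerturbedLeader.

(** * A program logic *)

Fixpoint wn (c : cmd) : seq nat :=
  match c with
  | NSet x _ _ | Flip x _ _ | Query _ _ x => [:: x]
  | Seq c1 c2 | If _ c1 c2 => wn c1 ++ wn c2
  | While _ c1 => wn c1
  | _ => [::]
  end.

Fixpoint wr (c : cmd) : seq nat :=
  match c with
  | RSet x _ _ => [:: x]
  | Seq c1 c2 | If _ c1 c2 => wr c1 ++ wr c2
  | While _ c1 => wr c1
  | _ => [::]
  end.

(* Steps taken by c, if each of its loops makes at most N iterations. *)
Fixpoint cost (N : nat) (c : cmd) : nat :=
  match c with
  | Seq c1 c2 => (1 + (cost N c1 + cost N c2))%N
  | If _ c1 c2 => (1 + (cost N c1 + cost N c2))%N
  | While _ c1 => (N * (1 + cost N c1) + 1)%N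
  | _ => 1%N
  end.

(** A loop multiplies the cost by about [N], so the degree depends on the program alone. This yields
    the polynomial budget of the theorem. *)
Lemma cost_poly c : exists k, forall N, (0 < N)%N -> (cost N c <= k * N ^ k)%N.
Proof.
have base : exists k, forall N, (0 < N)%N -> (1 <= k * N ^ k)%N.
  by exists 1%N => N; rewrite mul1n expn1.
have mono k k' N : (0 < N)%N -> (k <= k')%N -> (k * N ^ k <= k' * N ^ k')%N.
  by move=> N0 le; apply: leq_mul => //; apply: leq_pexp2l.
have seq c1 c2 : (exists k, forall N, (0 < N)%N -> (cost N c1 <= k * N ^ k)%N) ->
   (exists k, forall N, (0 < N)%N -> (cost N c2 <= k * N ^ k)%N) ->
   exists k, forall N, (0 < N)%N -> (1 + (cost N c1 + cost N c2) <= k * N ^ k)%N.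
  move=> [k1 IH1] [k2 IH2]; exists (1 + (k1 + k2))%N => N N0.
  have lePN k : (k <= 1 + (k1 + k2))%N -> (N ^ k <= N ^ (1 + (k1 + k2)))%N.
    by move=> le; apply: leq_pexp2l.
  rewrite mulnDl mul1n mulnDl; apply: leq_add; first by rewrite expn_gt0 N0.
  apply: leq_add.
    apply: leq_trans (IH1 N N0) _; apply: leq_mul => //; apply: lePN.
    by rewrite addnCA leq_addr.
  apply: leq_trans (IH2 N N0) _; apply: leq_mul => //; apply: lePN.
  by rewrite addnA leq_addl.
elim: c => //= [c1 IH1 c2 IH2|b c1 IH1 c2 IH2|b c1 [k IH]].
- exact: seq.
- exact: seq.
exists k.+2 => N N0.
have Nk : (0 < N ^ k.+1)%N by rewrite expn_gt0 N0.
apply: (@leq_trans (k.+2 * N ^ k.+1)); last first.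
  by rewrite leq_mul2l leq_pexp2l // orbT.
have := IH N N0; rewrite -(leq_pmul2l N0) mulnCA -expnS => leN.
rewrite mulnDr muln1 addnAC -[k.+2]addn2 mulnDl [X in (_ <= X)%N]addnC leq_add //.
have : (N <= N ^ k.+1)%N by rewrite -{1}(expn1 N) leq_pexp2l.
by rewrite mul2n -addnn => le1; apply: leq_add.
Qed.

Section Supp.
Variable R : realType.

Fixpoint allp (X : Type) (Q : X -> Prop) (mu : fdist R X) : Prop :=
  if mu is u :: mu' then Q u.2 /\ allp Q mu' else True.

Definition nneg (X : Type) (mu : fdist R X) := all (fun u => 0 <= u.1) mu.

Lemma allp_impl (X : Type) (Q Q' : X -> Prop) mu :
  (forall x, Q x -> Q' x) -> allp Q mu -> allp Q' mu.
Proof. by move=> QQ; elim: mu => //= u mu IH [/QQ Qu /IH]. Qed.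

Lemma allp_and (X : Type) (Q Q' : X -> Prop) mu :
  allp Q mu -> allp Q' mu -> allp (fun x => Q x /\ Q' x) mu.
Proof. by elim: mu => //= u mu IH [Qu /IH{}IH] [Q'u /IH]. Qed.

Lemma allp_cat (X : Type) (Q : X -> Prop) mu nu :
  allp Q (mu ++ nu) <-> allp Q mu /\ allp Q nu.
Proof. by elim: mu => [|u mu IH] /=; [|rewrite IH]; tauto. Qed.

Lemma allp_bind (X Y : Type) (Q : Y -> Prop) mu (f : X -> fdist R Y) :
  allp Q (bind mu f) <-> allp (fun x => allp Q (f x)) mu.
Proof.
elim: mu => //= u mu IH; rewrite bind_cons allp_cat IH.
suff -> : allp Q [seq (u.1 * v.1, v.2) | v <- f u.2] <-> allp Q (f u.2) by [].
by elim: (f u.2) => //= v nu ->.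
Qed.

Lemma nneg_bind (X Y : Type) mu (f : X -> fdist R Y) :
  nneg mu -> allp (fun x => nneg (f x)) mu -> nneg (bind mu f).
Proof.
elim: mu => //= u mu IH /andP[u0 /IH{}IH] [fu /IH{}IH].
rewrite bind_cons /nneg all_cat; apply/andP; split=> //.
rewrite all_map; apply: sub_all fu => v /= v0; exact: mulr_ge0.
Qed.

Lemma expect_le (X : Type) (mu : fdist R X) (f g : X -> R) : nneg mu ->
  allp (fun x => f x <= g x) mu -> expect mu f <= expect mu g.
Proof.
elim: mu => [|u mu IH]; first by rewrite !expect_nil.
move=> /andP[u0 /IH{}IH] [fg /IH le]; rewrite !expect_cons lerD //.
exact: ler_wpM2l.
Qed.

End Supp.

Section Logic.
Variables (R : realType) (nS nA : nat).
Variable O : seq (loss R nS nA) -> {ffun 'I_nS -> 'I_nA}.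
Variable N : nat.

Local Notation mem := (Defs.mem R).
Implicit Types (m : mem) (c : cmd).

Definition frame c m m' : Prop :=
  (forall x, x \notin wn c -> nmem m' x = nmem m x) /\
  (forall x, x \notin wr c -> rmem m' x = rmem m x).

Lemma frame_refl c m : frame c m m. Proof. by []. Qed.

Lemma frame_trans c1 c2 c m1 m2 m3 :
  {subset wn c1 <= wn c} -> {subset wn c2 <= wn c} ->
  {subset wr c1 <= wr c} -> {subset wr c2 <= wr c} ->
  frame c1 m1 m2 -> frame c2 m2 m3 -> frame c m1 m3.
Proof.
move=> n1 n2 r1 r2 [fn1 fr1] [fn2 fr2]; split=> x xc.
  by rewrite fn2 ?fn1 //; apply: contra xc; [apply: n1 | apply: n2].
by rewrite fr2 ?fr1 //; apply: contra xc; [apply: r1 | apply: r2].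
Qed.

Lemma frame_weaken c1 c m1 m2 :
  {subset wn c1 <= wn c} -> {subset wr c1 <= wr c} ->
  frame c1 m1 m2 -> frame c m1 m2.
Proof.
by move=> n1 r1 f1; apply: (frame_trans n1 n1 r1 r1 f1); apply: frame_refl.
Qed.

(** [K] is the rest of the stack and [j] an amount of fuel beyond which its outcome no longer
    changes. Quantifying over continuations makes sequencing a composition of [bind]s. *)
Definition evk k c m (mu : fdist R mem) : Prop :=
  forall K f j, allp (fun m' => forall n, (j <= n)%N -> run O n K m' = f m') mu ->
  forall n, (k + j <= n)%N -> run O n (c :: K) m = bind mu f.

Definition hupk k c m (Q : mem -> Prop) (F : mem -> R) (v : R) : Prop :=
  exists mu, [/\ evk k c m mu, nneg mu, allp (fun m' => frame c m m' /\ Q m') mu &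
    expect mu F <= v].

(* From m, the command c terminates within its cost in memories satisfying Q,
   and the expectation of F over them is at most v. *)
Definition hup c := hupk (cost N c) c.

Definition trk k c m (Q : mem -> Prop) : Prop :=
  exists m', [/\ evk k c m (ret R m'), frame c m m' & Q m'].

(* From m, the command c deterministically terminates within its cost in a memory
   satisfying Q. *)
Definition tr c := trk (cost N c) c.

Lemma hupk_trk k c m (Q : mem -> Prop) F v :
  trk k c m (fun m' => Q m' /\ F m' <= v) -> hupk k c m Q F v.
Proof.
move=> [m' [e f [Qm Fm]]]; exists (ret R m'); split=> //; last by rewrite expect_ret.
by rewrite /nneg /= ler01.
Qed.

Lemma trk_mono k c m (Q Q' : mem -> Prop) :
  trk k c m Q -> (forall m', frame c m m' -> Q m' -> Q' m') -> trk k c m Q'.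
Proof. by move=> [m' [e f Qm]] QQ; exists m'; split=> //; apply: QQ. Qed.

Lemma hupk_mono k c m (Q Q' : mem -> Prop) F F' v v' : hupk k c m Q F v ->
  (forall m', frame c m m' -> Q m' -> Q' m' /\ F' m' <= F m') -> v <= v' ->
  hupk k c m Q' F' v'.
Proof.
move=> [mu [e p a le]] QQ vv; exists mu; split=> //.
  by apply: allp_impl a => m' [f /(QQ _ f)[]].
apply: le_trans (le_trans le vv); apply: expect_le => //.
by apply: allp_impl a => m' [f /(QQ _ f)[]].
Qed.

Lemma ev_step c m m' :
  (forall n K, run O n.+1 (c :: K) m = run O n K m') -> evk 1 c m (ret R m').
Proof.
move=> e K f j /= [ef _] [|n]; rewrite ?add1n // ltnS => le.
by rewrite bind_ret -[RHS](ef n).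
Qed.

Lemma tr_skip m (Q : mem -> Prop) : Q m -> tr Skip m Q.
Proof. by move=> Qm; exists m; split=> //; apply: ev_step. Qed.

Lemma tr_nset x i e m (Q : mem -> Prop) :
  Q (nset m x (map (neval m) i) (neval m e)) -> tr (NSet x i e) m Q.
Proof.
move=> Qm; exists (nset m x (map (neval m) i) (neval m e)); split=> //; first exact: ev_step.
split=> //= y; rewrite inE => /negbTE yx; apply/funext => j.
by rewrite yx.
Qed.

Lemma tr_rset x i e m (Q : mem -> Prop) :
  Q (rset m x (map (neval m) i) (reval m e)) -> tr (RSet x i e) m Q.
Proof.
move=> Qm; exists (rset m x (map (neval m) i) (reval m e)); split=> //; first exact: ev_step.
split=> //= y; rewrite inE => /negbTE yx; apply/funext => j.
by rewrite yx.
Qed.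

Lemma write_policyE m y (f : {ffun 'I_nS -> 'I_nA}) (s : 'I_nS) :
  nmem (write_policy m y f) y [:: val s] = f s.
Proof.
rewrite /write_policy; have : s \in enum 'I_nS by rewrite mem_enum.
have gen e m' : s \notin e ->
    nmem (foldl (fun m' s => nset m' y [:: val s] (val (f s))) m' e) y [:: val s] = nmem m' y [:: val s].
  elim: e m' => //= s' e IH m'; rewrite inE negb_or => /andP[ss' se].
  rewrite IH //= eqxx /= eqseq_cons andbT.
  by case: eqP => // /val_inj e'; rewrite e' eqxx in ss'.
elim: (enum 'I_nS) m => //= s' e IH m; rewrite inE.
have [se _|se] := boolP (s \in e); first exact: IH.
by rewrite orbF => /eqP <-; rewrite gen //= !eqxx.
Qed.

Lemma rmem_write_policy m y (f : {ffun 'I_nS -> 'I_nA}) :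
  rmem (write_policy m y f) = rmem m.
Proof. by rewrite /write_policy; elim: (enum 'I_nS) m => //= s e IH m; rewrite IH. Qed.

Lemma nmem_write_policy_neq m y (f : {ffun 'I_nS -> 'I_nA}) x : x != y ->
  nmem (write_policy m y f) x = nmem m x.
Proof.
move=> xy; rewrite /write_policy; elim: (enum 'I_nS) m => //= s e IH m.
by rewrite IH; apply/funext => j /=; rewrite (negbTE xy).
Qed.

Lemma tr_query q e y m (Q : mem -> Prop) :
  Q (write_policy m y (O [seq read_loss nS nA m q t | t <- iota 0 (neval m e)])) ->
  tr (Query q e y) m Q.
Proof.
move=> Qm; eexists; split; [exact: ev_step| |exact: Qm].
split=> [x|x _]; last by rewrite rmem_write_policy.
by rewrite inE; apply: nmem_write_policy_neq.
Qed.

Lemma evk_seq c1 c2 k1 k2 m mu1 nu : evk k1 c1 m mu1 ->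
  allp (fun m1 => evk k2 c2 m1 (nu m1)) mu1 ->
  evk (1 + (k1 + k2)) (Seq c1 c2) m (bind mu1 nu).
Proof.
move=> e1 e2 K f j a [|n]; first by rewrite !addSn.
rewrite !addSn ltnS => le; rewrite bindA.
apply: (e1 (c2 :: K) (fun m1 => bind (nu m1) f) (k2 + j)%N) => /=; last by rewrite addnA.
apply: allp_impl (allp_and e2 (proj1 (allp_bind _ _ _) a)) => m1 [e21 a1] n' le'.
exact: e21 a1 _ le'.
Qed.

Lemma trk_seq k1 k2 c1 c2 m (Q1 Q : mem -> Prop) :
  trk k1 c1 m Q1 -> (forall m1, frame c1 m m1 -> Q1 m1 -> trk k2 c2 m1 Q) ->
  trk (1 + (k1 + k2)) (Seq c1 c2) m Q.
Proof.
move=> [m1 [e1 f1 Qm1]] /(_ m1 f1 Qm1)[m2 [e2 f2 Qm2]]; exists m2; split=> //.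
  have := evk_seq (nu := fun _ => ret R m2) e1 (conj e2 I).
  by rewrite bind_ret.
by apply: (frame_trans _ _ _ _ f1 f2) => x; rewrite mem_cat => ->; rewrite ?orbT.
Qed.

Lemma tr_seq c1 c2 m (Q1 Q : mem -> Prop) :
  tr c1 m Q1 -> (forall m1, frame c1 m m1 -> Q1 m1 -> tr c2 m1 Q) ->
  tr (Seq c1 c2) m Q.
Proof. exact: trk_seq. Qed.

Lemma hupk_seq k1 k2 c1 c2 m (Q1 Q : mem -> Prop) F1 F v :
  hupk k1 c1 m Q1 F1 v ->
  (forall m1, frame c1 m m1 -> Q1 m1 -> hupk k2 c2 m1 Q F (F1 m1)) ->
  hupk (1 + (k1 + k2)) (Seq c1 c2) m Q F v.
Proof.
move=> [mu1 [e1 p1 a1 le1]] h2.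
(* The outcome list of [c2] depends on the intermediate memory; choice gathers these lists into one
   function. *)
have /boolp.choice[nu nuP] : forall m1, exists mu2, frame c1 m m1 /\ Q1 m1 ->
   [/\ evk k2 c2 m1 mu2, nneg mu2,
     allp (fun m' => frame c2 m1 m' /\ Q m') mu2 & expect mu2 F <= F1 m1].
  move=> m1; have [[f1 q1]|nq] := pselect (frame c1 m m1 /\ Q1 m1); last by exists [::].
  by have [mu2 h] := h2 m1 f1 q1; exists mu2.
exists (bind mu1 nu); split.
- by apply: evk_seq => //; apply: allp_impl a1 => m1 /nuP[].
- by apply: nneg_bind => //; apply: allp_impl a1 => m1 /nuP[].
- apply/allp_bind; apply: allp_impl a1 => m1 a1; have [_ _ + _] := nuP m1 a1.
  apply: allp_impl => m2 [f2 q2]; split=> //.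
  by apply: (frame_trans _ _ _ _ (proj1 a1) f2) => x; rewrite mem_cat => ->; rewrite ?orbT.
rewrite expect_bind; apply: le_trans le1; apply: expect_le => //.
by apply: allp_impl a1 => m1 /nuP[].
Qed.

Lemma hup_seq c1 c2 m (Q1 Q : mem -> Prop) F1 F v :
  hup c1 m Q1 F1 v ->
  (forall m1, frame c1 m m1 -> Q1 m1 -> hup c2 m1 Q F (F1 m1)) ->
  hup (Seq c1 c2) m Q F v.
Proof. exact: hupk_seq. Qed.

Lemma evk_leq k k' c m mu : (k <= k')%N -> evk k c m mu -> evk k' c m mu.
Proof.
move=> le e K f j a n le'; apply: (e K f j a n); apply: leq_trans le'.
by rewrite leq_add2r.
Qed.

Lemma evk_if b c1 c2 k m mu : evk k (if beval m b then c1 else c2) m mu ->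
  evk (1 + k) (If b c1 c2) m mu.
Proof.
by move=> e K f j a [|n]; rewrite !addSn // ltnS => le /=; apply: (e K f j a n le).
Qed.

Let if_frame b c1 c2 b' m m' : frame (if b' then c1 else c2) m m' ->
  frame (If b c1 c2) m m'.
Proof.
by case: b' => /frame_weaken; apply=> x xc /=; rewrite mem_cat xc ?orbT.
Qed.

Lemma tr_if b c1 c2 m (Q : mem -> Prop) :
  tr (if beval m b then c1 else c2) m Q -> tr (If b c1 c2) m Q.
Proof.
move=> [m' [e f Qm]]; exists m'; split=> //; last exact: if_frame f.
apply: evk_leq (evk_if e); rewrite add1n ltnS; case: ifP => _.
  exact: leq_addr.
exact: leq_addl.
Qed.

Lemma hup_if b c1 c2 m (Q : mem -> Prop) F v :
  hup (if beval m b then c1 else c2) m Q F v -> hup (If b c1 c2) m Q F v.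
Proof.
move=> [mu [e p a le]]; exists mu; split=> //.
  apply: evk_leq (evk_if e); rewrite add1n ltnS; case: ifP => _.
    exact: leq_addr.
  exact: leq_addl.
by apply: allp_impl a => m' [f Qm]; split=> //; apply: if_frame f.
Qed.

Lemma hup_flip x i e m (Q : mem -> Prop) F v :
  let p := clip (reval m e) in
  let m1 := nset m x (map (neval m) i) 1 in
  let m0 := nset m x (map (neval m) i) 0 in
  Q m1 -> Q m0 -> p * F m1 + (1 - p) * F m0 <= v ->
  hup (Flip x i e) m Q F v.
Proof.
move=> p m1 m0 Q1 Q0 le; exists [:: (p, m1); (1 - p, m0)].
have /andP[p0 p1] := clip01 (reval m e).
have fr v' : frame (Flip x i e) m (nset m x (map (neval m) i) v').
  split=> //= y; rewrite inE => /negbTE yx; apply/funext => j.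
  by rewrite yx.
split.
- move=> K f j /= [h1 [h0 _]] [|n] //; rewrite !addSn ltnS => le'.
  rewrite /= !bind_cons /= -/m1 -/m0 -/p.
  by rewrite h1 // h0.
- by rewrite /nneg /= p0 subr_ge0 p1.
- by split; [split=> //; apply: fr | split=> //; split=> //; apply: fr].
by rewrite !expect_cons expect_nil addr0.
Qed.

Definition For x b c :=
  Seq (NSet x [::] (NConst 0))
      (While (BNot (BLeN (NGet b [::]) (NGet x [::])))
             (Seq c (NSet x [::] (NAdd (NGet x [::]) (NConst 1))))).

Let evk_while_stop b c m : ~~ beval m b -> evk 1 (While b c) m (ret R m).
Proof. by move=> nb; apply: ev_step => n K /=; rewrite (negbTE nb). Qed.

Let evk_while_step b c k k' m mu nu : beval m b -> evk k c m mu ->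
  allp (fun m1 => evk k' (While b c) m1 (nu m1)) mu ->
  evk (1 + (k + k')) (While b c) m (bind mu nu).
Proof.
move=> hb e1 e2 K f j a [|n]; first by rewrite !addSn.
have := evk_seq e1 e2 (f := f) (j := j) (K := K) a (n := n.+1).
by rewrite !addSn /= hb.
Qed.

Section ForRule.
Variables (x b : nat) (c : cmd) (m0 : mem) (n : nat).
Hypotheses (xb : x != b) (bc : b \notin wn c) (xc : x \notin wn c).
Hypotheses (bn : nmem m0 b [::] = n) (nN : (n <= N)%N).
Variables (I : nat -> mem -> Prop) (F : nat -> mem -> R).

Let body := Seq c (NSet x [::] (NAdd (NGet x [::]) (NConst 1))).
Let test := BNot (BLeN (NGet b [::]) (NGet x [::])).

Let test_frame m : frame (For x b c) m0 m -> nmem m b [::] = n.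
Proof.
by case=> -> //=; rewrite !(inE, mem_cat) eq_sym (negbTE xb) (negbTE bc).
Qed.

Let beval_test m i : frame (For x b c) m0 m -> nmem m x [::] = i ->
  beval m test = (i < n)%N.
Proof. by move=> f xi /=; rewrite (test_frame f) xi ltnNge. Qed.

Hypothesis Ix : forall i m v, I i m -> I i (nset m x [::] v).

Let body_sub_n : {subset wn body <= wn (For x b c)}.
Proof. by move=> y /=; rewrite inE => ->; rewrite orbT. Qed.
Let body_sub_r : {subset wr body <= wr (For x b c)}.
Proof. by []. Qed.
Let for_sub_n : {subset wn (For x b c) <= wn (For x b c)}. Proof. by []. Qed.
Let for_sub_r : {subset wr (For x b c) <= wr (For x b c)}. Proof. by []. Qed.
Let init_frame : frame (For x b c) m0 (nset m0 x [::] 0).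
Proof.
split=> //= y; rewrite inE negb_or => /andP[/negbTE yx _].
by apply/funext => j; rewrite yx.
Qed.

Lemma tr_for : I 0 m0 ->
  (forall i m, (i < n)%N -> frame (For x b c) m0 m -> nmem m x [::] = i ->
     I i m -> tr c m (I i.+1)) ->
  tr (For x b c) m0 (I n).
Proof.
move=> I0 step.
have loop d i m : (d + i = n)%N -> frame (For x b c) m0 m -> nmem m x [::] = i -> I i m ->
    exists m', [/\ evk (d * (1 + cost N body) + 1) (While test body) m (ret R m'),
      frame (For x b c) m0 m' & I n m'].
  elim: d i m => [|d IH] i m di fm xi Im.
    exists m; split=> //; last by rewrite -di.
    by apply: evk_while_stop; rewrite (beval_test fm xi) -di ltnn.
  have lt_i : (i < n)%N by rewrite -di addSn ltnS leq_addl.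
  have [m1 [e1 f1 I1]] : tr body m (fun m1 => I i.+1 m1 /\ nmem m1 x [::] = i.+1).
    apply: (tr_seq (step i m lt_i fm xi Im)) => m1 [fn _] Im1; apply: tr_nset.
    split; first exact: Ix.
    by rewrite /= !eqxx /= fn // xi addn1.
  have fm1 := frame_trans for_sub_n body_sub_n for_sub_r body_sub_r fm f1.
  have [m2 [e2 f2 I2]] := IH i.+1 m1 (etrans (addnS d i) di) fm1 I1.2 I1.1.
  exists m2; split=> //.
  have := evk_while_step (nu := fun _ => ret R m2) _ e1 (conj e2 Logic.I).
  rewrite bind_ret mulSn -!addnA; apply.
  by rewrite (beval_test fm xi).
have [|m2 [e2 f2 I2]] := loop n 0%N (nset m0 x [::] 0) (addn0 n) init_frame _ (Ix _ I0).
  by rewrite /= !eqxx.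
exists m2; split=> //.
have [m1 [e1 f1 m1E]] : trk 1 (NSet x [::] (NConst 0)) m0 (eq^~ (nset m0 x [::] 0)).
  exact: (@tr_nset x [::] (NConst 0)).
rewrite m1E in e1.
have := evk_seq (nu := fun _ => ret R m2) e1 (conj e2 Logic.I).
rewrite bind_ret; apply: evk_leq.
by rewrite !leq_add2l leq_add2r leq_mul2r nN orbT.
Qed.

Hypothesis Fx : forall i m v, F i (nset m x [::] v) = F i m.

(** [F] is a supermartingale along the loop: an iteration does not raise its expectation. The
    counter must be invisible to it. *)
Lemma hup_for : I 0 m0 ->
  (forall i m, (i < n)%N -> frame (For x b c) m0 m -> nmem m x [::] = i ->
     I i m -> hup c m (I i.+1) (F i.+1) (F i m)) ->
  hup (For x b c) m0 (I n) (F n) (F 0 m0).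
Proof.
move=> I0 step.
have loop d i m : (d + i = n)%N -> frame (For x b c) m0 m -> nmem m x [::] = i -> I i m ->
    exists mu, [/\ evk (d * (1 + cost N body) + 1) (While test body) m mu, nneg mu,
      allp (fun m' => frame (For x b c) m0 m' /\ I n m') mu & expect mu (F n) <= F i m].
  elim: d i m => [|d IH] i m di fm xi Im.
    rewrite add0n in di; exists (ret R m); split=> //.
    - by apply: evk_while_stop; rewrite (beval_test fm xi) di ltnn.
    - by rewrite /nneg /= ler01.
    - by rewrite -di.
    by rewrite expect_ret -di.
  have lt_i : (i < n)%N by rewrite -di addSn ltnS leq_addl.
  have [mu1 [e1 p1 a1 le1]] : hup body m (fun m1 => I i.+1 m1 /\ nmem m1 x [::] = i.+1) (F i.+1) (F i m).
    apply: (hup_seq (step i m lt_i fm xi Im)) => m1 [fn _] Im1.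
    apply: hupk_trk; apply: tr_nset; split; last by rewrite Fx.
    by split; [apply: Ix | rewrite /= !eqxx /= fn // xi addn1].
  have /boolp.choice[nu nuP] : forall m1, exists mu,
    frame body m m1 /\ I i.+1 m1 /\ nmem m1 x [::] = i.+1 ->
    [/\ evk (d * (1 + cost N body) + 1) (While test body) m1 mu, nneg mu,
      allp (fun m' => frame (For x b c) m0 m' /\ I n m') mu & expect mu (F n) <= F i.+1 m1].
    move=> m1.
    have [[f1 [I1 x1]]|nq] := pselect (frame body m m1 /\ I i.+1 m1 /\ nmem m1 x [::] = i.+1); last by exists [::].
    have fm1 := frame_trans for_sub_n body_sub_n for_sub_r body_sub_r fm f1.
    by have [mu h] := IH i.+1 m1 (etrans (addnS d i) di) fm1 x1 I1; exists mu.
  exists (bind mu1 nu); split.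
  - have -> : (d.+1 * (1 + cost N body) + 1 =
        1 + (cost N body + (d * (1 + cost N body) + 1)))%N by rewrite mulSn -!addnA.
    apply: (evk_while_step _ e1); first by rewrite (beval_test fm xi).
    by apply: allp_impl a1 => m1 /nuP[].
  - by apply: nneg_bind => //; apply: allp_impl a1 => m1 /nuP[].
  - by apply/allp_bind; apply: allp_impl a1 => m1 /nuP[].
  rewrite expect_bind; apply: le_trans le1; apply: expect_le => //.
  by apply: allp_impl a1 => m1 /nuP[].
have [|mu [e2 p2 a2 le2]] := loop n 0%N (nset m0 x [::] 0) (addn0 n) init_frame _ (Ix _ I0).
  by rewrite /= !eqxx.
exists mu; split=> //; last by rewrite Fx in le2.
have [m1 [e1 f1 m1E]] : trk 1 (NSet x [::] (NConst 0)) m0 (eq^~ (nset m0 x [::] 0)).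
  exact: (@tr_nset x [::] (NConst 0)).
rewrite m1E in e1.
have := evk_seq (nu := fun _ => mu) e1 (conj e2 Logic.I).
rewrite bind_ret; apply: evk_leq.
by rewrite !leq_add2l leq_add2r leq_mul2r nN orbT.
Qed.

End ForRule.

Lemma hup_run c m (Q : mem -> Prop) F v n : hup c m Q F v -> (cost N c <= n)%N ->
  exists mu, [/\ run O n [:: c] m = bind mu (fun m' => ret R (Some m')), nneg mu,
    allp Q mu & expect mu F <= v].
Proof.
move=> [mu [e p a le]] cn; exists mu; split=> //.
  apply: (e [::] _ 0%N); last by rewrite addn0.
  by elim: mu {e p le} a => //= u mu IH [_ /IH]; split=> // -[].
by apply: allp_impl a => m' [].
Qed.

End Logic.

Lemma nmem_nset_neq (R : realType) (m : Defs.mem R) x i v y :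
  y != x -> nmem (nset m x i v) y = nmem m y.
Proof. by move=> /negbTE yx; apply/funext => j; rewrite /nset /nmem yx. Qed.

(** * Derived rules for sums, tables and nested loops *)

Section Macros.
Variables (R : realType) (nS nA : nat).
Variable O : seq (loss R nS nA) -> {ffun 'I_nS -> 'I_nA}.
Variable N : nat.
Local Notation mem := (Defs.mem R).
Local Notation tr := (tr O N).
Local Notation hup := (hup O N).

Lemma tr_mono c (m : mem) (Q Q' : mem -> Prop) :
  tr c m Q -> (forall m', frame c m m' -> Q m' -> Q' m') -> tr c m Q'.
Proof. exact: trk_mono. Qed.

Lemma hup_mono c (m : mem) (Q Q' : mem -> Prop) F F' v v' : hup c m Q F v ->
  (forall m', frame c m m' -> Q m' -> Q' m' /\ F' m' <= F m') -> v <= v' ->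
  hup c m Q' F' v'.
Proof. exact: hupk_mono. Qed.

Lemma hup_tr c (m : mem) (Q : mem -> Prop) F v :
  tr c m (fun m' => Q m' /\ F m' <= v) -> hup c m Q F v.
Proof. exact: hupk_trk. Qed.

Lemma tr_sum x b a ix e (m : mem) n j (g : 'I_n -> R) :
  let c := For x b (RSet a ix (RAdd (RGet a ix) e)) in
  x != b -> nmem m b [::] = n -> (n <= N)%N ->
  (forall m1, frame c m m1 -> map (neval m1) ix = j) ->
  (forall m1 (i : 'I_n), frame c m m1 -> nmem m1 x [::] = i ->
     (forall j', j' != j -> rmem m1 a j' = rmem m a j') -> reval m1 e = g i) ->
  tr c m (fun m' => rmem m' a j = rmem m a j + \sum_i g i /\
                    forall j', j' != j -> rmem m' a j' = rmem m a j').
Proof.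
move=> c xb bn nN jx ex.
pose I k m' := rmem m' a j = rmem m a j + \sum_(0 <= i < k) load g i /\
                    forall j', j' != j -> rmem m' a j' = rmem m a j'.
apply: (@tr_mono _ _ (I n)).
  apply: (tr_for xb _ _ bn nN) => //=; first by split; rewrite ?big_geq ?addr0.
  move=> i m1 lt_i f xi [s o]; apply: tr_rset; rewrite (jx m1 f); split=> /=; last first.
    by move=> j' jj; rewrite (negbTE jj) andbF o.
  rewrite !eqxx /= (jx m1 f) s (ex m1 (Ordinal lt_i) f xi o) big_nat_recr //=.
  by rewrite addrA (load_nat g lt_i).
move=> m' _ [-> o]; split=> //; rewrite big_mkord; congr (_ + _).
by apply: eq_bigr => i _; rewrite load_ord.
Qed.

Lemma tr_fill x b a ix e (m : mem) n (J : 'I_n -> seq nat) (g : 'I_n -> R) :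
  let c := For x b (RSet a ix e) in
  x != b -> nmem m b [::] = n -> (n <= N)%N -> injective J ->
  (forall m1 (i : 'I_n), frame c m m1 -> nmem m1 x [::] = i ->
     map (neval m1) ix = J i) ->
  (forall m1 (i : 'I_n), frame c m m1 -> nmem m1 x [::] = i ->
     (forall j, (forall i', j != J i') -> rmem m1 a j = rmem m a j) ->
     reval m1 e = g i) ->
  tr c m (fun m' => (forall i, rmem m' a (J i) = g i) /\
             forall j, (forall i, j != J i) -> rmem m' a j = rmem m a j).
Proof.
move=> c xb bn nN Jinj jx ex.
pose I k m' := (forall i : 'I_n, (i < k)%N -> rmem m' a (J i) = g i) /\
             forall j, (forall i, j != J i) -> rmem m' a j = rmem m a j.
apply: (@tr_mono _ _ (I n)).
  apply: (tr_for xb _ _ bn nN) => //= i m1 lt_i f xi [s o].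
  have jxi := jx m1 (Ordinal lt_i) f xi.
  apply: tr_rset; rewrite jxi; split=> /= [i' lt_i'|j nj]; last first.
    by rewrite (negbTE (nj _)) andbF o.
  rewrite eqxx /=; case: eqP => [/Jinj ->|ne].
    exact: (ex m1 (Ordinal lt_i) f xi o).
  apply: s; rewrite ltn_neqAle -ltnS lt_i' andbT.
  by apply/eqP => e'; apply: ne; congr J; apply: val_inj.
by move=> m' _ [s o]; split=> // i; apply: s.
Qed.

Lemma tr_fill2 x b x' b' a ix e (m : mem) n n' (J : 'I_n -> 'I_n' -> seq nat)
    (g : 'I_n -> 'I_n' -> R) :
  let c := For x b (For x' b' (RSet a ix e)) in
  x != b -> x' != b' -> x != b' -> x' != b -> x' != x ->
  nmem m b [::] = n -> (n <= N)%N -> nmem m b' [::] = n' -> (n' <= N)%N ->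
  (forall i i' k k', J i i' = J k k' -> i = k /\ i' = k') ->
  (forall m1 (i : 'I_n) (i' : 'I_n'), frame c m m1 -> nmem m1 x [::] = i ->
     nmem m1 x' [::] = i' -> map (neval m1) ix = J i i') ->
  (forall m1 (i : 'I_n) (i' : 'I_n'), frame c m m1 -> nmem m1 x [::] = i ->
     nmem m1 x' [::] = i' ->
     (forall j, (forall k k', j != J k k') -> rmem m1 a j = rmem m a j) ->
     reval m1 e = g i i') ->
  tr c m (fun m' => (forall i i', rmem m' a (J i i') = g i i') /\
             forall j, (forall i i', j != J i i') -> rmem m' a j = rmem m a j).
Proof.
move=> c xb xb' xb'' x'b x'x bn nN bn' nN' Jinj jx ex.
pose I k m' := (forall (i : 'I_n) i', (i < k)%N -> rmem m' a (J i i') = g i i') /\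
             forall j, (forall i i', j != J i i') -> rmem m' a j = rmem m a j.
have sub1 m1 m2 : frame c m m1 -> frame (For x' b' (RSet a ix e)) m1 m2 -> frame c m m2.
  move=> f1 f2; apply: (frame_trans _ _ _ _ f1 f2) => // y; rewrite /= !inE.
  by case/orP => ->; rewrite ?orbT.
apply: (@tr_mono _ _ (I n)).
  apply: (tr_for xb _ _ bn nN) => //=.
  - by rewrite !inE !(eq_sym b) (negbTE x'b).
  - by rewrite !inE !(eq_sym x) (negbTE x'x).
  move=> i m1 lt_i f xi [s o].
  have b'1 : nmem m1 b' [::] = n'.
    case: f => -> //; rewrite /= !inE !(eq_sym b') (negbTE xb') (negbTE xb'') //.
  apply: tr_mono.
    apply: (tr_fill (n := n') (J := J (Ordinal lt_i)) (g := g (Ordinal lt_i)) xb' b'1 nN').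
    - by move=> k k' /Jinj[].
    - move=> m2 i' f2 xi'; apply: jx => //; first exact: sub1 f2.
      by case: f2 => -> //; rewrite /= !inE !(eq_sym x) (negbTE x'x).
    move=> m2 i' f2 xi' o2; apply: ex => //; first exact: sub1 f2.
      by case: f2 => -> //; rewrite /= !inE !(eq_sym x) (negbTE x'x).
    by move=> j nj; rewrite o2 // o.
  move=> m2 _ [s2 o2]; split=> [k i' lt_k|j nj]; last by rewrite o2 // o.
  have [e'|ne] := eqVneq (k : nat) i.
    have -> : k = Ordinal lt_i by apply: val_inj.
    exact: s2.
  rewrite o2 => [|i'']; last first.
    by apply: contraNneq ne => /Jinj[-> _].
  by apply: s; rewrite ltn_neqAle ne -ltnS.
by move=> m' _ [s o]; split=> // i i'; apply: s.
Qed.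

Lemma hup_nest x b c d (G : mem -> Prop) (F : nat -> mem -> R) n M :
  x != b -> b \notin wn c -> x \notin wn c ->
  (forall m, G m -> nmem m b [::] = n) -> (n <= N)%N ->
  (forall m v, G m -> G (nset m x [::] v)) ->
  (forall k m v, F k (nset m x [::] v) = F k m) ->
  (forall k m, (k + d <= M)%N -> G m -> hup c m G (F (k + d)%N) (F k m)) ->
  forall k m, (k + n * d <= M)%N -> G m -> hup (For x b c) m G (F (k + n * d)%N) (F k m).
Proof.
move=> xb bc xc Gb nN Gx Fx hc k m kM Gm.
have := @hup_for _ _ _ O N x b c m n xb bc xc (Gb m Gm) nN (fun _ => G) (fun i => F (k + i * d)%N).
rewrite /= addn0; apply; [by move=> i; apply: Gx | by move=> *; apply: Fx | exact: Gm|].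
move=> i m1 lt_i f xi Gm1; rewrite mulSn [(d + _)%N]addnC addnA; apply: hc => //.
by apply: leq_trans kM; rewrite -addnA leq_add2l addnC -mulSn leq_mul2r lt_i orbT.
Qed.

Lemma tr_nest x b c d (G : mem -> Prop) (I : nat -> mem -> Prop) n :
  x != b -> b \notin wn c -> x \notin wn c ->
  (forall m, G m -> nmem m b [::] = n) -> (n <= N)%N ->
  (forall m v, G m -> G (nset m x [::] v)) ->
  (forall k m v, I k m -> I k (nset m x [::] v)) ->
  (forall k m, G m -> I k m -> tr c m (fun m' => G m' /\ I (k + d)%N m')) ->
  forall k m, G m -> I k m -> tr (For x b c) m (fun m' => G m' /\ I (k + n * d)%N m').
Proof.
move=> xb bc xc Gb nN Gx Ix hc k m Gm Im.
have := @tr_for _ _ _ O N x b c m n xb bc xc (Gb m Gm) nN (fun i m' => G m' /\ I (k + i * d)%N m').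
rewrite /= addn0; apply; [|by []|].
  by move=> i m' v [Gm' Im']; split; [apply: Gx | apply: Ix].
move=> i m1 lt_i f xi [Gm1 Im1]; rewrite mulSn [(d + _)%N]addnC addnA; exact: hc.
Qed.

End Macros.

(** * The algorithm *)

Definition RSub e1 e2 := RAdd e1 (ROpp e2).
Definition RDiv e1 e2 := RMul e1 (RInv e2).
Definition BEqN e1 e2 := BAnd (BLeN e1 e2) (BLeN e2 e1).

Local Notation nv x := (NGet x [::]).
Local Notation rv x := (RGet x [::]).
Local Notation rn k := (RNat (NConst k)).
Local Notation rnv x := (RNat (NGet x [::])).
Local Notation nset0 x e := (NSet x [::] e).
Local Notation rset0 x e := (RSet x [::] e).

Local Notation xS := n_states.
Local Notation xA := n_actions.
Local Notation xT := horizon.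
Local Notation xs := 6%N.
Local Notation xa := 7%N.
Local Notation xt := 8%N.
Local Notation xz := 9%N.
Local Notation xy := 10%N.
Local Notation x1 := 11%N.
Local Notation x2 := 12%N.
Local Notation x3 := 13%N.
Local Notation x4 := 14%N.
Local Notation x5 := 15%N.
Local Notation aG := 16%N.     (* noise counts *)
Local Notation vflip := 17%N.
Local Notation vstop := 18%N.
Local Notation vscale := 19%N. (* the noise scale is vscale + 2 *)
Local Notation acur := 20%N.   (* current policy *)
Local Notation anew := 21%N.   (* perturbed leader *)
Local Notation vunc := 22%N.   (* 0 iff coupled with the current policy *)
Local Notation vph := 23%N.    (* rounds left in the current chase *)
Local Notation vtgt := 24%N.   (* chased state *)
Local Notation abest := 25%N.  (* best policy so far *)
Local Notation vH := 26%N.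
Local Notation vcnt := 27%N.
Local Notation vtau := 28%N.
Local Notation vlg := 29%N.
Local Notation aact := 30%N.
Local Notation vfound := 31%N.
Local Notation rq := 3%N.
Local Notation rvec := 4%N.
Local Notation rnew := 5%N.
Local Notation rL := 6%N.
Local Notation rV := 7%N.
Local Notation rsum := 8%N.
Local Notation rpw := 9%N.
Local Notation rZ := 10%N.
Local Notation rworst := 11%N.
Local Notation rtheta := 12%N.
Local Notation racc := 13%N.
Local Notation rrem := 14%N.

(** The surrounding loops run a fixed number of times; after the first failed toss, [vstop] turns
    the remaining ones into no-ops. *)
Definition toss_cmd :=
  If (BLeN (nv vstop) (NConst 0))
    (Seq (Flip vflip [::] (RSub (rn 1) (RInv (RMul (rnv xS) (rnv xT)))))
         (If (BLeN (NConst 1) (nv vflip))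
             (NSet aG [:: nv xs; nv xa] (NAdd (NGet aG [:: nv xs; nv xa]) (NConst 1)))
             (nset0 vstop (NConst 1))))
    Skip.

(* Naturals cannot be multiplied: a loop over a product of sizes is a nest of
   loops over its factors, here nS T T nS nA. *)
Definition sample_cmd :=
  For xs xS (For xa xA
    (Seq (NSet aG [:: nv xs; nv xa] (NConst 0))
    (Seq (nset0 vstop (NConst 0))
      (For x1 xS (For x2 xT (For x3 xT (For x4 xS (For x5 xA toss_cmd)))))))).

Definition step_cmd pol :=
  Seq (For xs xS (rset0 rL (RAdd (rv rL)
        (RMul (RGet rvec [:: nv xs])
              (RGet past [:: nv vcnt; nv xs; NGet pol [:: nv xs]])))))
  (Seq (For xz xS (Seq (RSet rnew [:: nv xz] (rn 0))
        (For xs xS (RSet rnew [:: nv xz] (RAdd (RGet rnew [:: nv xz])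
          (RMul (RGet rvec [:: nv xs])
                (RGet trans [:: nv xs; NGet pol [:: nv xs]; nv xz])))))))
  (Seq (For xs xS (RSet rvec [:: nv xs] (RGet rnew [:: nv xs])))
       (nset0 vcnt (NAdd (nv vcnt) (NConst 1))))).

(** The target time may exceed the horizon, being [round + H] in a launch; the loop bound [nS * T]
    leaves room for it. *)
Definition forward_cmd pol :=
  Seq (rset0 rL (rn 0))
  (Seq (nset0 vcnt (NConst 0))
  (Seq (For xs xS (RSet rvec [:: nv xs] (RGet start [:: nv xs])))
       (For x1 xS (For x2 xT
          (If (BLeN (nv vtau) (nv vcnt)) Skip (step_cmd pol)))))).

(** Sampling with biased coins only: a state is accepted with its probability divided by the mass
    not yet rejected. *)
Definition draw_cmd :=
  Seq (rset0 rrem (rn 1))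
  (Seq (nset0 vtgt (NConst 0))
  (Seq (nset0 vfound (NConst 0))
       (For xs xS (If (BLeN (nv vfound) (NConst 0))
          (Seq (Flip vflip [::] (RDiv (RGet rvec [:: nv xs]) (rv rrem)))
               (If (BLeN (NConst 1) (nv vflip))
                   (Seq (nset0 vtgt (nv xs)) (nset0 vfound (NConst 1)))
                   (rset0 rrem (RSub (rv rrem) (RGet rvec [:: nv xs])))))
          Skip)))).

Definition log_cmd :=
  Seq (rset0 rpw (rn 1))
  (Seq (nset0 vlg (NConst 0))
       (For x1 xS (For x2 xA
          (If (BLeR (RMul (rnv xS) (rnv xA)) (rv rpw)) Skip
              (Seq (rset0 rpw (RAdd (rv rpw) (rv rpw)))
                   (nset0 vlg (NAdd (nv vlg) (NConst 1)))))))).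

Definition scale_cmd :=
  Seq log_cmd
  (Seq (Query past (nv xT) abest)
  (Seq (nset0 vtau (nv xT))
  (Seq (forward_cmd abest)
       (If (BLeR (rv rL)
             (RMul (RMul (RNat (NAdd (nv vscale) (NConst 2))) (RNat (NAdd (nv vscale) (NConst 2))))
                   (RMul (RMul (rnv xS) (rnv xS)) (rnv vlg))))
           Skip (nset0 vscale (NAdd (nv vscale) (NConst 1))))))).

Definition noise_exp :=
  RMul (RMul (RNat (NAdd (nv vscale) (NConst 2)))
             (RSub (RMul (RMul (rnv xS) (rnv xT)) (RMul (RMul (rnv xT) (rnv xS)) (rnv xA)))
                   (RNat (NGet aG [:: nv xs; nv xa]))))
       (RInv (RMul (rnv xT) (RGet start [:: nv xs]))).

(** The truncated subtraction of [xt] from 1 is the indicator of the first loss function. *)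
Definition leader_cmd :=
  Seq (rset0 rZ (rn 1))
  (Seq (For xs xS (For xa xA (rset0 rZ (RAdd (rv rZ) noise_exp))))
  (Seq (For xt xT (For xs xS (For xa xA
          (RSet rq [:: nv xt; nv xs; nv xa]
             (RDiv (RAdd (RGet past [:: nv xt; nv xs; nv xa])
                         (RMul (RNat (NSub (NConst 1) (nv xt))) noise_exp)) (rv rZ))))))
       (Query rq (nv xT) anew))).

(** Phase 0 with acceptance probability 0 presents a switch as a chase that is bound to fail now, so
    that the launch after a failure also serves switches. *)
Definition switch_cmd :=
  For xs xS (If (BEqN (NGet acur [:: nv xs]) (NGet anew [:: nv xs])) Skip
    (Seq (nset0 vunc (NConst 1))
    (Seq (nset0 vph (NConst 0))
    (Seq (rset0 racc (rn 0))
         (NSet acur [:: nv xs] (NGet anew [:: nv xs])))))).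

Definition best_cmd :=
  Seq (rset0 rsum (rn 0))
  (Seq (For xz xS (rset0 rsum (RAdd (rv rsum)
          (RMul (RGet trans [:: nv xs; nv xa; nv xz]) (RGet rV [:: nv xy; nv xt; nv xz])))))
       (If (BLeR (RGet rV [:: nv xy; NAdd (nv xt) (NConst 1); nv xs]) (rv rsum))
           (Seq (RSet rV [:: nv xy; NAdd (nv xt) (NConst 1); nv xs] (rv rsum))
                (NSet aact [:: nv xy; NAdd (nv xt) (NConst 1); nv xs] (nv xa)))
           Skip)).

(** In truncated arithmetic, [1 - ((s - y) + (y - s))] is the indicator of [s = y]. *)
Definition reach_cmd :=
  For xy xS
    (Seq (For xs xS (RSet rV [:: nv xy; NConst 0; nv xs]
            (RNat (NSub (NConst 1) (NAdd (NSub (nv xs) (nv xy)) (NSub (nv xy) (nv xs)))))))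
         (For xt xT (For xs xS
            (Seq (RSet rV [:: nv xy; NAdd (nv xt) (NConst 1); nv xs] (rn 0))
            (Seq (NSet aact [:: nv xy; NAdd (nv xt) (NConst 1); nv xs] (NConst 0))
                 (For xa xA best_cmd)))))).

Definition worst_cmd :=
  Seq (rset0 rworst (rn 1))
      (For xy xS (For xs xS
         (If (BLeR (RGet rV [:: nv xy; NAdd (nv xt) (NConst 1); nv xs]) (rv rworst))
             (rset0 rworst (RGet rV [:: nv xy; NAdd (nv xt) (NConst 1); nv xs])) Skip))).

Definition length_cmd :=
  Seq (rset0 rtheta (rn 0))
  (Seq (nset0 vH (NConst 1))
       (For xt xT (Seq worst_cmd
          (If (BLeR (RMul (rnv vH) (rv rworst))
                    (RMul (RNat (NAdd (nv xt) (NConst 1))) (rv rtheta)))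
              Skip
              (Seq (rset0 rtheta (rv rworst))
                   (nset0 vH (NAdd (nv xt) (NConst 1)))))))).

Definition accept_cmd :=
  If (BAnd (BLeN (NConst 1) (nv vunc)) (BLeN (nv vph) (NConst 0)))
     (Seq (If (BEqN (nv state) (nv vtgt)) (Flip vflip [::] (rv racc))
              (nset0 vflip (NConst 0)))
          (If (BLeN (NConst 1) (nv vflip)) (nset0 vunc (NConst 0)) Skip))
     Skip.

Definition launch_cmd :=
  If (BAnd (BLeN (NConst 1) (nv vunc)) (BLeN (nv vph) (NConst 0)))
     (Seq (nset0 vtau (NAdd (nv round) (nv vH)))
     (Seq (forward_cmd acur)
     (Seq draw_cmd
     (Seq (rset0 racc (RDiv (rv rtheta) (RGet rV [:: nv vtgt; nv vH; nv state])))
          (nset0 vph (nv vH))))))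
     Skip.

Definition act_cmd :=
  If (BLeN (NConst 1) (nv vunc))
     (Seq (nset0 action (NGet aact [:: nv vtgt; nv vph; nv state]))
          (nset0 vph (NSub (nv vph) (NConst 1))))
     (nset0 action (NGet acur [:: nv state])).

(** All tables are recomputed in every round, so only the counts, the scale, the current policy and
    the state of the chase have to be tracked between rounds. *)
Definition round_cmd :=
  Seq scale_cmd (Seq leader_cmd (Seq switch_cmd (Seq reach_cmd
  (Seq length_cmd (Seq accept_cmd (Seq launch_cmd act_cmd)))))).

Definition algorithm :=
  Seq (If (BLeN (nv round) (NConst 0)) sample_cmd Skip) round_cmd.

(** * Correctness of the algorithm *)

Ltac weaken_notin H :=
  apply: contra H; rewrite /= !inE; do ?[case/orP]; by move=> ->; rewrite ?orbT.

(** * State laws and losses of a policy, as computed by the program *)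

Section Blocks.
Variables (R : realType) (nS nA : nat) (P : 'I_nS -> 'I_nA -> 'I_nS -> R).
Hypothesis PD : forall s a, is_dist (P s a).
Variable d1 : 'I_nS -> R.
Hypothesis d1D : is_dist d1.
Variable O : seq (loss R nS nA) -> {ffun 'I_nS -> 'I_nA}.
Variable ls : seq (loss R nS nA).
Variable N : nat.
Let T := size ls.
Hypotheses (SN : (nS <= N)%N) (AN : (nA <= N)%N) (TN : (T <= N)%N).
Hypotheses (nS_gt1 : (1 < nS)%N) (nA_gt0 : (0 < nA)%N).

Local Notation mem := (Defs.mem R).
Local Notation tr := (tr O N).
Local Notation hup := (hup O N).
Local Notation policy := {ffun 'I_nS -> 'I_nA}.

Definition ell t s a : R := nth [ffun=> 0] ls t (s, a).
(** Losses not yet revealed read as 0, so queries can always consist of [T] functions. *)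
Definition seen t t' s a : R := if (t' < t)%N then ell t' s a else 0.

Record env (t : nat) (x : 'I_nS) (m : mem) : Prop := Env {
  env_S : nmem m n_states [::] = nS;
  env_A : nmem m n_actions [::] = nA;
  env_T : nmem m horizon [::] = T;
  env_t : nmem m round [::] = t;
  env_x : nmem m state [::] = x;
  env_P : forall s a s', rmem m trans [:: val s; val a; val s'] = P s a s';
  env_d : forall s : 'I_nS, rmem m start [:: val s] = d1 s;
  env_l : forall t' s a, rmem m past [:: t'; val s; val a] = seen t t' s a }.

Definition readonly c := all (fun y => y \notin wn c) [:: 0; 1; 2; 3; 4]%N &&
  all (fun y => y \notin wr c) [:: 0; 1; 2]%N.

Lemma env_frame c t x m m' : readonly c -> frame c m m' -> env t x m -> env t x m'.
Proof.
move=> /andP[/allP rn /allP rr] [fn fr] [eS eA eT et ex eP ed el].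
by split; rewrite ?fn ?rn // => *; rewrite fr ?rr.
Qed.

Lemma inj_idx1 n : injective (fun i : 'I_n => [:: val i]).
Proof. by move=> i j [/val_inj]. Qed.

Lemma tr_step pol t x m (f : policy) k : env t x m -> pol \notin wn (step_cmd pol) ->
  nmem m vcnt [::] = k -> (forall s : 'I_nS, nmem m pol [:: val s] = f s) ->
  (forall s : 'I_nS, rmem m rvec [:: val s] = occ P d1 f k s) ->
  tr (step_cmd pol) m (fun m' => nmem m' vcnt [::] = k.+1 /\
    (forall s : 'I_nS, rmem m' rvec [:: val s] = occ P d1 f k.+1 s) /\
    rmem m' rL [::] = rmem m rL [::] + \sum_s occ P d1 f k s * seen t k s (f s)).
Proof.
move=> e pw ck pf vk.
apply: tr_seq.
  apply: (tr_sum O (j := [::]) (g := fun s => occ P d1 f k s * seen t k s (f s)) _ (env_S e) SN) => //.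
  move=> m1 i [fn fr] xi _ /=.
  rewrite xi !fr // vk fn // ck; congr (_ * _).
  rewrite fn; first by rewrite pf (env_l e).
  by weaken_notin pw.
move=> m1 f1 [L1 o1].
have e1 : env t x m1 by apply: env_frame f1 e.
have v1 (s : 'I_nS) : rmem m1 rvec [:: val s] = occ P d1 f k s.
  by case: f1 => _ -> //.
have pf1 (s : 'I_nS) : nmem m1 pol [:: val s] = f s.
  by case: f1 => -> //; weaken_notin pw.
have ck1 : nmem m1 vcnt [::] = k by case: f1 => ->.
apply: (tr_seq (Q1 := fun m2 => forall s : 'I_nS, rmem m2 rnew [:: val s] = occ P d1 f k.+1 s)).
  pose I i m2 := forall s : 'I_nS, (s < i)%N -> rmem m2 rnew [:: val s] = occ P d1 f k.+1 s.
  apply: (tr_mono (Q := I nS)); last by move=> m2 _ Im2 s; apply: Im2.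
  apply: (tr_for _ _ _ (env_S e1) SN) => //= i m2 lt_i f2 xi Im2.
  have e2 : env t x m2 by apply: env_frame f2 e1.
  have v2 (s : 'I_nS) : rmem m2 rvec [:: val s] = occ P d1 f k s by case: f2 => _ ->.
  have pf2 (s : 'I_nS) : nmem m2 pol [:: val s] = f s.
    by case: f2 => -> //; weaken_notin pw.
  apply: (tr_seq (Q1 := fun m3 => rmem m3 rnew [:: i] = 0 /\
     forall s : 'I_nS, (s < i)%N -> rmem m3 rnew [:: val s] = occ P d1 f k.+1 s)).
    apply: tr_rset; rewrite /= xi !eqxx; split=> // s lt_s.
    by rewrite eqseq_cons andbT ltn_eqF // Im2.
  move=> m3 f3 [z3 Im3].
  have e3 : env t x m3 by apply: env_frame f3 e2.
  apply: tr_mono.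
    apply: (tr_sum O (j := [:: i]) (g := fun s => occ P d1 f k s * P s (f s) (Ordinal lt_i)) _ (env_S e3) SN) => //.
      by case: f3 => fn3 _ m4 [fn4 _] /=; rewrite fn4 // fn3 // xi.
    case: f3 => fn3 fr3 m4 s [fn4 fr4] xs4 _ /=.
    rewrite xs4 fr4 // fr3 // v2 fn4; last by weaken_notin pw.
    rewrite fn3 // pf2 fn4 // fn3 // xi fr4 // (env_P e3 s (f s) (Ordinal lt_i)) //.
  move=> m4 f4 [z4 o4] s; rewrite ltnS leq_eqVlt => /predU1P[si|lt_s]; last first.
    by rewrite o4 ?Im3 // eqseq_cons andbT ltn_eqF.
  have -> : s = Ordinal lt_i by apply: val_inj.
  by rewrite z4 z3 add0r.
move=> m2 f2 n2.
have e2 : env t x m2 by apply: env_frame f2 e1.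
apply: (tr_seq (Q1 := fun m3 => forall s : 'I_nS, rmem m3 rvec [:: val s] = occ P d1 f k.+1 s)).
  apply: tr_mono.
    apply: (tr_fill O (J := fun s : 'I_nS => [:: val s]) (g := occ P d1 f k.+1) _ (env_S e2) SN) => //.
    - exact: inj_idx1.
    - by move=> m3 s _ /= ->.
    by move=> m3 s [fn fr] /= -> _; rewrite fr // n2.
  by move=> m3 _ [].
move=> m3 f3 v3; apply: tr_nset; split=> /=.
  by case: f3 => -> //; case: f2 => -> //; rewrite ck1 addn1.
split=> //; case: f3 => _ -> //; case: f2 => _ -> //.
Qed.

Lemma tr_forward pol t x m (f : policy) k : env t x m -> pol \notin wn (forward_cmd pol) ->
  nmem m vtau [::] = k -> (k <= nS * T)%N ->
  (forall s : 'I_nS, nmem m pol [:: val s] = f s) ->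
  tr (forward_cmd pol) m (fun m' =>
    (forall s : 'I_nS, rmem m' rvec [:: val s] = occ P d1 f k s) /\
    rmem m' rL [::] = \sum_(j < k) \sum_s occ P d1 f j s * seen t j s (f s)).
Proof.
move=> e pw tauk kT pf.
apply: (tr_seq (Q1 := fun m1 => rmem m1 rL [::] = 0)); first exact: tr_rset.
move=> m1 f1 L1.
apply: (tr_seq (Q1 := fun m2 => nmem m2 vcnt [::] = 0%N)); first exact: tr_nset.
move=> m2 f2 c2.
have e1 : env t x m1 by apply: env_frame f1 e.
have e2 : env t x m2 by apply: env_frame f2 e1.
have polS : pol \notin wn (step_cmd pol).
  by weaken_notin pw.
have pcnt : (pol == vcnt) = false.
  by apply/negbTE; apply: contra pw => /eqP ->.
apply: (tr_seq (Q1 := fun m3 => forall s : 'I_nS, rmem m3 rvec [:: val s] = d1 s)).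
  apply: tr_mono.
    apply: (tr_fill O (J := fun s : 'I_nS => [:: val s]) (g := d1) _ (env_S e2) SN) => //.
    - exact: inj_idx1.
    - by move=> m3 s _ /= ->.
    by move=> m3 s [fn fr] /= -> _; rewrite fr // (env_d e2).
  by move=> m3 _ [].
move=> m3 f3 v3.
have e3 : env t x m3 by apply: env_frame f3 e2.
pose G m' := [/\ env t x m', nmem m' vtau [::] = k & forall s : 'I_nS, nmem m' pol [:: val s] = f s].
(* Iterations after the [k]-th are idle, hence [minn i k]. *)
pose I i m' := [/\ nmem m' vcnt [::] = minn i k,
   forall s : 'I_nS, rmem m' rvec [:: val s] = occ P d1 f (minn i k) s &
   rmem m' rL [::] = \sum_(j < minn i k) \sum_s occ P d1 f j s * seen t j s (f s)].
have polx y v m' : y \in [:: x1; x2] -> G m' -> G (nset m' y [::] v).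
  move=> yx [e' t' p'].
  have y1 : y \in wn (forward_cmd pol).
    by move: yx; rewrite /= !inE => /orP[] /eqP ->.
  have yp : (pol == y) = false by apply/negbTE; apply: contra pw => /eqP ->.
  split.
  - case: e' => eS eA eT et ex eP ed el.
    by move: yx; rewrite !inE => /orP[] /eqP ->; split.
  - by move: yx; rewrite !inE => /orP[] /eqP -> /=; exact: t'.
  by move=> s; rewrite nmem_nset_neq ?yp.
have Ix y i m' v : y \in [:: x1; x2] -> I i m' -> I i (nset m' y [::] v).
  by rewrite !inE => /orP[] /eqP -> [? ? ?]; split=> //=.
have one i m' : G m' -> I i m' ->
  tr (If (BLeN (nv vtau) (nv vcnt)) Skip (step_cmd pol)) m' (fun m'' => G m'' /\ I (i + 1)%N m'').
  move=> [e' t' p'] [ci vi Li]; apply: tr_if; rewrite [beval _ _]/= t' ci.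
  have [le_k|lt_k] := leqP k i.
    rewrite leqnn; apply: tr_skip.
    split=> //; rewrite /I; have -> : minn (i + 1) k = minn i k.
      by rewrite (minn_idPr le_k); apply/minn_idPr; apply: leq_trans le_k (leq_addr _ _).
    by rewrite (minn_idPr le_k) in ci vi Li *; split.
  rewrite leqNgt lt_k; apply: tr_mono.
    rewrite (minn_idPl (ltnW lt_k)) in ci vi.
    exact: tr_step e' polS ci p' vi.
  move=> m'' f'' [c'' [v'' L'']]; rewrite /I addn1 (minn_idPl lt_k); split; last first.
    by split=> //; rewrite L'' Li (minn_idPl (ltnW lt_k)) big_ord_recr.
  split; first by apply: env_frame f'' e'.
    by case: f'' => ->.
  move=> s; case: f'' => -> //.
have G3 : G m3.
  split=> //; first by case: f3 => -> //; case: f2 => -> //; case: f1 => ->.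
  move=> s; case: f3 => fn3 _; rewrite fn3; last first.
    by weaken_notin pw.
  by case: f2 => fn2 _; rewrite fn2 ?inE ?pcnt //; case: f1 => ->.
have I3 : I 0%N m3.
  rewrite /I min0n big_ord0; split=> //; first by case: f3 => ->.
  by case: f3 => _ -> //; case: f2 => _ ->.
have inner := tr_nest (O := O) (N := N) (x := x2) (b := xT) (d := 1) (G := G) (I := I) (n := T).
have outer := tr_nest (O := O) (N := N) (x := x1) (b := xS) (d := (T * 1)%N) (G := G) (I := I) (n := nS).
apply: tr_mono.
  apply: (outer _ _ _ _ _ SN _ _ _ 0%N m3 G3 I3) => //.
  - by move=> m' [e' _ _]; apply: env_S e'.
  - by move=> m' v; apply: polx.
  apply: inner => //.
  - by move=> m' [e' _ _]; apply: env_T e'.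
  - by move=> m' v; apply: polx.
move=> m' _ [_ []]; rewrite add0n muln1 (minn_idPr kT) => _ v L; split=> //.
Qed.

End Blocks.

(** * Drawing the target and the noise *)

Section Sampling.
Variables (R : realType) (nS nA : nat) (P : 'I_nS -> 'I_nA -> 'I_nS -> R).
Variables (d1 : 'I_nS -> R) (ls : seq (loss R nS nA)).
Variable O : seq (loss R nS nA) -> {ffun 'I_nS -> 'I_nA}.
Variable N : nat.
Let T := size ls.
Hypotheses (SN : (nS <= N)%N) (AN : (nA <= N)%N) (TN : (T <= N)%N).
Hypothesis nS_gt1 : (1 < nS)%N.

Local Notation mem := (Defs.mem R).
Local Notation tr := (tr O N).
Local Notation hup := (hup O N).
Local Notation env := (env P d1 ls).

Lemma hup_draw t x m (p : 'I_nS -> R) (F : nat -> R) : env t x m -> is_dist p ->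
  (forall s : 'I_nS, rmem m rvec [:: val s] = p s) ->
  hup draw_cmd m (fun m' => (nmem m' vtgt [::] < nS)%N)
    (fun m' => F (nmem m' vtgt [::])) (\sum_s p s * F s).
Proof.
move=> e [p0 psum] vp.
pose rem i := \sum_(i <= y < nS) load p y.
(* The mean of [F] over the states from [i] on, given that all earlier ones were rejected. With no
   mass left, the target keeps its default 0. *)
pose G i := if rem i == 0 then F 0%N else (\sum_(i <= y < nS) load p y * F y) / rem i.
pose Fi i (m : mem) := if nmem m vfound [::] == 0%N then G i else F (nmem m vtgt [::]).
pose I i (m : mem) := (nmem m vtgt [::] < nS)%N /\
  (nmem m vfound [::] = 0%N -> nmem m vtgt [::] = 0%N /\ rmem m rrem [::] = rem i).
have lp y : 0 <= load p y by rewrite /load; case: insub.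
have rem0 : rem 0%N = 1.
  by rewrite /rem big_mkord -psum; apply: eq_bigr => s _; rewrite load_ord.
have remS i (lt_i : (i < nS)%N) : rem i = p (Ordinal lt_i) + rem i.+1.
  by rewrite /rem big_ltn // load_nat.
have rem_ge0 i : 0 <= rem i by apply: sumr_ge0.
have -> : \sum_s p s * F s = G 0%N.
  rewrite /G rem0 oner_eq0 divr1 big_mkord; apply: eq_bigr => s _.
  by rewrite load_ord.
apply: (hup_seq (Q1 := fun m1 => rmem m1 rrem [::] = 1) (F1 := fun=> G 0%N)).
  by apply: hup_tr; apply: tr_rset.
move=> m1 f1 r1.
apply: (hup_seq (Q1 := fun m2 => nmem m2 vtgt [::] = 0%N) (F1 := fun=> G 0%N)).
  by apply: hup_tr; apply: tr_nset.
move=> m2 f2 t2.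
apply: (hup_seq (Q1 := fun m3 => nmem m3 vfound [::] = 0%N) (F1 := fun=> G 0%N)).
  by apply: hup_tr; apply: tr_nset.
move=> m3 f3 fd3.
have e1 : env t x m1 by apply: env_frame f1 e.
have e2 : env t x m2 by apply: env_frame f2 e1.
have e3 : env t x m3 by apply: env_frame f3 e2.
have v3 (s : 'I_nS) : rmem m3 rvec [:: val s] = p s.
  by case: f3 => _ -> //; case: f2 => _ -> //; case: f1 => _ ->.
have t3 : nmem m3 vtgt [::] = 0%N by case: f3 => ->.
have I3 : I 0%N m3.
  split; first by rewrite t3 (ltn_trans _ nS_gt1).
  move=> _; split=> //; case: f3 => _ -> //; case: f2 => _ -> //.
  by rewrite r1 rem0.
apply: hup_mono (lexx _).
  have -> : G 0%N = Fi 0%N m3 by rewrite /Fi fd3.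
  apply: (hup_for (n := nS) _ _ _ (env_S e3) SN (I := I) (F := Fi)) => //.
  move=> i m4 lt_i f4 xi [tg fd].
  have v4 : rmem m4 rvec [:: i] = p (Ordinal lt_i).
    by rewrite -(v3 (Ordinal lt_i)); case: f4 => _ ->.
  apply: hup_if; rewrite [beval _ _]/=.
  have [fd0|fd1] := posnP (nmem m4 vfound [::]); last first.
    rewrite leqNgt fd1; apply: hup_tr; apply: tr_skip.
    rewrite /I /Fi !(gtn_eqF fd1); split=> //; split=> // z.
    by rewrite z in fd1.
  have [tg0 rr] := fd fd0; rewrite /Fi fd0 eqxx leqnn.
  apply: (hup_seq
     (Q1 := fun m5 => m5 = nset m4 vflip [::] 1 \/ m5 = nset m4 vflip [::] 0)
     (F1 := fun m5 => if nmem m5 vflip [::] == 1%N then F i else G i.+1)).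
    apply: hup_flip => /=; [by left | by right|].
    rewrite xi v4 rr; have rS := remS i lt_i; have pi0 := p0 (Ordinal lt_i).
    rewrite /G; have [ri0|ri0] := eqVneq (rem i) 0.
      have [-> r1'] : p (Ordinal lt_i) = 0 /\ rem i.+1 = 0.
        move: (rem_ge0 i.+1) rS; rewrite ri0 => *; split; lra.
      rewrite mul0r r1' eqxx /clip min_r // maxxx mul0r subr0 mul1r add0r //.
    have ripos : 0 < rem i by rewrite lt_neqAle eq_sym ri0 rem_ge0.
    have cl : clip (p (Ordinal lt_i) / rem i) = p (Ordinal lt_i) / rem i.
      apply: clip_id; rewrite divr_ge0 //= ler_pdivrMr // mul1r rS lerDl //.
    rewrite cl [\sum_(i <= y < nS) _]big_ltn // load_nat.
    have [r1'|r1'] := eqVneq (rem i.+1) 0.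
      have pr : p (Ordinal lt_i) = rem i by rewrite rS r1' addr0.
      have z y : (i.+1 <= y < nS)%N -> load p y = 0.
        move=> /andP[ly yn]; apply/eqP; rewrite eq_le lp andbT -r1' /rem.
        rewrite (big_cat_nat ly (ltnW yn)) /= (big_ltn yn) addrCA lerDl addr_ge0 ?sumr_ge0 //.
      rewrite big_nat big1 => [|y yb]; last by rewrite z // mul0r.
      by rewrite pr divff // subrr mul0r !addr0 mul1r mulrAC divff // mul1r.
    rewrite le_eqVlt; apply/orP; left; apply/eqP.
    have -> : p (Ordinal lt_i) = rem i - rem i.+1 by rewrite rS addrK.
    by field; rewrite ri0 r1'.
  move=> m5 _ m5E; apply: hup_tr.
  have fd5 : nmem m5 vfound [::] = 0%N by case: m5E => ->.
  have tg5 : nmem m5 vtgt [::] = 0%N by case: m5E => ->.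
  have rr5 : rmem m5 rrem [::] = rem i by case: m5E => ->.
  have xs5 : nmem m5 xs [::] = i by case: m5E => ->.
  have v5 : rmem m5 rvec [:: i] = p (Ordinal lt_i) by case: m5E => ->.
  apply: tr_if; case: m5E => m5E; rewrite m5E [beval _ _]/= -m5E.
    apply: (tr_seq (Q1 := fun m6 => nmem m6 vtgt [::] = i)); first by apply: tr_nset => /=; rewrite xs5.
    move=> m6 _ tg6; apply: tr_nset; rewrite /I /= tg6; split; first by split.
    by rewrite m5E /=.
  apply: tr_rset; rewrite /I /= xs5 v5 rr5 tg5 fd5 /=; split; last by rewrite m5E.
  split; first exact: ltn_trans nS_gt1.
  by move=> _; split=> //; rewrite (remS i lt_i) addrC addKr.
move=> m4 f4 [tg fd]; split=> //; rewrite /Fi; case: eqP => [/fd[-> _]|//].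
by rewrite /G /rem big_geq // eqxx.
Qed.

Let p : R := (nS * T)%:R^-1.
Let capN := (nS * T * (T * nS * nA))%N.
Hypothesis T_gt0 : (0 < T)%N.

Definition coords_from i : seq (seq nat) :=
  [seq [:: s; a] | s <- iota i (nS - i), a <- iota 0 nA].

Definition coords := coords_from 0.

Lemma coords_fromS i : (i < nS)%N -> coords_from i =
  [seq [:: i; a] | a <- iota 0 nA] ++ coords_from i.+1.
Proof. by move=> lt_i; rewrite /coords_from -subSS subSn // subSS. Qed.

Lemma coords_uniq : uniq coords.
Proof.
apply: allpairs_uniq; rewrite ?iota_uniq //.
by move=> [s a] [s' a'] _ _ /= [-> ->].
Qed.

Lemma mem_coords (s : 'I_nS) (a : 'I_nA) : cell_of s a \in coords.
Proof.
by apply/allpairsP; exists (val s, val a); rewrite !mem_iota subn0 !add0n /=.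
Qed.

Let psi (l : seq (seq nat)) (f : (seq nat -> nat) -> R) g := prodE p capN l g f.

Let p01 : 0 < p <= 1.
Proof.
have ST : (0 < nS * T)%N by rewrite muln_gt0 T_gt0 ltnW.
by rewrite invr_gt0 ltr0n ST invf_le1 ?ltr0n // ler1n.
Qed.

(* The value of the tosses that remain for coordinate c, k of them being done. *)
Let toss_value (c : seq nat) (phi : (seq nat -> nat) -> R) k (m : mem) :=
  if nmem m vstop [::] == 0%N then
    geo p (capN - k) (nmem m aG c) (fun v => phi (upd (nmem m aG) c v))
  else phi (nmem m aG).

Lemma hup_toss t x m i j phi k : (k + 1 <= capN)%N -> env t x m ->
  nmem m xs [::] = i -> nmem m xa [::] = j ->
  hup toss_cmd m (fun m' => [/\ env t x m', nmem m' xs [::] = i & nmem m' xa [::] = j])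
    (toss_value [:: i; j] phi (k + 1)) (toss_value [:: i; j] phi k m).
Proof.
move=> kN e xi xj.
apply: hup_mono (lexx _); last first.
  move=> m' f q; split; last exact: lexx.
  by split; [apply: env_frame f e | case: f => -> | case: f => ->].
instantiate (1 := fun=> True).
apply: hup_if; rewrite [beval _ _]/=.
have [st0|st1] := posnP (nmem m vstop [::]); last first.
  rewrite leqNgt st1; apply: hup_tr; apply: tr_skip; split=> //.
  by rewrite /toss_value !(gtn_eqF st1).
rewrite {2}/toss_value st0 eqxx leqnn.
have -> : (capN - k = (capN - (k + 1)).+1)%N by move: kN; rewrite addn1 => kN; rewrite -subSn // subSS.
rewrite [geo _ _.+1 _ _]/=.
apply: (hup_seq
  (Q1 := fun m1 => m1 = nset m vflip [::] 1 \/ m1 = nset m vflip [::] 0)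
  (F1 := fun m1 => if nmem m1 vflip [::] == 1%N
     then geo p (capN - (k + 1)) (nmem m aG [:: i; j]).+1 (fun v => phi (upd (nmem m aG) [:: i; j] v))
     else phi (nmem m aG))).
  apply: hup_flip => /=; [by left | by right|].
  rewrite (env_S e) (env_T e) -natrM -/p clip_id; last first.
    by case/andP: p01 => p0 p1; rewrite subr_ge0 p1 /= gerBl ltW.
  rewrite subKr; set u := upd _ _ _; have -> : u = nmem m aG; last by [].
  by apply/funext => c; rewrite /u /upd; case: eqP => [->|].
move=> m1 _ m1E; apply: hup_tr; apply: tr_if.
case: m1E => ->; rewrite [beval _ _]/=.
  apply: tr_nset; split=> //; rewrite /toss_value /= st0 xi xj /= !eqxx addn1.
  rewrite le_eqVlt; apply/orP; left; apply/eqP.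
  congr (geo _ _ _ _); first by rewrite addn1.
  apply/funext => v; congr phi.
  by apply/funext => c; rewrite /upd; case: eqP.
by apply: tr_nset; split=> //; rewrite /toss_value.
Qed.

(** The potential is the expectation over the cells not yet sampled, given the counts already in
    memory. *)
Lemma hup_sample t x m (f : (seq nat -> nat) -> R) : env t x m ->
  hup sample_cmd m (fun=> True) (fun m' => f (nmem m' aG))
    (prodE p capN coords (nmem m aG) f).
Proof.
move=> e.
pose I (i : nat) (m : mem) := env t x m.
pose F i (m : mem) := psi (coords_from i) f (nmem m aG).
have envx y m' v : y \in iota 6 10 -> env t x m' -> env t x (nset m' y [::] v).
  move=> yx [eS eA eT et ex eP ed el].
  by split=> //; rewrite nmem_nset_neq //; apply: contraTneq yx => <-.
apply: (hup_mono (Q := I nS) (F := F nS) (v := F 0%N m)) => //; last first.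
  by move=> m' _ _; rewrite /F /coords_from subnn.
apply: (hup_for (n := nS) _ _ _ (env_S e) SN (I := I) (F := F)) => //.
- by move=> i m' v; apply: envx.
move=> i m1 lt_i f1 xi e1.
pose F1 j (m : mem) := psi ([seq [:: i; a] | a <- iota j (nA - j)] ++ coords_from i.+1) f (nmem m aG).
apply: (hup_mono (Q := I nA) (F := F1 nA) (v := F1 0%N m1)) => //; last first.
- by rewrite /F1 /F subn0 -coords_fromS.
- by move=> m' _ e'; split=> //; rewrite /F1 subnn.
apply: (hup_for (n := nA) _ _ _ (env_A e1) AN (I := I) (F := F1)) => //.
- by move=> j m' v; apply: envx.
move=> j m2 lt_j f2 xj e2.
have xi2 : nmem m2 xs [::] = i by case: f2 => ->.
pose phi := psi ([seq [:: i; a] | a <- iota j.+1 (nA - j.+1)] ++ coords_from i.+1) f.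
have F1j : F1 j m2 = geo p capN 0 (fun v => phi (upd (nmem m2 aG) [:: i; j] v)).
  by rewrite /F1 -subSS subSn //= subSS.
rewrite F1j.
apply: (hup_seq (Q1 := fun m3 => [/\ env t x m3, nmem m3 xs [::] = i, nmem m3 xa [::] = j & nmem m3 aG [:: i; j] = 0%N])
  (F1 := fun m3 => geo p capN 0 (fun v => phi (upd (nmem m3 aG) [:: i; j] v)))).
  apply: hup_tr; apply: tr_nset; rewrite /= xi2 xj !eqxx /=; split.
    split=> //; case: e2 => *; split=> //.
  rewrite le_eqVlt; apply/orP; left; apply/eqP; congr (geo _ _ _ _).
  by apply/funext => v; congr phi; apply/funext => c; rewrite /upd; case: eqP.
move=> m3 f3 [e3 xi3 xj3 g3].
apply: (hup_seq (Q1 := fun m4 => [/\ env t x m4, nmem m4 xs [::] = i & nmem m4 xa [::] = j])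
  (F1 := toss_value [:: i; j] phi 0)).
  apply: hup_tr; apply: tr_nset; split.
    by split=> //; case: e3 => *; split.
  by rewrite /toss_value /= g3 subn0.
move=> m4 f4 G4.
pose G (m : mem) := [/\ env t x m, nmem m xs [::] = i & nmem m xa [::] = j].
have Gx y m' v : y \in iota 11 5 -> G m' -> G (nset m' y [::] v).
  move=> yx [e' i' j']; have ny z : z \notin iota 11 5 -> z != y by apply: contraNneq => ->.
  split; last 2 first.
  - by rewrite nmem_nset_neq // ny.
  - by rewrite nmem_nset_neq // ny.
  by apply: envx e'; move: yx; rewrite !mem_iota => /andP[l1 l2]; apply/andP; split; [apply: leq_trans l1 | apply: leq_trans l2 _].
have Fx y k m' v : y \in iota 11 5 -> toss_value [:: i; j] phi k (nset m' y [::] v) = toss_value [:: i; j] phi k m'.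
  move=> yx; have ny z : z \notin iota 11 5 -> z != y by apply: contraNneq => ->.
  by rewrite /toss_value !nmem_nset_neq // ny.
have n1 := @hup_nest _ _ _ O N x5 xA toss_cmd 1 G (toss_value [:: i; j] phi) nA capN.
have n2 := @hup_nest _ _ _ O N x4 xS (For x5 xA toss_cmd) (nA * 1) G (toss_value [:: i; j] phi) nS capN.
have n3 := @hup_nest _ _ _ O N x3 xT (For x4 xS (For x5 xA toss_cmd)) (nS * (nA * 1)) G (toss_value [:: i; j] phi) T capN.
have n4 := @hup_nest _ _ _ O N x2 xT (For x3 xT (For x4 xS (For x5 xA toss_cmd))) (T * (nS * (nA * 1))) G (toss_value [:: i; j] phi) T capN.
have n5 := @hup_nest _ _ _ O N x1 xS (For x2 xT (For x3 xT (For x4 xS (For x5 xA toss_cmd)))) (T * (T * (nS * (nA * 1)))) G (toss_value [:: i; j] phi) nS capN.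
(* The five nested loops perform exactly as many tosses as the cap allows. *)
have total : (nS * (T * (T * (nS * (nA * 1)))) = capN)%N by rewrite /capN; ring.
have GS m' : G m' -> nmem m' xS [::] = nS by case=> /env_S.
have GA m' : G m' -> nmem m' xA [::] = nA by case=> /env_A.
have GT m' : G m' -> nmem m' xT [::] = T by case=> /env_T.
have toss k m' : (k + 1 <= capN)%N -> G m' -> hup toss_cmd m' G (toss_value [:: i; j] phi (k + 1)) (toss_value [:: i; j] phi k m').
  by move=> kN [e' i' j']; apply: hup_toss.
have l1 := n1 isT isT isT GA AN (fun m v => Gx x5 m v isT) (fun k m v => Fx x5 k m v isT) toss.
have l2 := n2 isT isT isT GS SN (fun m v => Gx x4 m v isT) (fun k m v => Fx x4 k m v isT) l1.
have l3 := n3 isT isT isT GT TN (fun m v => Gx x3 m v isT) (fun k m v => Fx x3 k m v isT) l2.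
have l4 := n4 isT isT isT GT TN (fun m v => Gx x2 m v isT) (fun k m v => Fx x2 k m v isT) l3.
have l5 := n5 isT isT isT GS SN (fun m v => Gx x1 m v isT) (fun k m v => Fx x1 k m v isT) l4.
apply: hup_mono (lexx _).
  by apply: (l5 0%N m4 _ G4); rewrite total.
move=> m5 f5 [e5 _ _]; split=> //; rewrite total add0n /toss_value subnn /= /F1 -/(phi _).
case: eqP => // _; rewrite (_ : upd _ _ _ = nmem m5 aG) //.
by apply/funext => c; rewrite /upd; case: eqP => [->|].
Qed.

End Sampling.

(** * The noise scale, the perturbed leader and the switch *)

Section Leader.
Variables (R : realType) (nS nA : nat) (P : 'I_nS -> 'I_nA -> 'I_nS -> R).
Hypothesis PD : forall s a, is_dist (P s a).
Variables (d1 : 'I_nS -> R) (ls : seq (loss R nS nA)).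
Variable O : seq (loss R nS nA) -> {ffun 'I_nS -> 'I_nA}.
Variable N : nat.
Let T := size ls.
Hypotheses (SN : (nS <= N)%N) (AN : (nA <= N)%N) (TN : (T <= N)%N).
Hypotheses (nS_gt1 : (1 < nS)%N) (nA_gt0 : (0 < nA)%N).

Local Notation mem := (Defs.mem R).
Local Notation tr := (tr O N).
Local Notation hup := (hup O N).
Local Notation env := (env P d1 ls).
Local Notation seen := (seen ls).
Local Notation policy := {ffun 'I_nS -> 'I_nA}.

Definition lgSA := up_log 2 (nS * nA).

Lemma tr_log t x m : env t x m -> tr log_cmd m (fun m' => nmem m' vlg [::] = lgSA).
Proof.
move=> e.
apply: (tr_seq (Q1 := fun m1 => rmem m1 rpw [::] = 1)); first exact: tr_rset.
move=> m1 f1 p1.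
apply: (tr_seq (Q1 := fun m1 => nmem m1 vlg [::] = 0%N)); first exact: tr_nset.
move=> m2 f2 l2.
have e1 : env t x m1 by apply: env_frame f1 e.
have e2 : env t x m2 by apply: env_frame f2 e1.
pose I k (m : mem) := nmem m vlg [::] = minn k lgSA /\
  rmem m rpw [::] = (2 ^ minn k lgSA)%:R.
pose body := If (BLeR (RMul (rnv xS) (rnv xA)) (rv rpw)) Skip
              (Seq (rset0 rpw (RAdd (rv rpw) (rv rpw)))
                   (nset0 vlg (NAdd (nv vlg) (NConst 1)))).
have step k m' : env t x m' -> I k m' -> tr body m' (fun m'' => env t x m'' /\ I (k + 1)%N m'').
  move=> e' [l' p'].
  apply: (tr_mono (Q := I (k + 1)%N)); last first.
    by move=> m'' f'' I''; split=> //; apply: env_frame f'' e'.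
  apply: tr_if; rewrite [beval _ _]/= p' (env_S e') (env_A e') -natrM ler_nat.
  rewrite /I addn1.
  have [le_l|lt_l] := leqP lgSA k.
    have le1 : (lgSA <= k.+1)%N by apply: leqW.
    rewrite (minn_idPr le1) up_logP //; apply: tr_skip.
    by rewrite (minn_idPr le_l) in l' p'.
  rewrite leqNgt; have -> : (2 ^ k < nS * nA)%N.
    by rewrite ltnNge; apply: contraTN lt_l => /up_log_min; rewrite -leqNgt; apply.
  apply: (tr_seq (Q1 := fun m'' => rmem m'' rpw [::] = (2 ^ k.+1)%:R /\ nmem m'' vlg [::] = k)).
    apply: tr_rset; rewrite /= p' l' (minn_idPl (ltnW lt_l)); split=> //.
    by rewrite expnS mul2n -addnn natrD.
  move=> m'' f'' [p'' l'']; apply: tr_nset; rewrite /= l'' addn1 (minn_idPl lt_l).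
  by split.
have I2 : I 0%N m2.
  rewrite /I min0n; split=> //; case: f2 => _ -> //.
have envx y m' v : y \in iota 6 10 -> env t x m' -> env t x (nset m' y [::] v).
  move=> yx [eS eA eT et ex eP ed el].
  by split=> //; rewrite nmem_nset_neq //; apply: contraTneq yx => <-.
have n1 := tr_nest (O := O) (N := N) (x := x2) (b := xA) (d := 1) (G := env t x) (I := I)
   (n := nA) (c := body) isT isT isT (fun m e => env_A e) AN (fun m v => envx x2 m v isT)
   (fun k m v I => I) step.
have n2 := tr_nest (O := O) (N := N) (x := x1) (b := xS) (d := (nA * 1)%N) (G := env t x) (I := I)
   (n := nS) (c := For x2 xA body) isT isT isT (fun m e => env_S e) SN (fun m v => envx x1 m v isT)
   (fun k m v I => I) n1.
apply: tr_mono (n2 0%N m2 e2 I2) _ => m' _ [_ [-> _]].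
rewrite add0n muln1; apply/minn_idPr; apply: up_log_min => //.
by apply: ltnW; apply: ltn_expl.
Qed.

Definition past_seq t : seq (loss R nS nA) :=
  mkseq (fun t' => [ffun sa => seen t t' sa.1 sa.2]) T.

Definition past_best t := O (past_seq t).

Definition best_past_loss t : R :=
  \sum_(j < T) \sum_s occ P d1 (past_best t) j s * seen t j s (past_best t s).

Definition next_scale t n :=
  if best_past_loss t <= (n + 2)%:R * (n + 2)%:R * (nS%:R * nS%:R * lgSA%:R)
  then n else n.+1.

Lemma read_past t x m : env t x m ->
  [seq read_loss nS nA m past t' | t' <- iota 0 T] = past_seq t.
Proof.
move=> e; apply: eq_map => t'; apply/ffunP => -[s a].
by rewrite !ffunE /= (env_l e).
Qed.

Lemma tr_scale t x m n : env t x m -> nmem m vscale [::] = n ->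
  tr scale_cmd m (fun m' => nmem m' vscale [::] = next_scale t n).
Proof.
move=> e sn.
apply: (tr_seq (tr_log e)) => m1 f1 l1.
have e1 : env t x m1 by apply: env_frame f1 e.
apply: (tr_seq (Q1 := fun m2 => forall s : 'I_nS, nmem m2 abest [:: val s] = past_best t s)).
  apply: tr_query => s; rewrite write_policyE.
  by rewrite /= (env_T e1) (read_past e1).
move=> m2 f2 b2.
have e2 : env t x m2 by apply: env_frame f2 e1.
apply: (tr_seq (Q1 := fun m3 => nmem m3 vtau [::] = T)).
  by apply: tr_nset; rewrite /= (env_T e2).
move=> m3 f3 t3.
have e3 : env t x m3 by apply: env_frame f3 e2.
have b3 (s : 'I_nS) : nmem m3 abest [:: val s] = past_best t s.
  by case: f3 => ->.
apply: (tr_seq (Q1 := fun m4 => rmem m4 rL [::] = best_past_loss t)).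
  apply: tr_mono (tr_forward O SN TN e3 _ t3 _ b3) _ => //.
    by rewrite leq_pmull // ltnW.
  by move=> m4 _ [].
move=> m4 f4 L4.
have e4 : env t x m4 by apply: env_frame f4 e3.
have l4 : nmem m4 vlg [::] = lgSA.
  by case: f4 => -> //; case: f3 => -> //; case: f2 => ->.
have s4 : nmem m4 vscale [::] = n.
  by case: f4 => -> //; case: f3 => -> //; case: f2 => -> //; case: f1 => ->.
apply: tr_if; rewrite [beval _ _]/= L4 l4 s4 (env_S e4) /next_scale.
by case: ifP => _; [apply: tr_skip | apply: tr_nset; rewrite /= s4 addn1].
Qed.

(* The perturbation of the first loss; as the first state has law d1, the policy f
   pays (n + 2) / T times nS capN - sum_s g (s, f s), where capN, the cap of the
   counts, keeps it nonnegative. *)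
Definition noise n (g : seq nat -> nat) (s : 'I_nS) (a : 'I_nA) : R :=
  (n + 2)%:R * (nS%:R * T%:R * (T%:R * nS%:R * nA%:R) - (g [:: val s; val a])%:R) /
  (T%:R * d1 s).

Definition total_noise n g : R := 1 + \sum_s \sum_a noise n g s a.

(* Dividing by the total noise makes the queries [0,1]-valued. *)
Definition leader_seq t n g : seq (loss R nS nA) :=
  mkseq (fun t' => [ffun sa => (seen t t' sa.1 sa.2 +
     (1 - t')%N%:R * noise n g sa.1 sa.2) / total_noise n g]) T.

Definition leader t n g := O (leader_seq t n g).

Lemma noise_expE t x m n g (s : 'I_nS) (a : 'I_nA) : env t x m ->
  nmem m vscale [::] = n ->
  (forall s a : nat, nmem m aG [:: s; a] = g [:: s; a]) ->
  nmem m xs [::] = s -> nmem m xa [::] = a -> reval m noise_exp = noise n g s a.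
Proof.
by move=> e sn gG ss aa; rewrite /= ss aa sn gG (env_S e) (env_A e) (env_T e) (env_d e).
Qed.

Lemma tr_leader t x m n g : env t x m -> nmem m vscale [::] = n ->
  (forall s a : nat, nmem m aG [:: s; a] = g [:: s; a]) ->
  tr leader_cmd m (fun m' => forall s : 'I_nS, nmem m' anew [:: val s] = leader t n g s).
Proof.
move=> e sn gG.
apply: (tr_seq (Q1 := fun m1 => rmem m1 rZ [::] = 1)); first exact: tr_rset.
move=> m1 f1 z1.
have e1 : env t x m1 by apply: env_frame f1 e.
have keep c m2 : frame c m1 m2 -> vscale \notin wn c -> aG \notin wn c ->
    nmem m2 vscale [::] = n /\ forall s a : nat, nmem m2 aG [:: s; a] = g [:: s; a].
  move=> [fn _] h1 h2; rewrite !fn //; case: f1 => fn1 _.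
  by rewrite !fn1.
apply: (tr_seq (Q1 := fun m2 => rmem m2 rZ [::] = total_noise n g)).
  pose I k (m : mem) := rmem m rZ [::] = 1 + \sum_(0 <= i < k) load (fun s => \sum_a noise n g s a) i.
  apply: (tr_mono (Q := I nS)); last first.
    move=> m2 _; rewrite /I big_mkord => ->; congr (_ + _).
    by apply: eq_bigr => s _; rewrite load_ord.
  apply: (tr_for _ _ _ (env_S e1) SN) => //; first by rewrite /I big_geq // addr0.
  move=> i m2 lt_i f2 xi I2.
  have e2 : env t x m2 by apply: env_frame f2 e1.
  apply: tr_mono.
    apply: (tr_sum O (j := [::]) (g := noise n g (Ordinal lt_i)) _ (env_A e2) AN) => //.
    move=> m3 a f3 xa3 _.
    have [s2 g2] := keep _ m2 f2 isT isT.
    have e3 : env t x m3 by apply: env_frame f3 e2.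
    apply: noise_expE e3 _ _ _ xa3.
    - by case: f3 => ->.
    - by move=> s a'; case: f3 => ->.
    by case: f3 => ->.
  move=> m3 _ [z3 _]; rewrite /I z3 I2 big_nat_recr //= load_nat addrA //.
move=> m2 f2 z2.
have e2 : env t x m2 by apply: env_frame f2 e1.
have [s2 g2] := keep _ m2 f2 isT isT.
apply: (tr_seq (Q1 := fun m3 => forall t' (s : 'I_nS) (a : 'I_nA), (t' < T)%N ->
   rmem m3 rq [:: t'; val s; val a] = (seen t t' s a +
     (1 - t')%N%:R * noise n g s a) / total_noise n g)).
  pose I k (m : mem) := forall t' (s : 'I_nS) (a : 'I_nA), (t' < k)%N ->
   rmem m rq [:: t'; val s; val a] = (seen t t' s a +
     (1 - t')%N%:R * noise n g s a) / total_noise n g.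
  apply: (tr_for (n := T) (I := I) _ _ _ (env_T e2) TN) => //.
  move=> i m3 lt_i f3 xi I3.
  have e3 : env t x m3 by apply: env_frame f3 e2.
  apply: tr_mono.
    apply: (tr_fill2 O (J := fun (s : 'I_nS) (a : 'I_nA) => [:: i; val s; val a])
      (g := fun s a => (seen t i s a + (1 - i)%N%:R * noise n g s a) / total_noise n g)
      _ _ _ _ _ (env_S e3) SN (env_A e3) AN) => //.
    - by move=> s a s' a' [/val_inj -> /val_inj ->].
    - by move=> m4 s a f4 s4 a4; rewrite /= s4 a4; case: f4 => -> //; rewrite xi.
    move=> m4 s a f4 s4 a4 _.
    have e4 : env t x m4 by apply: env_frame f4 e3.
    have xi4 : nmem m4 xt [::] = i by case: f4 => ->.
    have Z4 : rmem m4 rZ [::] = total_noise n g.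
      by case: f4 => _ -> //; case: f3 => _ ->.
    rewrite [reval _ _]/= -/(reval m4 noise_exp) Z4 xi4 s4 a4 (env_l e4).
    congr ((_ + _ * _) / _); rewrite -(@noise_expE t x m4 n g s a e4) //= ?s4 ?a4 //.
      by case: f4 => -> //; case: f3 => ->.
    by move=> s' a'; case: f4 => -> //; case: f3 => ->.
  move=> m4 f4 [q4 o4] t' s a; rewrite ltnS leq_eqVlt => /predU1P[->//|lt_t].
  by rewrite o4 ?I3 // => s' a'; rewrite eqseq_cons ltn_eqF.
move=> m3 f3 q3; apply: tr_query => s; rewrite write_policyE.
have e3 : env t x m3 by apply: env_frame f3 e2.
rewrite /= (env_T e3) /leader; congr (val (O _ s)).
apply/eq_in_map => t'; rewrite mem_iota => /andP[_ lt_t]; apply/ffunP => -[s' a'].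
by rewrite !ffunE /= q3.
Qed.

Lemma tr_switch t x m (c0 f : policy) : env t x m ->
  (forall s : 'I_nS, nmem m acur [:: val s] = c0 s) ->
  (forall s : 'I_nS, nmem m anew [:: val s] = f s) ->
  tr switch_cmd m (fun m' => (forall s : 'I_nS, nmem m' acur [:: val s] = f s) /\
    if f != c0 then [/\ nmem m' vunc [::] = 1%N, nmem m' vph [::] = 0%N & rmem m' racc [::] = 0]
    else [/\ nmem m' vunc [::] = nmem m vunc [::], nmem m' vph [::] = nmem m vph [::] &
      rmem m' racc [::] = rmem m racc [::]]).
Proof.
move=> e cc cn.
pose I k (m' : mem) := (forall s : 'I_nS, nmem m' acur [:: val s] = if (s < k)%N then f s else c0 s) /\
    if [exists s : 'I_nS, (s < k)%N && (f s != c0 s)] then [/\ nmem m' vunc [::] = 1%N, nmem m' vph [::] = 0%N & rmem m' racc [::] = 0]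
    else [/\ nmem m' vunc [::] = nmem m vunc [::], nmem m' vph [::] = nmem m vph [::] &
      rmem m' racc [::] = rmem m racc [::]].
apply: (tr_mono (Q := I nS)); last first.
  move=> m' _ [c' u']; split=> [s|]; first by rewrite c' ltn_ord.
  have -> : (f != c0) = [exists s : 'I_nS, (s < nS)%N && (f s != c0 s)]; last exact: u'.
  apply/idP/existsP => [ne|[s /andP[_ ne]]]; last by apply: contraNneq ne => ->.
  apply/existsP; apply: contraNT ne => /existsPn ne; apply/eqP/ffunP => s.
  by apply/eqP; move: (ne s); rewrite ltn_ord negbK.
have I0 : I 0%N m.
  by split=> //; case: existsP => [[s]|_].
apply: (tr_for (n := nS) (I := I) _ _ _ (env_S e) SN) => //.
move=> i m1 lt_i f1 xi [c1 u1].
pose s0 := Ordinal lt_i.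
have n1 : nmem m1 anew [:: i] = f s0 by rewrite -(cn s0); case: f1 => ->.
have cs1 : nmem m1 acur [:: i] = c0 s0 by rewrite (c1 s0) ltnn.
have exS : [exists s : 'I_nS, (s < i.+1)%N && (f s != c0 s)] =
    [exists s : 'I_nS, (s < i)%N && (f s != c0 s)] || (f s0 != c0 s0).
  apply/existsP/orP => [[s /andP[]]|[/existsP[s /andP[lt_s ne]]|ne]].
  - rewrite ltnS leq_eqVlt => /orP[/eqP es ne|lt_s ne].
      by right; have -> : s0 = s by apply: val_inj.
    by left; apply/existsP; exists s; rewrite lt_s.
  - by exists s; rewrite ltnS ltnW.
  by exists s0; rewrite ltnSn.
have new (s : 'I_nS) : (if (s < i.+1)%N then f s else c0 s) =
    if s == s0 then f s0 else if (s < i)%N then f s else c0 s.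
  case: (eqVneq s s0) => [->|ne]; first by rewrite /= ltnSn.
  have ne' : (s : nat) != i by apply: contra ne => /eqP e'; apply/eqP/val_inj.
  by rewrite ltnS leq_eqVlt (negbTE ne').
apply: tr_if; rewrite [beval _ _]/= xi n1 cs1 -eqn_leq.
case: (eqVneq (c0 s0) (f s0)) => [e0|ne0].
  rewrite -e0 eqxx; apply: tr_skip; split.
    by move=> s; rewrite new c1; case: (eqVneq s s0) => [->|//]; rewrite /= ltnn e0.
  by rewrite exS e0 eqxx orbF.
have -> : (c0 s0 == f s0 :> nat) = false by apply/negbTE; apply: contra ne0 => /eqP /val_inj ->.
apply: (tr_seq (Q1 := fun m2 => nmem m2 vunc [::] = 1%N)); first exact: tr_nset.
move=> m2 f2 u2.
apply: (tr_seq (Q1 := fun m3 => nmem m3 vph [::] = 0%N)); first exact: tr_nset.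
move=> m3 f3 p3.
apply: (tr_seq (Q1 := fun m4 => rmem m4 racc [::] = 0)); first exact: tr_rset.
move=> m4 f4 a4; apply: tr_nset.
have x4 : nmem m4 xs [::] = i by case: f4 => -> //; case: f3 => -> //; case: f2 => ->.
have n4 : nmem m4 anew [:: i] = f s0.
  by case: f4 => -> //; case: f3 => -> //; case: f2 => ->.
have c4 : nmem m4 acur = nmem m1 acur.
  by case: f4 => -> //; case: f3 => -> //; case: f2 => ->.
split.
  move=> s; rewrite /= x4 n4 c4 c1 new eqseq_cons andbT.
  have -> : (\val s == i) = (s == s0) by [].
  by case: (s == s0).
rewrite exS (eq_sym (f s0)) ne0 orbT; split=> /=.
- by case: f4 => -> //; case: f3 => ->.
- by case: f4 => ->.
by [].
Qed.

End Leader.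

(** * The best chase length *)

Section Horizon.
Variables (R : realType) (nS nA : nat) (P : 'I_nS -> 'I_nA -> 'I_nS -> R).
Hypothesis PD : forall s a, is_dist (P s a).
Variable a0 : 'I_nA.

Definition worst h : R := \big[Order.min/1]_y \big[Order.min/1]_x reach P y h x.

Lemma worst_le h y x : worst h <= reach P y h x.
Proof. by apply: le_trans (bigmin_le _ y _) _; apply: bigmin_le. Qed.

Lemma worst_le1 h : worst h <= 1.
Proof. exact: bigmin_le_id. Qed.

Lemma le_worst h c : c <= 1 -> (forall y x, c <= reach P y h x) -> c <= worst h.
Proof. by move=> c1 cr; apply/bigmin_geP; split=> // y _; apply/bigmin_geP. Qed.

Lemma worst_ge0 h : 0 <= worst h.
Proof. by apply: le_worst => // y x; apply: reach_ge0 PD a0 _ _ _. Qed.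

Definition length_step (b : R * nat) h :=
  if b.2%:R * worst h.+1 <= h.+1%:R * b.1 then b else (worst h.+1, h.+1).

(* The chase length h in 1..k with the best ratio of success probability to h. *)
Definition best_length k := foldl length_step (0, 1%N) (iota 0 k).

Lemma best_lengthS k : best_length k.+1 = length_step (best_length k) k.
Proof. by rewrite /best_length -[in iota _ _]addn1 iotaD foldl_cat. Qed.

(** The default length 1 with probability 0 remains if every [worst] vanishes; hence [maxn 1 k] and
    a merely nonnegative [b.1]. Positivity will come from the diameter. *)
Lemma best_lengthP k : let b := best_length k in
  [/\ (0 < b.2 <= maxn 1 k)%N, 0 <= b.1, forall y x, b.1 <= reach P y b.2 x &
      forall h, (h < k)%N -> worst h.+1 * b.2%:R <= b.1 * h.+1%:R].
Proof.
elim: k => [|k [/andP[b0 bk] r0 rb IH]].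
  by split=> // y x; apply: reach_ge0 PD a0 _ _ _.
rewrite /= best_lengthS /length_step; set b := best_length k in b0 bk r0 rb IH *.
case: ifPn => [le_b|]; rewrite -?ltNge.
  split=> //.
    by rewrite b0; apply: leq_trans bk _; rewrite !geq_max leq_max leqnn /= leq_max leqnSn orbT.
  move=> h; rewrite ltnS leq_eqVlt => /predU1P[->|/IH//].
  by rewrite mulrC [leRHS]mulrC.
move=> lt_b; split=> //=.
- by rewrite leq_max leqnn orbT.
- exact: worst_ge0.
- by move=> y x; apply: worst_le.
move=> h; rewrite ltnS leq_eqVlt => /predU1P[-> //|lt_h].
have b2 : 0 < b.2%:R :> R by rewrite ltr0n.
rewrite -(ler_pM2r b2); have le1 := IH h lt_h.
(* Two ratios are compared through the previous best one, after multiplication by [b.2]. *)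
apply: (@le_trans _ _ (b.1 * h.+1%:R * k.+1%:R)).
  by rewrite mulrAC; apply: ler_wpM2r.
rewrite mulrAC [b.1 * _]mulrC [leRHS]mulrAC; apply: ler_wpM2r => //.
by rewrite [worst _ * _]mulrC ltW.
Qed.

End Horizon.

(** * Computing the steering tables *)

Section Steer.
Variables (R : realType) (nS nA : nat) (P : 'I_nS -> 'I_nA -> 'I_nS -> R).
Hypothesis PD : forall s a, is_dist (P s a).
Variables (d1 : 'I_nS -> R) (ls : seq (loss R nS nA)).
Variable O : seq (loss R nS nA) -> {ffun 'I_nS -> 'I_nA}.
Variable N : nat.
Let T := size ls.
Hypotheses (SN : (nS <= N)%N) (AN : (nA <= N)%N) (TN : (T <= N)%N).

Local Notation mem := (Defs.mem R).
Local Notation tr := (tr O N).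
Local Notation env := (env P d1 ls).
Local Notation reach := (reach P).
Local Notation reach_arg := (reach_arg P).

Definition reach_cell (m : mem) (y : 'I_nS) h (x : 'I_nS) : Prop :=
  rmem m rV [:: val y; h; val x] = reach y h x /\
  ((0 < h)%N -> nmem m aact [:: val y; h; val x] = reach_arg y h x).

(** [D] marks the part of the table that is already filled; each loop has its own region. *)
Definition reach_cells (D : 'I_nS -> nat -> 'I_nS -> bool) m : Prop :=
  forall y h x, D y h x -> reach_cell m y h x.

Lemma tr_reach_cell t x0 m (D : 'I_nS -> nat -> 'I_nS -> bool) y h x : env t x0 m ->
  nmem m xy [::] = val y -> nmem m xt [::] = h -> nmem m xs [::] = val x ->
  (forall x', D y h x') -> ~~ D y h.+1 x -> reach_cells D m ->
  tr (Seq (RSet rV [:: nv xy; NAdd (nv xt) (NConst 1); nv xs] (rn 0))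
     (Seq (NSet aact [:: nv xy; NAdd (nv xt) (NConst 1); nv xs] (NConst 0))
        (For xa xA best_cmd))) m
    (fun m' => reach_cells D m' /\ reach_cell m' y h.+1 x).
Proof.
move=> e ym hm xm Dh nD Dm.
pose q := load (fun a => \sum_x' P x a x' * reach y h x').
pose c := [:: val y; h.+1; val x].
have Dc y' h' x' : D y' h' x' -> ([:: val y'; h'; val x'] == c) = false.
  move=> Dd; apply/negbTE; apply: contra nD => /eqP[/val_inj <- <- /val_inj <-].
  exact: Dd.
pose I k m' := reach_cells D m' /\ (rmem m' rV c, nmem m' aact c) = best_arg q k.
apply: (tr_seq (Q1 := fun m1 => reach_cells D m1 /\ rmem m1 rV c = 0)).
  apply: tr_rset; rewrite /= ym hm xm addn1 -/c !eqxx /=; split=> //.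
  by move=> y' h' x' Dd; rewrite /reach_cell /= Dc //; apply: Dm.
move=> m1 f1 [Dm1 v1].
have y1 : nmem m1 xy [::] = val y by case: f1 => ->.
have h1 : nmem m1 xt [::] = h by case: f1 => ->.
have s1 : nmem m1 xs [::] = val x by case: f1 => ->.
have e1 : env t x0 m1 by apply: env_frame f1 e.
apply: (tr_seq (Q1 := I 0%N)).
  apply: tr_nset; rewrite /= y1 h1 s1 addn1 -/c /I /= !eqxx v1; split=> //.
  by move=> y' h' x' Dd; rewrite /reach_cell /= Dc //; apply: Dm1.
move=> m2 f2 I2.
have e2 : env t x0 m2 by apply: env_frame f2 e1.
apply: (tr_mono (Q := I nA)); last first.
  by move=> m3 _ [D3 b3]; split=> //; split=> [|_]; [exact: (congr1 fst b3) | exact: (congr1 snd b3)].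
apply: (tr_for _ _ _ (env_A e2) AN) => //.
move=> a m3 lt_a f3 xa3 [Dm3 b3].
have e3 : env t x0 m3 by apply: env_frame f3 e2.
have y3 : nmem m3 xy [::] = val y by case: f3 => -> //; case: f2 => ->.
have h3 : nmem m3 xt [::] = h by case: f3 => -> //; case: f2 => ->.
have s3 : nmem m3 xs [::] = val x by case: f3 => -> //; case: f2 => ->.
apply: (tr_seq (Q1 := fun m4 => rmem m4 rsum [::] = 0)); first exact: tr_rset.
move=> m4 f4 z4.
have e4 : env t x0 m4 by apply: env_frame f4 e3.
apply: (tr_seq (Q1 := fun m5 => rmem m5 rsum [::] = q a)).
  apply: tr_mono.
    apply: (tr_sum O (j := [::]) (g := fun x' => P x (Ordinal lt_a) x' * reach y h x') _ (env_S e4) SN) => //.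
    move=> m5 x' f5 z5 _.
    have e5 : env t x0 m5 by apply: env_frame f5 e4.
    have s5 : nmem m5 xs [::] = val x by case: f5 => -> //; case: f4 => ->.
    have a5 : nmem m5 xa [::] = val (Ordinal lt_a) by case: f5 => -> //; case: f4 => ->.
    have y5 : nmem m5 xy [::] = val y by case: f5 => -> //; case: f4 => ->.
    have h5 : nmem m5 xt [::] = h by case: f5 => -> //; case: f4 => ->.
    have v5 : rmem m5 rV [:: val y; h; val x'] = reach y h x'.
      case: f5 => _ -> //; case: f4 => _ -> //.
      by have [] := Dm3 y h x' (Dh x').
    by rewrite /= s5 a5 y5 h5 z5 (env_P e5) v5.
  by move=> m5 _ [-> _]; rewrite z4 add0r /q load_nat.
move=> m5 f5 q5.
have e5 : env t x0 m5 by apply: env_frame f5 e4.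
have s5 : nmem m5 xs [::] = val x by case: f5 => -> //; case: f4 => ->.
have a5 : nmem m5 xa [::] = a by case: f5 => -> //; case: f4 => ->.
have y5 : nmem m5 xy [::] = val y by case: f5 => -> //; case: f4 => ->.
have h5 : nmem m5 xt [::] = h by case: f5 => -> //; case: f4 => ->.
have V5 : rmem m5 rV = rmem m3 rV by case: f5 => _ -> //; case: f4 => _ ->.
have A5 : nmem m5 aact = nmem m3 aact by case: f5 => -> //; case: f4 => ->.
have Dm5 : reach_cells D m5.
  by move=> y' h' x' Dd; rewrite /reach_cell V5 A5; apply: Dm3.
apply: tr_if; rewrite [beval _ _]/= y5 h5 s5 addn1 -/c V5 q5 /I best_argS -b3 /best_step.
case: ifP => le_q; last first.
  by apply: tr_skip; rewrite V5 A5; split.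
apply: (tr_seq (Q1 := fun m6 => [/\ reach_cells D m6, rmem m6 rV c = q a & nmem m6 xa [::] = a])).
  apply: tr_rset; rewrite /= y5 h5 s5 addn1 -/c !eqxx q5 /=; split=> //.
  by move=> y' h' x' Dd; rewrite /reach_cell /= Dc //; apply: Dm5.
move=> m6 f6 [Dm6 v6 a6]; apply: tr_nset.
have s6 : nmem m6 xs [::] = val x by case: f6 => ->.
have y6 : nmem m6 xy [::] = val y by case: f6 => ->.
have h6 : nmem m6 xt [::] = h by case: f6 => ->.
rewrite /= s6 y6 h6 a6 addn1 -/c !eqxx v6 /=; split=> //.
by move=> y' h' x' Dd; rewrite /reach_cell /= Dc //; apply: Dm6.
Qed.

Lemma tr_reach t x0 m : env t x0 m ->
  tr reach_cmd m (reach_cells (fun _ h _ => (h <= T)%N)).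
Proof.
move=> e.
pose I k := reach_cells (fun y h _ => (y < k)%N && (h <= T)%N).
apply: (tr_mono (Q := I nS)); last first.
  by move=> m' _ Im y h x hT; apply: Im; rewrite ltn_ord.
apply: (tr_for _ _ _ (env_S e) SN) => //.
move=> i m1 lt_i f1 y1 I1; pose y := Ordinal lt_i.
have e1 : env t x0 m1 by apply: env_frame f1 e.
pose I' k := reach_cells (fun y' h _ => ((y' < i) && (h <= T) || (y' == y) && (h <= k))%N).
apply: (tr_seq (Q1 := I' 0%N)).
  apply: tr_mono.
    apply: (tr_fill O (J := fun x : 'I_nS => [:: val y; 0%N; val x]) (g := reach y 0) _ (env_S e1) SN) => //.
    - by move=> x x' [/val_inj].
    - by move=> m2 x [fn _] s2; rewrite /= s2 fn // y1.
    move=> m2 x [fn _] s2 _; rewrite /= s2 fn // y1; congr (_%:R).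
    have -> : (x == y) = (val x == i) by [].
    by case: (ltngtP (val x) i) => /= lt_x; rewrite ?lt_x ?subnn //=; lia.
  move=> m2 f2 [v2 o2] y' h x /orP[/andP[lt_y hT]|/andP[/eqP -> ]]; last first.
    by rewrite leqn0 => /eqP ->; split.
  have [V1 A1] := I1 y' h x (introT andP (conj lt_y hT)).
  split; last by case: f2 => -> //; apply: A1.
  by rewrite o2 ?V1 // => x'; rewrite eqseq_cons ltn_eqF.
move=> m2 f2 I2.
have e2 : env t x0 m2 by apply: env_frame f2 e1.
have y2 : nmem m2 xy [::] = val y by case: f2 => ->.
apply: (tr_mono (Q := I' T)); last first.
  move=> m' _ Im y' h x /andP[lt_y hT]; apply: Im; rewrite hT !andbT.
  move: lt_y; rewrite ltnS leq_eqVlt orbC => /orP[->//|/eqP yi].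
  have -> : y' = y by apply: val_inj.
  by rewrite eqxx orbT.
apply: (tr_for _ _ _ (env_T e2) TN) => //.
move=> h m3 lt_h f3 h3 I3.
have e3 : env t x0 m3 by apply: env_frame f3 e2.
have y3 : nmem m3 xy [::] = val y by case: f3 => ->.
pose I'' k := reach_cells (fun y' h' x => ((y' < i) && (h' <= T) ||
   (y' == y) && ((h' <= h) || (h' == h.+1) && (x < k)))%N).
apply: (tr_mono (Q := I'' nS)); last first.
  move=> m' _ Im y' h' x /orP[/andP[ly hT]|/andP[ey hh]]; apply: Im; first by rewrite ly hT.
  by rewrite ey ltn_ord andbT; move: hh; rewrite leq_eqVlt orbC ltnS => ->; rewrite orbT.
have I3' : I'' 0%N m3.
  move=> y' h' x /orP[/andP[lt_y hT]|]; first by apply: I3; rewrite lt_y hT.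
  by rewrite andbF orbF => D'; apply: I3; rewrite D' orbT.
apply: (tr_for _ _ _ (env_S e3) SN) => //.
move=> k m4 lt_k f4 x4 I4.
have e4 : env t x0 m4 by apply: env_frame f4 e3.
have y4 : nmem m4 xy [::] = val y by case: f4 => ->.
have h4 : nmem m4 xt [::] = h by case: f4 => ->.
apply: tr_mono (tr_reach_cell (x := Ordinal lt_k) e4 y4 h4 x4 _ _ I4) _.
- by move=> x'; rewrite eqxx leqnn orbT.
- by rewrite /= !ltnn eqxx /= andbF.
move=> m' _ [Im c'] y' h' x /orP[D'|/andP[/eqP ->]]; first by apply: Im; rewrite D'.
case/orP=> [hh|/andP[/eqP ->]]; first by apply: Im; rewrite eqxx hh !orbT.
rewrite ltnS leq_eqVlt => /orP[/eqP xk|lt_x].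
  by have -> : x = Ordinal lt_k by apply: val_inj.
by apply: Im; rewrite !eqxx lt_x !orbT.
Qed.

Lemma tr_worst t x0 m h : env t x0 m -> nmem m xt [::] = h -> (h < T)%N ->
  reach_cells (fun _ h _ => (h <= T)%N) m ->
  tr worst_cmd m (fun m' => rmem m' rworst [::] = worst P h.+1).
Proof.
move=> e hm hT Dm.
apply: (tr_seq (Q1 := fun m1 => rmem m1 rworst [::] = 1)); first exact: tr_rset.
move=> m1 f1 w1.
have e1 : env t x0 m1 by apply: env_frame f1 e.
pose I (D : 'I_nS -> 'I_nS -> bool) (m : mem) :=
  [/\ rmem m rworst [::] <= 1, worst P h.+1 <= rmem m rworst [::] &
     forall y x, D y x -> rmem m rworst [::] <= reach y h.+1 x].
apply: (tr_mono (Q := I (fun y x => (y < nS)%N))); last first.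
  move=> m' _ [w' le_w lew]; apply/le_anti; rewrite le_w andbT.
  by apply: le_worst => // y x; apply: lew.
apply: (tr_for (I := fun k => I (fun y x => (y < k)%N)) _ _ _ (env_S e1) SN) => //.
  by rewrite /I w1; split=> //; apply: worst_le1.
move=> i m2 lt_i f2 y2 I2.
have e2 : env t x0 m2 by apply: env_frame f2 e1.
pose D k (y x : 'I_nS) := (y < i)%N || (val y == i) && (x < k)%N.
apply: (tr_mono (Q := I (D nS))); last first.
  move=> m' _ [w' le_w lew]; split=> // y x; rewrite ltnS leq_eqVlt orbC => Dy.
  by apply: lew; rewrite /D ltn_ord andbT.
apply: (tr_for (I := fun k => I (D k)) _ _ _ (env_S e2) SN) => //.
  case: I2 => w' le_w lew; split=> // y x.
  by rewrite /D andbF orbF; apply: lew.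
move=> k m3 lt_k f3 x3 [w3 le_w3 lew3].
have y3 : nmem m3 xy [::] = val (Ordinal lt_i) by case: f3 => ->.
have h3 : nmem m3 xt [::] = h.
  by case: f3 => -> //; case: f2 => -> //; case: f1 => ->.
have v3 : rmem m3 rV [:: val (Ordinal lt_i); h.+1; val (Ordinal lt_k)] = reach (Ordinal lt_i) h.+1 (Ordinal lt_k).
  case: f3 => _ -> //; case: f2 => _ -> //; case: f1 => _ -> //.
  by have [] := Dm (Ordinal lt_i) h.+1 (Ordinal lt_k) hT.
have DS y x : D k.+1 y x -> D k y x \/ (y = Ordinal lt_i /\ x = Ordinal lt_k).
  case/orP=> [lt_y|/andP[/eqP yi]]; first by left; rewrite /D lt_y.
  rewrite ltnS leq_eqVlt => /orP[/eqP xk|lt_x]; [right|left].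
    by split; apply: val_inj.
  by rewrite /D yi eqxx lt_x orbT.
apply: tr_if; rewrite [beval _ _]/= y3 h3 x3 addn1 v3.
case: ifPn => [le_r|]; last first.
  rewrite -ltNge => lt_r; apply: tr_skip; split=> // y x /DS[/lew3//|[-> ->]].
  exact: ltW.
apply: tr_rset; rewrite /I /= y3 h3 x3 addn1 v3; split.
- exact: le_trans w3.
- exact: worst_le.
by move=> y x /DS[/lew3 |[-> -> //]]; apply: le_trans.
Qed.

Lemma tr_length t x0 m : env t x0 m ->
  reach_cells (fun _ h _ => (h <= T)%N) m ->
  tr length_cmd m (fun m' => rmem m' rtheta [::] = (best_length P T).1 /\
    nmem m' vH [::] = (best_length P T).2).
Proof.
move=> e Dm.
apply: (tr_seq (Q1 := fun m1 => rmem m1 rtheta [::] = 0)); first exact: tr_rset.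
move=> m1 f1 t1.
apply: (tr_seq (Q1 := fun m1 => nmem m1 vH [::] = 1%N)); first exact: tr_nset.
move=> m2 f2 H2.
have e1 : env t x0 m1 by apply: env_frame f1 e.
have e2 : env t x0 m2 by apply: env_frame f2 e1.
pose I k (m : mem) := rmem m rtheta [::] = (best_length P k).1 /\
    nmem m vH [::] = (best_length P k).2.
apply: (tr_for (I := I) _ _ _ (env_T e2) TN) => //.
  by split=> //; case: f2 => _ ->.
move=> h m3 lt_h f3 h3 [t3 H3].
have e3 : env t x0 m3 by apply: env_frame f3 e2.
have Dm3 : reach_cells (fun _ h _ => (h <= T)%N) m3.
  move=> y h' x hT; have := Dm y h' x hT.
  by case: f3 => fn3 fr3; case: f2 => fn2 fr2; case: f1 => fn1 fr1;
     rewrite /reach_cell fn3 // fr3 // fn2 // fr2 // fn1 // fr1.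
apply: (tr_seq (tr_worst e3 h3 lt_h Dm3)) => m4 f4 w4.
have t4 : rmem m4 rtheta [::] = (best_length P h).1 by case: f4 => _ ->.
have H4 : nmem m4 vH [::] = (best_length P h).2 by case: f4 => ->.
have h4 : nmem m4 xt [::] = h by case: f4 => ->.
apply: tr_if; rewrite [beval _ _]/= t4 H4 h4 w4 addn1 /I best_lengthS /length_step.
case: ifP => _; first by apply: tr_skip.
apply: (tr_seq (Q1 := fun m5 => rmem m5 rtheta [::] = worst P h.+1)).
  by apply: tr_rset; rewrite /= w4.
move=> m5 f5 t5; apply: tr_nset => /=; split=> //.
by case: f5 => -> //; rewrite h4 addn1.
Qed.

End Steer.

(** * One round of the algorithm *)

Section Round.
Variables (R : realType) (nS nA : nat) (P : 'I_nS -> 'I_nA -> 'I_nS -> R).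
Hypothesis PD : forall s a, is_dist (P s a).
Variable d1 : 'I_nS -> R.
Hypothesis d1D : is_dist d1.
Variable ls : seq (loss R nS nA).
Variable O : seq (loss R nS nA) -> {ffun 'I_nS -> 'I_nA}.
Variable N : nat.
Let T := size ls.
Hypotheses (SN : (nS <= N)%N) (AN : (nA <= N)%N) (TN : (T <= N)%N).
Hypotheses (nS_gt1 : (1 < nS)%N) (nA_gt0 : (0 < nA)%N).

Local Notation mem := (Defs.mem R).
Local Notation tr := (tr O N).
Local Notation hup := (hup O N).
Local Notation env := (env P d1 ls).
Local Notation ell := (ell ls).
Local Notation reach := (reach P).

Definition first_action : 'I_nA := Ordinal nA_gt0.
Definition first_state : 'I_nS := Ordinal (ltnW nS_gt1).

Local Notation a0 := first_action.
Local Notation s0 := first_state.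
Local Notation theta := (best_length P T).1.
Local Notation H := (best_length P T).2.

Fixpoint scale_at t :=
  next_scale P d1 ls O t (if t is t'.+1 then scale_at t' else 0%N).

Definition prev_scale t := if t is t'.+1 then scale_at t' else 0%N.

Lemma scale_atE t : scale_at t = next_scale P d1 ls O t (prev_scale t).
Proof. by case: t. Qed.

Definition pol g t := leader d1 ls O t (scale_at t) g.

Definition config_of (m : mem) : config R nS :=
  if nmem m vunc [::] == 0%N then None
  else Some (nmem m vph [::], insubd s0 (nmem m vtgt [::]), rmem m racc [::]).

Definition valid (m : mem) : Prop :=
  (nmem m vtgt [::] < nS)%N /\ (nmem m vunc [::] != 0%N -> (nmem m vph [::] <= T)%N).

(** Holds between launch and action: a steering action exists only with a positive number of rounds
    left. *)
Definition chasing (m : mem) : Prop :=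
  (nmem m vtgt [::] < nS)%N /\
  (nmem m vunc [::] != 0%N -> (0 < nmem m vph [::] <= T)%N).

(* The memory with which a round is entered. *)
Record rep t x g m : Prop := Rep {
  rep_env : env t x m;
  rep_G : forall s a : nat, nmem m aG [:: s; a] = g [:: s; a];
  rep_scale : nmem m vscale [::] = prev_scale t;
  rep_cur : forall s : 'I_nS, nmem m acur [:: val s] = prev_pol a0 (pol g) t s;
  rep_valid : valid m }.

(* The memory of a round once the policy and the steering tables are computed. *)
Record mid t x g m : Prop := Mid {
  mid_env : env t x m;
  mid_G : forall s a : nat, nmem m aG [:: s; a] = g [:: s; a];
  mid_scale : nmem m vscale [::] = scale_at t;
  mid_cur : forall s : 'I_nS, nmem m acur [:: val s] = pol g t s;
  mid_cells : reach_cells P (fun _ h _ => (h <= T)%N) m;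
  mid_theta : rmem m rtheta [::] = theta;
  mid_H : nmem m vH [::] = H }.

Lemma mid_frame c t x g m m' : readonly c ->
  all (fun y => y \notin wn c) [:: aG; vscale; acur; aact; vH] ->
  all (fun y => y \notin wr c) [:: rV; rtheta] ->
  frame c m m' -> mid t x g m -> mid t x g m'.
Proof.
move=> ro /allP rn /allP rr f [e G s c' cl th h].
have [fn fr] := f; split.
- exact: env_frame f e.
- by move=> s' a; rewrite fn ?rn.
- by rewrite fn ?rn.
- by move=> s'; rewrite fn ?rn.
- by move=> y k z D; have := cl y k z D; rewrite /reach_cell fn ?fr ?rn ?rr.
- by rewrite fr ?rr.
- by rewrite fn ?rn.
Qed.

Section Values.
Variables (g : seq nat -> nat) (v : nat -> 'I_nS -> config R nS -> R) (t : nat) (x : 'I_nS).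

Let flw := follow P ell (pol g) v t x.
Let chs h y q := chase PD a0 ell v t x h y q.
Let lnc := launch PD a0 d1 ell H theta (pol g) v t x.

(** This and the next three definitions are the values just before acceptance, launch and action and
    at the end of the round: the successive potentials that unfold [round_value]. *)
Definition accept_value m :=
  if nmem m vunc [::] == 0%N then flw
  else if nmem m vph [::] == 0%N then
    let p := if x == insubd s0 (nmem m vtgt [::]) then clip (rmem m racc [::]) else 0 in
    p * flw + (1 - p) * lnc
  else chs (nmem m vph [::]) (insubd s0 (nmem m vtgt [::])) (rmem m racc [::]).

Definition launch_value m :=
  if nmem m vunc [::] == 0%N then flw
  else if nmem m vph [::] == 0%N then lnc
  else chs (nmem m vph [::]) (insubd s0 (nmem m vtgt [::])) (rmem m racc [::]).

Definition act_value m :=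
  if nmem m vunc [::] == 0%N then flw
  else chs (nmem m vph [::]) (insubd s0 (nmem m vtgt [::])) (rmem m racc [::]).

Definition end_value m :=
  move P ell v t x (insubd a0 (nmem m action [::])) (config_of m).

Lemma insubd_val n (u0 : 'I_n) k : (k < n)%N -> val (insubd u0 k) = k.
Proof. by move=> lt_k; rewrite val_insubd lt_k. Qed.

Lemma hup_accept m : mid t x g m -> valid m ->
  hup accept_cmd m (fun m' => mid t x g m' /\ valid m') launch_value (accept_value m).
Proof.
move=> M V.
apply: (hup_mono (Q := valid) (F := launch_value) (v := accept_value m)) => //; last first.
  by move=> m' f V'; split=> //; split=> //; apply: mid_frame f M.
apply: hup_if; rewrite [beval _ _]/= lt0n leqn0 /accept_value.
have [u0|u0] := eqVneq (nmem m vunc [::]) 0%N.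
  by apply: hup_tr; apply: tr_skip; rewrite /launch_value u0.
have [p0|p0] := eqVneq (nmem m vph [::]) 0%N; last first.
  by apply: hup_tr; apply: tr_skip; rewrite /launch_value (negbTE u0) (negbTE p0).
have [tgN _] := V.
apply: (hup_seq
  (Q1 := fun m1 => (m1 = nset m vflip [::] 1 \/ m1 = nset m vflip [::] 0))
  (F1 := fun m1 => if nmem m1 vflip [::] == 1%N then flw else lnc)).
  apply: hup_if; rewrite [beval _ _]/= (env_x (mid_env M)) -eqn_leq.
  have -> : (x == insubd s0 (nmem m vtgt [::])) = (val x == nmem m vtgt [::]).
    by rewrite -(inj_eq val_inj) insubd_val.
  case: ifP => _; last first.
    by apply: hup_tr; apply: tr_nset; split; [right | rewrite /= mul0r add0r subr0 mul1r].
  by apply: hup_flip => /=; [left|right|].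
move=> m1 _ m1E; apply: hup_tr; apply: tr_if.
case: m1E => ->; rewrite [beval _ _]/=.
  by apply: tr_nset; rewrite /launch_value.
apply: tr_skip; rewrite /launch_value /= (negbTE u0) p0 /=; split=> //.
Qed.

Lemma hup_launch m : (t < T)%N -> mid t x g m -> valid m ->
  hup launch_cmd m (fun m' => mid t x g m' /\ chasing m') act_value (launch_value m).
Proof.
move=> tT M V.
have [/andP[H0 HT] _ _ _] := best_lengthP PD a0 T.
have {}HT : (H <= T)%N by apply: leq_trans HT _; rewrite geq_max (leq_ltn_trans _ tT) // leqnn.
apply: (hup_mono (Q := chasing) (F := act_value) (v := launch_value m)) => //; last first.
  by move=> m' f V'; split=> //; split=> //; apply: mid_frame f M.
apply: hup_if; rewrite [beval _ _]/= lt0n leqn0 /launch_value.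
have [u0|u0] := eqVneq (nmem m vunc [::]) 0%N.
  by apply: hup_tr; apply: tr_skip; rewrite /act_value /chasing u0; case: V.
have [p0|p0] := eqVneq (nmem m vph [::]) 0%N; last first.
  have [tgN hT] := V.
  apply: hup_tr; apply: tr_skip; rewrite /act_value (negbTE u0); split=> //.
  by split=> // _; rewrite lt0n p0 hT.
pose f := pol g t.
apply: (hup_seq (Q1 := fun m1 => nmem m1 vtau [::] = (t + H)%N) (F1 := fun=> lnc)).
  by apply: hup_tr; apply: tr_nset; rewrite /= (env_t (mid_env M)) (mid_H M).
move=> m1 f1 t1.
have M1 : mid t x g m1 by apply: mid_frame f1 M.
apply: (hup_seq (Q1 := fun m2 => forall s : 'I_nS, rmem m2 rvec [:: val s] = occ P d1 f (t + H) s)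
   (F1 := fun=> lnc)).
  apply: hup_tr; apply: tr_mono (tr_forward O SN TN (mid_env M1) _ t1 _ (mid_cur M1)) _ => //.
    (* [t + H <= 2 * T <= nS * T], within the loop bound of [forward_cmd]. *)
    apply: leq_trans (_ : 2 * T <= _)%N; last by rewrite leq_mul2r nS_gt1 orbT.
    by rewrite mul2n -addnn leq_add // ltnW.
  by move=> m2 _ [].
move=> m2 f2 v2.
have M2 : mid t x g m2 by apply: mid_frame f2 M1.
pose C k := chs H (insubd s0 k) (theta / reach (insubd s0 k) H x).
apply: (hup_seq (Q1 := fun m3 => (nmem m3 vtgt [::] < nS)%N)
   (F1 := fun m3 => C (nmem m3 vtgt [::]))).
  apply: hup_mono (hup_draw O SN nS_gt1 C (mid_env M2) (occ_dist PD f (t + H) d1D) v2) _ _ => //.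
  by rewrite /lnc /launch; apply: ler_sum => y _; rewrite /C valKd.
move=> m3 f3 tg3.
have M3 : mid t x g m3 by apply: mid_frame f3 M2.
have u3 : nmem m3 vunc [::] = nmem m vunc [::].
  by case: f3 => -> //; case: f2 => -> //; case: f1 => ->.
apply: hup_tr.
apply: (tr_seq (Q1 := fun m4 => rmem m4 racc [::] = theta / reach (insubd s0 (nmem m3 vtgt [::])) H x)).
  apply: tr_rset; rewrite /= (mid_theta M3) (mid_H M3) (env_x (mid_env M3)).
  have [V3 _] := @mid_cells _ _ _ _ M3 (insubd s0 (nmem m3 vtgt [::])) H x HT.
  by rewrite (insubd_val s0 tg3) in V3; rewrite V3.
move=> m4 f4 a4; apply: tr_nset.
have H4 : nmem m4 vH [::] = H by case: f4 => -> // _; rewrite (mid_H M3).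
have tg4 : nmem m4 vtgt [::] = nmem m3 vtgt [::] by case: f4 => ->.
have u4 : nmem m4 vunc [::] = nmem m vunc [::] by case: f4 => ->.
rewrite /chasing /act_value /= H4 tg4 u4 (negbTE u0) a4; split=> //.
by split=> // _; rewrite H0 HT.
Qed.

Lemma tr_act m : mid t x g m -> chasing m ->
  tr act_cmd m (fun m' => [/\ mid t x g m', valid m',
    (nmem m' action [::] < nA)%N & end_value m' <= act_value m]).
Proof.
move=> M V.
apply: (tr_mono (Q := fun m' => [/\ valid m', (nmem m' action [::] < nA)%N & end_value m' <= act_value m])); last first.
  by move=> m' f [? ? ?]; split=> //; apply: mid_frame f M.
apply: tr_if; rewrite [beval _ _]/= lt0n /act_value.
have [u0|u0] := eqVneq (nmem m vunc [::]) 0%N.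
  apply: tr_nset; rewrite /end_value /valid /config_of /= (env_x (mid_env M)) (mid_cur M) u0.
  by rewrite eqxx /= valKd ltn_ord; have [tgN _] := V; split.
have [tgN /(_ u0) /andP[h0 hT]] := V.
set y := insubd s0 (nmem m vtgt [::]).
have yE : val y = nmem m vtgt [::] by rewrite insubd_val.
set h := nmem m vph [::] in h0 hT *.
have [_ /(_ h0) argE] := @mid_cells _ _ _ _ M y h x hT.
apply: (tr_seq (Q1 := fun m1 => nmem m1 action [::] = reach_act PD a0 y h x)).
  by apply: tr_nset; rewrite /= (env_x (mid_env M)) -yE argE.
move=> m1 [fn fr] a1; apply: tr_nset.
rewrite /valid /end_value /config_of /= a1 !fn // ltn_ord (negbTE u0) -/h -/y subn1; split=> //.
  by rewrite -yE ltn_ord; split=> // _; apply: leq_trans hT; apply: leq_pred.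
by rewrite /chs /chase valKd fr.
Qed.

(** After a switch the acceptance probability is 0, so the mixture reduces to the launch whatever
    the old target was. *)
Lemma round_value_accept m m' c : config_of m = c ->
  valid m ->
  (if pol g t != prev_pol a0 (pol g) t
   then [/\ nmem m' vunc [::] = 1%N, nmem m' vph [::] = 0%N & rmem m' racc [::] = 0]
   else [/\ nmem m' vunc [::] = nmem m vunc [::], nmem m' vph [::] = nmem m vph [::] &
      rmem m' racc [::] = rmem m racc [::]]) ->
  nmem m' vtgt [::] = nmem m vtgt [::] ->
  accept_value m' = round_value PD a0 d1 ell H theta (pol g) v t x c.
Proof.
move=> <- V; rewrite /round_value; case: ifP => _ [u' p' q'] tg'.
  rewrite /accept_value u' p' q' clip_id ?lexx ?ler01 // if_same.
  by rewrite mul0r add0r subr0 mul1r.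
rewrite /accept_value /config_of u' p' q' tg'.
by case: eqP => //= _; case: (nmem m vph [::]).
Qed.

Lemma hup_round m : (t < T)%N -> rep t x g m ->
  hup round_cmd m (fun m' => [/\ mid t x g m', valid m' & (nmem m' action [::] < nA)%N])
    end_value (round_value PD a0 d1 ell H theta (pol g) v t x (config_of m)).
Proof.
move=> tT [e G sc cu V].
set V0 := round_value _ _ _ _ _ _ _ _ _ _ _.
apply: (hup_seq (Q1 := fun m1 => nmem m1 vscale [::] = scale_at t) (F1 := fun=> V0)).
  apply: hup_tr; apply: tr_mono (tr_scale O SN AN TN nS_gt1 e sc) _ => m1 _ ->.
  by rewrite -scale_atE.
move=> m1 f1 s1.
have e1 : env t x m1 by apply: env_frame f1 e.
have G1 (s a : nat) : nmem m1 aG [:: s; a] = g [:: s; a] by case: f1 => ->.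
apply: (hup_seq (Q1 := fun m2 => forall s : 'I_nS, nmem m2 anew [:: val s] = pol g t s) (F1 := fun=> V0)).
  by apply: hup_tr; apply: tr_mono (tr_leader O SN AN TN e1 s1 G1) _ => m2 _ h.
move=> m2 f2 n2.
have e2 : env t x m2 by apply: env_frame f2 e1.
have c2 (s : 'I_nS) : nmem m2 acur [:: val s] = prev_pol a0 (pol g) t s.
  by case: f2 => -> //; case: f1 => ->.
pose chg (m' : mem) := if pol g t != prev_pol a0 (pol g) t
   then [/\ nmem m' vunc [::] = 1%N, nmem m' vph [::] = 0%N & rmem m' racc [::] = 0]
   else [/\ nmem m' vunc [::] = nmem m vunc [::], nmem m' vph [::] = nmem m vph [::] &
      rmem m' racc [::] = rmem m racc [::]].
apply: (hup_seq (Q1 := fun m3 => (forall s : 'I_nS, nmem m3 acur [:: val s] = pol g t s) /\ chg m3) (F1 := fun=> V0)).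
  apply: hup_tr; apply: tr_mono (tr_switch O SN e2 c2 n2) _ => m3 _ [c3 u3].
  split=> //; split=> //; move: u3; rewrite /chg.
  case: f2 => fn2 fr2; case: f1 => fn1 fr1.
  by rewrite !(fn2 vunc, fn2 vph, fr2 racc) // !(fn1 vunc, fn1 vph, fr1 racc).
move=> m3 f3 [c3 u3].
have e3 : env t x m3 by apply: env_frame f3 e2.
apply: (hup_seq (Q1 := reach_cells P (fun _ h _ => (h <= T)%N)) (F1 := fun=> V0)).
  by apply: hup_tr; apply: tr_mono (tr_reach O SN AN TN e3) _.
move=> m4 f4 r4.
have e4 : env t x m4 by apply: env_frame f4 e3.
apply: (hup_seq (Q1 := fun m5 => rmem m5 rtheta [::] = theta /\ nmem m5 vH [::] = H) (F1 := accept_value)).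
  apply: hup_tr; apply: tr_mono (tr_length O SN TN e4 r4) _ => m5 f5 h5; split=> //.
  rewrite (round_value_accept (m := m) (c := config_of m)) //.
    move: u3; rewrite /chg; case: f5 => fn5 fr5; case: f4 => fn4 fr4.
    by rewrite !(fn5 vunc, fn5 vph, fr5 racc) // !(fn4 vunc, fn4 vph, fr4 racc).
  by case: f5 => -> //; case: f4 => -> //; case: f3 => -> //; case: f2 => -> //; case: f1 => ->.
move=> m5 f5 [th5 H5].
have e5 : env t x m5 by apply: env_frame f5 e4.
have tg5 : nmem m5 vtgt [::] = nmem m vtgt [::].
  by case: f5 => -> //; case: f4 => -> //; case: f3 => -> //; case: f2 => -> //; case: f1 => ->.
have M5 : mid t x g m5.
  split=> //.
  - by move=> s a; case: f5 => -> //; case: f4 => -> //; case: f3 => -> //; case: f2 => ->.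
  - by case: f5 => -> //; case: f4 => -> //; case: f3 => -> //; case: f2 => ->.
  - by move=> s; case: f5 => -> //; case: f4 => ->.
  move=> y h z hT; have := r4 y h z hT.
  by case: f5 => fn5 fr5; rewrite /reach_cell fn5 // fr5.
have V5 : valid m5.
  have u5 : nmem m5 vunc [::] = nmem m3 vunc [::] by case: f5 => -> //; case: f4 => ->.
  have p5 : nmem m5 vph [::] = nmem m3 vph [::] by case: f5 => -> //; case: f4 => ->.
  have [tgN ph] := V; rewrite /valid u5 p5 tg5; split=> //; move: u3; rewrite /chg.
  by case: ifP => _ [-> -> _].
apply: (hup_seq (hup_accept M5 V5)) => m6 f6 [M6 V6].
apply: (hup_seq (hup_launch tT M6 V6)) => m7 f7 [M7 V7].
apply: hup_tr; apply: tr_mono (tr_act M7 V7) _ => m8 _ [M8 V8 a8 le8].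
by split.
Qed.

End Values.
End Round.

Section Mass.
Variables (R : realType) (nS nA : nat) (P : 'I_nS -> 'I_nA -> 'I_nS -> R).
Hypothesis PD : forall s a, is_dist (P s a).
Variable O : seq (loss R nS nA) -> {ffun 'I_nS -> 'I_nA}.

Lemma run_mass n K (m : Defs.mem R) : expect (run O n K m) (fun=> 1) = 1.
Proof.
elim: n K m => [|n IH] [|c K] m; rewrite /= ?expect_ret //.
case: c => [|x i e|x i e|c1 c2|b c1 c2|b c1|x i e|q e y]; rewrite ?IH //.
rewrite expect_bind !expect_cons expect_nil /= !IH; ring.
Qed.

(** Lets the loss of the current round be taken out of the expectation over the following ones. *)
Lemma play_mass n alg t l s (m : Defs.mem R) :
  expect (play P O n alg t l s m) (fun=> 1) = 1.
Proof.
elim: l t s m => [|l ls IH] t s m /=; first by rewrite expect_ret.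
rewrite expect_bind -[RHS](run_mass n [:: alg] m); apply: eq_expect => -[m'|]; last by rewrite expect_ret.
case: insub => [a|]; last by rewrite expect_ret.
rewrite expect_bind expect_draw -[RHS](PD s a).2; apply: eq_bigr => s' _.
rewrite expect_bind (eq_expect _ (g := fun=> 1)) ?IH ?mulr1 // => r.
by rewrite expect_ret.
Qed.

End Mass.

(** * From one round to the whole game *)

Section Game.
Variables (R : realType) (nS nA : nat) (P : 'I_nS -> 'I_nA -> 'I_nS -> R).
Hypothesis PD : forall s a, is_dist (P s a).
Variable d1 : 'I_nS -> R.
Hypothesis d1D : is_dist d1.
Variable ls : seq (loss R nS nA).
Variable O : seq (loss R nS nA) -> {ffun 'I_nS -> 'I_nA}.
Let T := size ls.
Hypotheses (nS_gt1 : (1 < nS)%N) (nA_gt0 : (0 < nA)%N).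
Let N := (nS + nA + T)%N.
Variable n : nat.
Hypothesis costn : (cost N algorithm <= n)%N.

Let SN : (nS <= N)%N. Proof. by rewrite /N -addnA leq_addr. Qed.
Let AN : (nA <= N)%N. Proof. by rewrite /N addnAC leq_addl. Qed.
Let TN : (T <= N)%N. Proof. by rewrite /N leq_addl. Qed.

Local Notation mem := (Defs.mem R).
Local Notation hup := (hup O N).
Local Notation a0 := (first_action nA_gt0).
Local Notation ell := (ell ls).
Local Notation theta := (best_length P T).1.
Local Notation H := (best_length P T).2.
Local Notation pol := (pol P d1 ls O).
Local Notation config_of := (config_of nS_gt1).
Local Notation valid := (valid ls).

Definition learner_value g := value PD a0 d1 ell H theta (pol g).

Let post t x (m : mem) :=
  [/\ mid P d1 ls O t x (nmem m aG) m, valid m & (nmem m action [::] < nA)%N].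

Let after r t x (m : mem) :=
  end_value P ls nS_gt1 nA_gt0 (learner_value (nmem m aG) r) t x m.

Lemma rep_reveal t x x' g m : (t < T)%N -> mid P d1 ls O t x g m -> valid m ->
  rep P d1 ls O nA_gt0 t.+1 x' g (reveal t (nth [ffun=> 0] ls t) x' m).
Proof.
move=> tT [[eS eA eT et ex eP ed el] G sc cu _ _ _] V; split=> //.
split=> // t' s a; rewrite /=.
rewrite /seen; have [->|ne] := eqVneq t' t.
  by rewrite ltnSn !load_ord.
by rewrite (el t' s a) /seen ltnS [(t' <= t)%N]leq_eqVlt (negbTE ne).
Qed.

Let somes (X : Type) (mu : fdist R (option X)) := allp (fun o => isSome o) mu.

Lemma play_step r t x m v : (r.+1 + t = T)%N ->
  hup algorithm m (post t x) (after r t x) v ->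
  (forall x' m', rep P d1 ls O nA_gt0 t.+1 x' (nmem m' aG) m' ->
     somes (play P O n algorithm t.+1 (drop t.+1 ls) x' m') /\
     expect (play P O n algorithm t.+1 (drop t.+1 ls) x' m') (odflt 0) <=
       learner_value (nmem m' aG) r t.+1 x' (config_of m')) ->
  somes (play P O n algorithm t (drop t ls) x m) /\
  expect (play P O n algorithm t (drop t ls) x m) (odflt 0) <= v.
Proof.
move=> rT hu IH; have tT : (t < T)%N by rewrite -rT addSn ltnS leq_addl.
have [mu [runE p a le]] := hup_run hu costn.
rewrite (drop_nth [ffun=> 0] tT) /= runE bindA.
set l := nth _ _ _; set K := fun om : option mem => _.
have step m' : post t x m' -> somes (K (Some m')) /\ expect (K (Some m')) (odflt 0) <= after r t x m'.
  move=> [M V a']; rewrite /K insubT.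
  set b := Sub _ _.
  have rp x' : rep P d1 ls O nA_gt0 t.+1 x' (nmem (reveal t l x' m') aG) (reveal t l x' m').
    exact: (rep_reveal x' tT M V).
  split.
    apply/allp_bind; rewrite /draw; elim: (enum _) => //= x' e IHe; split=> //.
    apply/allp_bind; have [sm _] := IH x' _ (rp x').
    by apply: allp_impl sm => -[y|] //= _; split.
  rewrite expect_bind expect_draw /after /end_value /move.
  have -> : insubd a0 (nmem m' action [::]) = b.
    by apply: val_inj; rewrite insubd_val.
  have -> : ell t x b = \sum_x' P x b x' * ell t x b.
    by rewrite -mulr_suml (PD x b).2 mul1r.
  rewrite -big_split /=; apply: ler_sum => x' _; rewrite -mulrDr.
  apply: ler_wpM2l; first by case: (PD x b).
  have [sm le'] := IH x' _ (rp x').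
  rewrite expect_bind.
  (* As all outcomes are [Some], adding the loss commutes with [odflt 0]; the factor 1 prepares for
     the total mass. *)
  apply: (@le_trans _ _ (expect (play P O n algorithm t.+1 (drop t.+1 ls) x' (reveal t l x' m'))
     (fun o => ell t x b * 1 + odflt 0 o))).
    rewrite le_eqVlt; apply/orP; left; apply/eqP.
    elim: (play _ _ _ _ _ _ _ _) sm => [|u rest IHr]; first by rewrite !expect_nil.
    move=> [us /IHr e]; rewrite !expect_cons e expect_nil addr0 mul1r.
    by case: u us {e} => w [y|] //= _; rewrite mulr1.
  by rewrite expectD expectZ play_mass // mulr1 lerD2l.
have muE f : expect (bind mu (fun m' => bind (ret R (Some m')) K)) f =
    expect mu (fun m' => expect (K (Some m')) f).
  by rewrite expect_bind; apply: eq_expect => m'; rewrite bind_ret.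
split.
  apply/allp_bind; apply: allp_impl a => m' /step[+ _].
  by rewrite bind_ret.
rewrite muE; apply: le_trans le; apply: expect_le => //.
by apply: allp_impl a => m' /step[].
Qed.

Lemma hup_later r t x m : (0 < t)%N -> (t < T)%N ->
  rep P d1 ls O nA_gt0 t x (nmem m aG) m ->
  hup algorithm m (post t x) (after r t x)
    (learner_value (nmem m aG) r.+1 t x (config_of m)).
Proof.
move=> t0 tT Rm.
apply: (hup_seq (Q1 := fun m1 => m1 = m)
   (F1 := fun=> learner_value (nmem m aG) r.+1 t x (config_of m))).
  apply: hup_tr; apply: tr_if; rewrite [beval _ _]/= (env_t (rep_env Rm)) leqNgt t0.
  exact: tr_skip.
move=> m1 _ ->.
have hr := hup_round PD d1D SN AN TN nS_gt1 (learner_value (nmem m aG) r) tT Rm.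
apply: hup_mono hr _ _ => // m' f [M V a].
have G : nmem m' aG = nmem m aG by case: f => ->.
by rewrite /post /after G.
Qed.

(** Round 0 draws the noise, so its bound averages over [g]. Later rounds leave the array [aG] alone
    and are treated for a fixed [g]. *)
Lemma hup_first r x m : (0 < T)%N -> rep P d1 ls O nA_gt0 0 x (nmem m aG) m ->
  config_of m = None ->
  hup algorithm m (post 0 x) (after r 0 x)
    (prodE (nS * T)%:R^-1 (nS * T * (T * nS * nA)) (coords nS nA) (nmem m aG)
      (fun g => learner_value g r.+1 0 x None)).
Proof.
move=> T0 Rm cm.
apply: (hup_seq (Q1 := fun m1 => rep P d1 ls O nA_gt0 0 x (nmem m1 aG) m1 /\ config_of m1 = None)
   (F1 := fun m1 => learner_value (nmem m1 aG) r.+1 0 x None)).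
  apply: hup_if; rewrite [beval _ _]/= (env_t (rep_env Rm)) leqnn.
  have hs := hup_sample O SN AN TN nS_gt1 T0 (fun g => learner_value g r.+1 0 x None) (rep_env Rm).
  apply: hup_mono hs _ (lexx _).
  move=> m1 f1 _; split=> //; have [fn fr] := f1; case: Rm => e _ sc cu V; split.
    split=> //.
    - exact: env_frame f1 e.
    - by rewrite fn.
    - by move=> s; rewrite fn.
    by rewrite /valid !fn.
  by move: cm; rewrite /config_of !fn // fr.
move=> m1 _ [R1 c1]; rewrite -c1.
have hr := hup_round PD d1D SN AN TN nS_gt1 (learner_value (nmem m1 aG) r) T0 R1.
apply: hup_mono hr _ _ => // m' f [M V a].
have G : nmem m' aG = nmem m1 aG by case: f => ->.
by rewrite /post /after G.
Qed.

Lemma play_later r t x m : (0 < t)%N -> (r + t = T)%N ->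
  rep P d1 ls O nA_gt0 t x (nmem m aG) m ->
  somes (play P O n algorithm t (drop t ls) x m) /\
  expect (play P O n algorithm t (drop t ls) x m) (odflt 0) <=
    learner_value (nmem m aG) r t x (config_of m).
Proof.
elim: r t x m => [|r IH] t x m t0 rT Rm.
  rewrite add0n in rT; rewrite rT /T drop_size /= expect_ret /=.
  by split; [split | apply: lexx].
have tT : (t < T)%N by rewrite -rT addSn ltnS leq_addl.
apply: (play_step rT (hup_later r t0 tT Rm)) => x' m' Rm'.
by apply: IH => //; rewrite addnS -addSn.
Qed.

Lemma init_G x : nmem (init_mem P d1 T x) aG = fun=> 0%N.
Proof. by apply/funext => -[]. Qed.

(** A zeroed memory reads as the default policy, coupled with it: in round 0 every policy has the
    law [d1]. *)
Lemma rep_init x : rep P d1 ls O nA_gt0 0 x (nmem (init_mem P d1 T x) aG)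
  (init_mem P d1 T x).
Proof.
rewrite init_G; split=> //; last 2 first.
- by move=> s; rewrite ffunE.
- by split=> //=; apply: ltnW.
by split=> //= [s a s'|s]; rewrite !load_ord.
Qed.

Lemma ell01 : losses01 ls -> forall t s a, 0 <= ell t s a <= 1.
Proof.
move=> l01 t s a; rewrite /ell; have [lt_t|le_t] := ltnP t T.
  by apply: l01; apply: mem_nth.
by rewrite nth_default // ffunE lexx ler01.
Qed.

Lemma game_value : (0 < T)%N ->
  completes P d1 O n algorithm ls /\
  expect (game P d1 O n algorithm ls) (odflt 0) <=
  prodE (nS * T)%:R^-1 (nS * T * (T * nS * nA)) (coords nS nA) (fun=> 0%N)
    (fun g => \sum_s d1 s * learner_value g T 0 s None).
Proof.
move=> T0; have TE : (T.-1.+1 + 0 = T)%N by rewrite addn0 prednK.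
have bound x := play_step TE (hup_first T.-1 T0 (rep_init x) (erefl : config_of (init_mem P d1 T x) = None))
   (fun x' m' Rm' => play_later (r := T.-1) (t := 1) (ltn0Sn 0) (etrans (addn1 _) (prednK T0)) Rm').
split.
  have : allp (fun o => isSome o) (game P d1 O n algorithm ls).
    apply/allp_bind; rewrite /draw; elim: (enum _) => //= x e IHe; split=> //.
    by have [] := bound x; rewrite drop0.
  rewrite /completes; elim: (game _ _ _ _ _ _) => //= u rest IH [-> /IH ->].
  by rewrite implybT.
rewrite /game expect_bind expect_draw prodE_sum; apply: ler_sum => x _.
rewrite prodEZ; apply: ler_wpM2l; first by case: d1D.
by have [_] := bound x; rewrite drop0 prednK // init_G.
Qed.

Lemma game_le_horizon : (0 < T)%N -> losses01 ls ->
  expect (game P d1 O n algorithm ls) (odflt 0) <= T%:R.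
Proof.
move=> T0 l01; have [_] := game_value T0; move/le_trans; apply.
rewrite -[leRHS](prodE_cst (nS * T)%:R^-1 (nS * T * (T * nS * nA)) (coords nS nA) (fun=> 0%N)).
apply: prodE_le => // [|g _].
  rewrite invr_gt0 ltr0n muln_gt0 T0 (ltnW nS_gt1) /= invf_le1 ?ltr0n ?ler1n muln_gt0 T0 ltnW //.
apply: dist_avg_le => // x; apply: value_le => // t s a.
by apply: ell01.
Qed.

End Game.

(** * Regret *)

Section Regret.
Variables (R : realType) (nS nA : nat) (P : 'I_nS -> 'I_nA -> 'I_nS -> R).
Hypothesis PD : forall s a, is_dist (P s a).
Variable d1 : 'I_nS -> R.
Hypotheses (d1D : is_dist d1) (d1_gt0 : forall s, 0 < d1 s).
Variable ls : seq (loss R nS nA).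
Hypothesis l01 : losses01 ls.
Variable O : seq (loss R nS nA) -> {ffun 'I_nS -> 'I_nA}.
Hypothesis oracle : is_oracle P d1 O.
Let T := size ls.
Hypotheses (nS_gt1 : (1 < nS)%N) (nA_gt0 : (0 < nA)%N) (T_gt0 : (0 < T)%N).

Local Notation policy := {ffun 'I_nS -> 'I_nA}.
Local Notation ell := (ell ls).
Local Notation seen := (seen ls).
Local Notation capN := (nS * T * (T * nS * nA))%N.

Let h t (f : policy) := mean_loss P d1 ell f t.
Let L t f := \sum_(j < t) h j f.
Let h01 t f : 0 <= h t f <= 1. Proof. exact: (mean_loss01 PD d1D (ell01 l01)). Qed.
Let nS_gt0 : (0 < nS)%N. Proof. exact: ltnW. Qed.
Let T0 : 0 < T%:R :> R. Proof. by rewrite ltr0n. Qed.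

Lemma seen01 t t' s a : 0 <= seen t t' s a <= 1.
Proof. by rewrite /seen; case: ifP => _; rewrite ?ell01 // lexx ler01. Qed.

Lemma sum_seen t f : (t <= T)%N ->
  \sum_(j < T) \sum_s occ P d1 f j s * seen t j s (f s) = L t f.
Proof.
move=> tT; rewrite /L (big_ord_widen T (fun j => h j f) tT) [RHS]big_mkcond.
apply: eq_bigr => j _; rewrite /seen; case: ifP => // _.
by rewrite big1 // => s _; rewrite mulr0.
Qed.

Lemma policy_loss_past t f : (t <= T)%N ->
  policy_loss P d1 (det R f) (past_seq ls t) = L t f.
Proof.
move=> tT; rewrite policy_loss_sum // size_mkseq -sum_seen //.
apply: eq_bigr => j _; apply: eq_bigr => s _.
by rewrite nth_mkseq // ffunE.
Qed.

Lemma past_best_opt t f : (t <= T)%N -> L t (past_best ls O t) <= L t f.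
Proof.
move=> tT; rewrite -!policy_loss_past //; apply: oracle => l /mapP[t' _ ->] [s a].
by rewrite ffunE; apply: seen01.
Qed.

Lemma best_past_lossE t : (t <= T)%N ->
  best_past_loss P d1 ls O t = L t (past_best ls O t).
Proof. exact: sum_seen. Qed.

Lemma best_past_loss_min t f : (t <= T)%N -> best_past_loss P d1 ls O t <= L t f.
Proof. by move=> tT; rewrite best_past_lossE // past_best_opt. Qed.

Let LS t f : L t.+1 f = L t f + h t f.
Proof. by rewrite /L big_ord_recr. Qed.

Lemma best_past_lossS t : (t < T)%N ->
  best_past_loss P d1 ls O t <= best_past_loss P d1 ls O t.+1 <=
  best_past_loss P d1 ls O t + 1.
Proof.
move=> tT; apply/andP; split.
  apply: le_trans (best_past_loss_min (past_best ls O t.+1) (ltnW tT)) _.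
  by rewrite best_past_lossE // LS lerDl; case/andP: (h01 t (past_best ls O t.+1)).
apply: le_trans (best_past_loss_min (past_best ls O t) tT) _.
by rewrite LS [X in _ <= X + 1]best_past_lossE 1?ltnW // lerD2l; case/andP: (h01 t (past_best ls O t)).
Qed.

Let B : R := nS%:R ^+ 2 * (lgSA nS nA)%:R.
Let nn t := (scale_at P d1 ls O t + 2)%N.

Let S2 : 2 <= nS%:R :> R. Proof. by rewrite ler_nat. Qed.

Let lg_gt0 : (0 < lgSA nS nA)%N.
Proof. by rewrite up_log_gt0 /=; apply: leq_trans nS_gt1 _; rewrite leq_pmulr. Qed.

Let B_ge4 : 4 <= B.
Proof.
have l1 : 1 <= (lgSA nS nA)%:R :> R by rewrite ler1n.
apply: le_trans (_ : nS%:R ^+ 2 <= _); first by rewrite expr2; move: S2; nra.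
by rewrite /B ler_peMr // exprn_ge0.
Qed.

Let next_scaleE t n : next_scale P d1 ls O t n =
  if best_past_loss P d1 ls O t <= (n + 2)%:R ^+ 2 * B then n else n.+1.
Proof. by rewrite /next_scale /B !expr2. Qed.

Lemma scale_steps t : nn t.+1 = nn t \/ nn t.+1 = (nn t).+1.
Proof. by rewrite /nn /= next_scaleE; case: ifP => _; [left|right]. Qed.

Lemma scale_start : nn 0 = 2.
Proof.
rewrite /nn /= next_scaleE best_past_lossE // /L big_ord0.
by rewrite mulr_ge0 ?exprn_ge0 // (le_trans _ B_ge4).
Qed.

(** The best loss grows by at most 1 in a round, whereas raising the scale by one raises the
    threshold by at least [B >= 4]; one increment per round keeps up. *)
Lemma scale_upper t : (t <= T)%N ->
  best_past_loss P d1 ls O t <= (nn t)%:R ^+ 2 * B.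
Proof.
elim: t => [|t IH] tT.
  rewrite scale_start best_past_lossE // /L big_ord0.
  by rewrite mulr_ge0 ?exprn_ge0 // (le_trans _ B_ge4).
have {}IH := IH (ltnW tT); have /andP[_ le1] := best_past_lossS tT.
rewrite /nn /= next_scaleE; case: ifPn => [//|_].
apply: le_trans le1 _; rewrite -/(nn t) addSn -/(nn t) -addn1 natrD.
set m : R := (nn t)%:R in IH *; have m0 : 0 <= m by [].
rewrite sqrrD expr1n mulr1 !mulrDl mul1r; move: B_ge4 IH => B4.
have : 0 <= m *+ 2 * B by rewrite mulr_ge0 ?mulrn_wge0 // (le_trans _ B4).
lra.
Qed.

(** The scale is raised only when its previous value was exceeded, and the best loss never
    decreases. This makes the scale of order [Num.sqrt (Lstar / B)]. *)
Lemma scale_lower t : (t <= T)%N ->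
  nn t = 2 \/ ((nn t)%:R - 1) ^+ 2 * B < best_past_loss P d1 ls O t.
Proof.
elim: t => [|t IH] tT; first by left; apply: scale_start.
have /andP[le1 _] := best_past_lossS tT.
rewrite /nn /= next_scaleE; case: ifPn => [_|].
  rewrite -/(nn t); case: (IH (ltnW tT)) => [|lt_n]; [by left | right].
  exact: lt_le_trans lt_n le1.
by rewrite -ltNge addSn -/(nn t) -[(nn t).+1]addn1 natrD addrK; right.
Qed.

Lemma noise_ge0 n g s a : (forall i, (g i <= capN)%N) -> 0 <= noise d1 ls n g s a.
Proof.
move=> gN; rewrite /noise divr_ge0 ?mulr_ge0 //; last exact: ltW.
by rewrite subr_ge0 -!natrM ler_nat.
Qed.

Lemma total_noise_gt0 n g : (forall i, (g i <= capN)%N) -> 0 < total_noise d1 ls n g.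
Proof.
move=> gN; rewrite /total_noise ltr_wpDr //; apply: sumr_ge0 => s _.
by apply: sumr_ge0 => a _; apply: noise_ge0.
Qed.

Lemma leader_seq01 t n g : (forall i, (g i <= capN)%N) ->
  losses01 (leader_seq d1 ls t n g).
Proof.
move=> gN l /mapP[t' _ ->] [s a]; rewrite ffunE /=.
have Z0 := total_noise_gt0 n gN; have n0 := noise_ge0 n s a gN.
have /andP[s0 s1] := seen01 t t' s a.
apply/andP; split; first by rewrite divr_ge0 ?(ltW Z0) // addr_ge0 // mulr_ge0.
rewrite ler_pdivrMr // mul1r /total_noise lerD //.
apply: (@le_trans _ _ (noise d1 ls n g s a)).
  by rewrite ler_piMl // lern1 leq_subr.
rewrite (bigD1 s) //= (bigD1 a) //= -addrA lerDl addr_ge0 //.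
  by apply: sumr_ge0 => a' _; apply: noise_ge0.
by apply: sumr_ge0 => s' _; apply: sumr_ge0 => a' _; apply: noise_ge0.
Qed.

(** Only the first loss is perturbed and its state has law [d1] under every policy, so the division
    by [d1 s] cancels. The normalisation is a common positive factor. *)
Lemma policy_loss_leader t n g f : (t <= T)%N ->
  policy_loss P d1 (det R f) (leader_seq d1 ls t n g) =
  (L t f + ((n + 2)%:R / T%:R) * (nS%:R * capN%:R - \sum_s (g (cell_of s (f s)))%:R)) /
  total_noise d1 ls n g.
Proof.
move=> tT; set Z := total_noise d1 ls n g.
rewrite policy_loss_sum // size_mkseq.
rewrite (eq_bigr (fun j : 'I_T => (\sum_s occ P d1 f j s * seen t j s (f s)) / Z +
   (\sum_s occ P d1 f j s * ((1 - j)%N%:R * noise d1 ls n g s (f s))) / Z)); last first.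
  move=> j _; rewrite -mulrDl -big_split /= mulr_suml; apply: eq_bigr => s _.
  by rewrite nth_mkseq // ffunE /= mulrA -mulrDr.
rewrite big_split /= -!mulr_suml sum_seen // -mulrDl; congr ((_ + _) / _).
pose F j := \sum_s occ P d1 f j s * ((1 - j)%N%:R * noise d1 ls n g s (f s)).
have first_only k : (0 < k)%N -> \sum_(j < k) F j = F 0%N.
  case: k => // k _; rewrite big_ord_recl big1 ?addr0 // => j _.
  by rewrite /F big1 // => s _; rewrite /bump /= subSS sub0n mul0r mulr0.
rewrite (first_only T T_gt0).
have -> : F 0%N = \sum_s d1 s * noise d1 ls n g s (f s).
  by apply: eq_bigr => s _; rewrite mul1r.
have -> : nS%:R * capN%:R = \sum_(s < nS) capN%:R :> R by rewrite sum_ord_cst.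
rewrite -sumrB mulr_sumr; apply: eq_bigr => s _.
rewrite /noise /cell_of -/T !natrM; field.
by rewrite !gt_eqF.
Qed.

Lemma leader_opt t g f : (t <= T)%N -> (forall i, (g i <= capN)%N) ->
  L t (pol P d1 ls O g t) - (nn t)%:R / T%:R * \sum_s (g (cell_of s (pol P d1 ls O g t s)))%:R <=
  L t f - (nn t)%:R / T%:R * \sum_s (g (cell_of s (f s)))%:R.
Proof.
move=> tT gN.
have Z0 := total_noise_gt0 (scale_at P d1 ls O t) gN.
have := oracle (@leader_seq01 t (scale_at P d1 ls O t) g gN) f.
rewrite !policy_loss_leader // ler_pM2r ?invr_gt0 // -/(nn t).
rewrite /pol /leader; set f' := O _; set c : R := (nn t)%:R / T%:R.
by rewrite !mulrBr; lra.
Qed.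

Lemma best_past_le_best : best_past_loss P d1 ls O T <= best_loss P d1 ls.
Proof.
apply: lb_le_inf.
  by exists (policy_loss P d1 (det R [ffun=> first_action nA_gt0]) ls); exists [ffun=> first_action nA_gt0].
move=> _ [f _ <-].
have -> : policy_loss P d1 (det R f) ls = L T f.
  by rewrite policy_loss_sum.
exact: best_past_loss_min.
Qed.

Local Notation theta := (best_length P T).1.
Local Notation H := (best_length P T).2.

(** The losses are fixed in advance, so the tracking bound holds for each [g] and can be averaged
    over the noise. *)
Lemma game_regret n : (cost (nS + nA + T) algorithm <= n)%N -> 0 < theta ->
  expect (game P d1 O n algorithm ls) (odflt 0) <=
  best_loss P d1 ls + 18 * (B * (nn T)%:R) + (1 + 16 * (B * (nn T)%:R)) * (H%:R / theta).
Proof.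
move=> costn th0.
have [_ le] := game_value PD d1D O nS_gt1 nA_gt0 costn T_gt0; apply: le_trans le _.
have [/andP[H0 _] _ thr _] := best_lengthP PD (first_action nA_gt0) T.
set W := H%:R / theta.
have W0 : 0 <= W by rewrite divr_ge0 // ltW.
set p : R := (nS * T)%:R^-1.
have p01 : 0 < p <= 1.
  have ST : (0 < nS * T)%N by rewrite muln_gt0 T_gt0 nS_gt0.
  by rewrite /p invr_gt0 ltr0n ST invf_le1 ?ltr0n // ler1n.
pose pi t g := pol P d1 ls O g t.
have [|bound1 bound2] := perturbed_leader (R := R) (lg := lgSA nS nA) nS_gt1 nA_gt0 T_gt0 (up_logP _ (ltnSn 1))
  (erefl capN) (coords_uniq nS nA) (@mem_coords nS nA) h01 scale_start scale_steps leader_opt (best := past_best ls O).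
  by move=> t tT; rewrite -[leLHS]/(L t _) -best_past_lossE //; apply: scale_upper.
apply: (@le_trans _ _ (prodE p capN (coords nS nA) (fun=> 0%N)
   (fun g => \sum_(j < T) h j (pi j g) + (1 + \sum_(j < T) (pi j.+1 g != pi j g)%:R) * W))).
  apply: prodE_le => // g _.
  exact: (tracking_value PD (first_action nA_gt0) d1D (ell01 l01) (pol P d1 ls O g) H0 th0 (fun x y => thr y x) T).
have -> : prodE p capN (coords nS nA) (fun=> 0%N)
   (fun g => \sum_(j < T) h j (pi j g) + (1 + \sum_(j < T) (pi j.+1 g != pi j g)%:R) * W) =
   \sum_(j < T) prodE p capN (coords nS nA) (fun=> 0%N) (fun g => h j (pi j g)) +
   (1 + \sum_(j < T) prodE p capN (coords nS nA) (fun=> 0%N) (fun g => (pi j.+1 g != pi j g)%:R)) * W.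
  rewrite prodED prodE_sum; congr (_ + _).
  rewrite (eq_prodE _ _ _ _ (f' := fun g => W * (1 + \sum_(j < T) (pi j.+1 g != pi j g)%:R))).
    by rewrite prodEZ prodED prodE_cst prodE_sum mulrC.
  by move=> g; rewrite mulrC.
have bb := best_past_le_best; rewrite best_past_lossE // in bb.
have := ler_wpM2r W0 (lerD (lexx 1) bound2).
move: bound1; rewrite -/(L T _) -/B !mulrA; move: bb; rewrite -/p.
set X1 := \sum_(t < T) _; set X2 := \sum_(t < T) _ => bb bound1 b2.
move: X1 X2 bound1 b2 => X1 X2 bound1 b2. lra.
Qed.

End Regret.

Lemma half_le_ln2 (R : realType) : 1 / 2 <= ln 2 :> R.
Proof.
have /le_ln1Dx : -1 < - (1 / 2) :> R by lra.
have -> : 1 - 1 / 2 = 2^-1 :> R by lra.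
by rewrite lnV ?posrE //; lra.
Qed.

(** Since [ln 2 >= 1 / 2], the logarithm before rounding is at most [2 * ln m], and the 1 lost in
    rounding is again at most [2 * ln m]. *)
Lemma up_log_le_ln (R : realType) m : (1 < m)%N -> (up_log 2 m)%:R <= 4 * ln m%:R :> R.
Proof.
move=> m1; have /andP[lt_m _] := up_log_bounds (ltnSn 1) m1.
have ln_m : (up_log 2 m).-1%:R * ln 2 <= ln m%:R :> R.
  rewrite mulr_natl -lnXn // ler_ln ?posrE ?exprn_gt0 // ?ltr0n 1?ltnW //.
  by rewrite -natrX ler_nat ltnW.
have ln2_m : ln 2 <= ln m%:R :> R by rewrite ler_ln ?posrE ?ltr0n ?ler_nat // ltnW.
have lg0 : (0 < up_log 2 m)%N by rewrite up_log_gt0.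
rewrite -(prednK lg0) -natr1; have ln2 := half_le_ln2 R.
have : (up_log 2 m).-1%:R * (1 / 2) <= (up_log 2 m).-1%:R * ln 2 :> R by rewrite ler_wpM2l.
lra.
Qed.

(* With [x = Lstar] and [y = nS ln (nS nA) / alpha]. *)
Lemma scale_bound (R : realType) (b n x y : R) : 1 <= y -> y <= x -> 0 <= b <= 4 * y ->
  n = 2 \/ 2 <= n /\ (n - 1) ^+ 2 * b <= x -> b * n <= 8 * Num.sqrt (x * y).
Proof.
move=> y1 yx /andP[b0 b4].
have sy : y <= Num.sqrt (x * y).
  have y0 : 0 <= y by lra.
  by rewrite -[leLHS](ger0_norm y0) -sqrtr_sqr ler_wsqrtr // expr2; nra.
case=> [->|[n2 le_x]]; first by move: sy; lra.
have xy0 : 0 <= x * y by nra.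
rewrite -[8](@ger0_norm R) // -sqrtr_sqr -sqrtrM ?sqr_ge0 //.
have bn0 : 0 <= b * n by apply: mulr_ge0 => //; lra.
rewrite -(ger0_norm bn0) -sqrtr_sqr ler_wsqrtr //.
(* [n >= 2] gives [n <= 2 * (n - 1)], whence [b ^+ 2 * n ^+ 2 <= 16 * x * y]. *)
have h1 : n ^+ 2 <= 4 * (n - 1) ^+ 2 by rewrite !expr2; nra.
have h2 : n ^+ 2 * b <= 4 * x by have := ler_wpM2r b0 h1; rewrite -mulrA; lra.
have h3 := ler_wpM2r b0 h2.
have h4 : 4 * x * b <= 4 * x * (4 * y) by apply: ler_wpM2l => //; lra.
rewrite !expr2 in h3 *; nra.
Qed.

Section Bound.
Variables (R : realType) (nS nA : nat) (P : 'I_nS -> 'I_nA -> 'I_nS -> R).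
Hypotheses (nS_gt1 : (1 < nS)%N) (PD : forall s a, is_dist (P s a)).
Hypothesis comm : communicating P.
Variables (z : 'I_nS) (b : 'I_nA).
Hypothesis zz : P z b z = 1.
Local Notation D := (fine (diameter P)).

Let D1 : 1 <= D. Proof. by have [] := diameter_ge1 PD nS_gt1 comm. Qed.

(** The length [2 * K] with [K] the integer part of [2 * (D + 1)] is a candidate, since
    [4 * (D + 1) <= 8 * D <= T]. By [reach_lower] its ratio is at most [8 * K * K.+1], and
    [K <= 4 * D], [K.+1 <= 5 * D]. *)
Lemma chase_time T : 8 * D <= T%:R ->
  0 < (best_length P T).1 /\
  (best_length P T).2%:R / (best_length P T).1 <= 160 * D ^+ 2.
Proof.
move=> DT; have [/andP[H0 _] _ _ opt] := best_lengthP PD b T.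
set H := (best_length P T).2 in H0 opt *; set th := (best_length P T).1 in opt *.
have [K /andP[K_le K_gt]] : exists K, K%:R <= 2 * (D + 1) < K.+1%:R.
  by exists (Num.truncn (2 * (D + 1))); apply: truncn_itv; move: D1; lra.
have K1 : K.+1%:R = K%:R + 1 :> R by rewrite -natr1.
have K0 : (0 < K)%N by rewrite -(ltr0n R); move: K_gt D1; rewrite K1; lra.
have KT : ((K + K).-1 < T)%N.
  by rewrite prednK ?addn_gt0 ?K0 // -(ler_nat R) natrD; move: D1; lra.
have := opt _ KT; rewrite prednK ?addn_gt0 ?K0 // => le_th.
set c : R := 1 / (4 * K.+1%:R).
have c0 : 0 < c by rewrite divr_gt0 ?mulr_gt0 ?ltr0n.
have cw : c <= worst P (K + K).
  apply: le_worst => [|y x]; last exact: (reach_lower PD b x y nS_gt1 comm zz (ltW K_gt)).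
  by rewrite ler_pdivrMr ?mulr_gt0 ?ltr0n // mul1r K1; have : 0 <= K%:R :> R by []; lra.
have H1 : 0 < H%:R :> R by rewrite ltr0n.
have cH : c * H%:R <= th * (K + K)%:R by apply: le_trans le_th; rewrite ler_pM2r.
have KK : 0 < (K + K)%:R :> R by rewrite ltr0n addn_gt0 K0.
have th0 : 0 < th by rewrite -(pmulr_lgt0 _ KK) (lt_le_trans _ cH) ?mulr_gt0.
split=> //; rewrite ler_pdivrMr //.
have {}cH : H%:R <= 8 * (K%:R * K.+1%:R) * th.
  move: cH; rewrite /c mul1r [_^-1 * _]mulrC ler_pdivrMr ?mulr_gt0 ?ltr0n // natrD.
  by move/le_trans; apply; rewrite le_eqVlt; apply/orP; left; apply/eqP; ring.
apply: le_trans cH _; rewrite ler_pM2r // expr2.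
have : K%:R * K.+1%:R <= 4 * D * (5 * D).
  by apply: ler_pM => //; rewrite ?K1; move: D1; lra.
lra.
Qed.

End Bound.

(** The lower bound on [Lstar] serves the least scale 2: its cost is of order
    [nS * ln (nS * nA) / alpha], which must stay below the square root. The budget [time] is for
    each round. *)
Theorem theorem5p12 (R : realType) :
  exists (alg : cmd) (k : nat) (C : R),
  forall (nS nA : nat) (P : 'I_nS -> 'I_nA -> 'I_nS -> R) (d1 : 'I_nS -> R)
    (alpha : R) (O : seq (loss R nS nA) -> {ffun 'I_nS -> 'I_nA})
    (ls : seq (loss R nS nA)),
  (1 < nS)%N ->
  (forall s a, is_dist (P s a)) ->
  communicating P ->
  (exists (sstar : 'I_nS) (a : 'I_nA), P sstar a sstar = 1) ->
  is_dist d1 ->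
  0 < alpha -> (forall s, alpha <= d1 s) ->
  is_oracle P d1 O ->
  losses01 ls ->
  let time := (k * (nS + nA + size ls) ^ k)%N in
  let D := fine (diameter P) in
  let Lstar := best_loss P d1 ls in
  completes P d1 O time alg ls /\
  (nS%:R * ln (nS * nA)%:R / alpha <= Lstar ->
   regret P d1 O time alg ls
     <= C * (D ^+ 2 * Num.sqrt (Lstar * nS%:R * ln (nS * nA)%:R / alpha))).
Proof.
have [k cost_k] := cost_poly algorithm.
(* The constants add up to 18 * 8 + 160 + 16 * 8 * 160 = 20784. *)
exists algorithm, k, (21 * 1000) => nS nA P d1 alpha O ls nS_gt1 PD comm [z [b zz]] d1D al0 al_le
  oracle l01 /=.
have nS_gt0 := ltnW nS_gt1.
have nA_gt0 : (0 < nA)%N := leq_ltn_trans (leq0n b) (ltn_ord b).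
have d1_gt0 s : 0 < d1 s := lt_le_trans al0 (al_le s).
set n := (k * _ ^ k)%N; have costn : (cost (nS + nA + size ls) algorithm <= n)%N.
  by apply: cost_k; rewrite -addnA addn_gt0 nS_gt0.
have SA_gt1 : (1 < nS * nA)%N by rewrite (leq_trans nS_gt1) // leq_pmulr.
set y := nS%:R * ln (nS * nA)%:R / alpha; set Lstar := best_loss P d1 ls.
have lnSA : 1 / 2 <= ln (nS * nA)%:R :> R.
  by apply: le_trans (half_le_ln2 R) _; rewrite ler_ln ?posrE ?ltr0n ?ler_nat // ltnW.
have y_lg : 4 <= (nS%:R : R) ^+ 2 * (lgSA nS nA)%:R <= 4 * y.
  have S2 : 2 <= nS%:R :> R by rewrite ler_nat.
  apply/andP; split.
    have l1 : 1 <= (lgSA nS nA)%:R :> R by rewrite ler1n up_log_gt0.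
    apply: le_trans (_ : nS%:R ^+ 2 <= _); first by rewrite expr2; nra.
    by rewrite ler_peMr // exprn_ge0.
  (* The weights of [d1] sum to 1 and each is at least [alpha]; this trades [nS ^+ 2] for
     [nS / alpha]. *)
  have alS : alpha * nS%:R <= 1.
    have [_ d1_sum] := d1D; apply: le_trans (_ : \sum_s d1 s <= 1); last by rewrite d1_sum.
    by rewrite mulr_natr -[X in _ *+ X]card_ord -sumr_const ler_sum.
  rewrite /y mulrA ler_pdivlMr //.
  have := up_log_le_ln R SA_gt1; rewrite -/(lgSA nS nA).
  set lg : R := (lgSA nS nA)%:R; set q := ln _ => lgq.
  have lg0 : 0 <= lg by [].
  have : alpha * nS%:R * (nS%:R * lg) <= 1 * (nS%:R * lg) by rewrite ler_wpM2r ?mulr_ge0.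
  have : nS%:R * lg <= nS%:R * (4 * q) by rewrite ler_wpM2l.
  rewrite expr2; lra.
have y1 : 1 <= y by move/andP: y_lg => [] /le_trans h /h; lra.
(* Without rounds [Lstar] is at most 0, against [1 <= y <= Lstar]. *)
have [T0|T_gt0] := posnP (size ls).
  have ls0 : ls = [::] := size0nil T0.
  split.
    rewrite /completes /game ls0 /bind /ret /=; elim: (draw d1) => //= u e IH.
    by rewrite IH implybT.
  have : Lstar <= 0.
    apply: le_trans (ge_inf _ _) _; last 2 first.
      by exists [ffun=> b].
      by rewrite policy_loss_sum // ls0 /= big_ord0.
    exists 0 => _ [f _ <-]; rewrite policy_loss_sum // ls0 /= big_ord0 //.
  by move=> h1 h2; have := le_trans y1 (le_trans h2 h1); rewrite ler10.
split; first by have [] := game_value PD d1D O nS_gt1 nA_gt0 costn T_gt0.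
move=> y_le; set D := fine (diameter P).
have [_ D1] := diameter_ge1 PD nS_gt1 comm; rewrite -/D in D1.
have -> : Lstar * nS%:R * ln (nS * nA)%:R / alpha = Lstar * y by rewrite /y !mulrA.
rewrite /regret -/Lstar; set sq : R := Num.sqrt _.
have sq1 : 1 <= sq.
  rewrite /sq -[1]sqrtr1 ler_wsqrtr //; nra.
have D2 : D <= D ^+ 2 by rewrite expr2; nra.
have Dsq : D ^+ 2 <= D ^+ 2 * sq by rewrite ler_peMr ?exprn_ge0 // (le_trans _ D1).
(* A horizon below [8 * D] may not hold a chase of length [2 * K], but then the whole loss is below
   [8 * D]. *)
have [DT|TD] := lerP (8 * D) (size ls)%:R; last first.
  have := game_le_horizon PD d1D O nS_gt1 nA_gt0 costn T_gt0 l01.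
  lra.
have [th0 W_le] := chase_time nS_gt1 PD comm zz DT.
have := game_regret PD d1D d1_gt0 l01 oracle nS_gt1 nA_gt0 T_gt0 costn th0.
set B : R := nS%:R ^+ 2 * _ in y_lg *; set W := _ / _ in W_le *.
set m := (scale_at P d1 ls O (size ls) + 2)%N => le_regret.
have best_le := best_past_le_best PD d1D l01 oracle nA_gt0.
have lower := scale_lower PD d1D l01 oracle nS_gt1 nA_gt0 (leqnn (size ls)).
have m2 : 2 <= m%:R :> R by rewrite ler_nat leq_addl.
have /andP[B4 By] := y_lg.
have Bm : B * m%:R <= 8 * sq.
  apply: scale_bound => //; first by rewrite By andbT; lra.
  move: lower; rewrite -/m -/B => -[->|lt_m]; [by left | right; split=> //].
  exact/ltW/(lt_le_trans lt_m).
have Bm8 : 8 <= B * m%:R by nra.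
have W_le' : (1 + 16 * (B * m%:R)) * W <= (1 + 16 * (8 * sq)) * (160 * D ^+ 2).
  by rewrite ler_pM //; [lra | rewrite divr_ge0 // ltW | lra].
have sqD : sq * D ^+ 2 >= sq by rewrite ler_peMr //; lra.
rewrite -/m -/W -/B -/Lstar in le_regret; rewrite -/D in W_le' sqD *.
clearbody B m W Lstar D sq; move: le_regret; move: (expect _ _) => X le_regret.
move: W_le' Bm sqD Dsq le_regret => {}W_le {}Bm {}sqD {}Dsq; lra.
Qed.
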